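(* Let $k$ be an algebraically closed field and let $A$ be a connected basic finite-dimensional associative $k$-algebra with identity. Then $A$ is derived bounded if and only if $A$ is derived finite.
   Context: Modules are finite-dimensional right modules, and $D^b(A)$ is the bounded derived category of the category $\mathrm{mod}\,A$ of finite-dimensional right $A$-modules. For a nonzero $X^\bullet\in D^b(A)$ put $\mathrm{hl}(X^\bullet)=\max\{\dim_k H^i(X^\bullet)\mid i\in\mathbb{Z}\}$ (cohomological length), $\mathrm{hw}(X^\bullet)=\max\{j-i+1\mid H^i(X^\bullet)\neq 0\neq H^j(X^\bullet)\}$ (cohomological width), and $\mathrm{hr}(X^\bullet)=\mathrm{hl}(X^\bullet)\cdot \mathrm{hw}(X^\bullet)$ (cohomological range). The global cohomological range is $\mathrm{gl.hr}\,A=\sup\{\mathrm{hr}(X^\bullet)\mid X^\bullet\in D^b(A)\text{ indecomposable}\}$. The algebra $A$ is derived bounded if $\mathrm{gl.hr}\,A<\infty$. The algebra $A$ is derived finite if, up to shift and isomorphism, there are only finitely many indecomposable objects in $D^b(A)$. *)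

(* Defs.v *)
From HB Require Import structures.
From mathcomp Require Import all_boot all_order all_algebra all_field.

Set Implicit Arguments.
Unset Strict Implicit.
Unset Printing Implicit Defensive.

Import GRing.Theory.
Local Open Scope ring_scope.

Section Modules.
Variables (k : fieldType) (A : falgType k).

(* [ract a] is the map [v |-> v . a]. *)
Record rmodule := RModule {
  carrier :> vectType k;
  ract : A -> 'End(carrier);
  ract_linear : linear ract;
  ract1 : ract 1 = \1%VF;
  ractM : forall a b, ract (a * b) = (ract b \o ract a)%VF }.

Definition is_rmorph (M N : rmodule) (f : 'Hom(M, N)) : Prop :=
  forall a, (f \o ract M a)%VF = (ract N a \o f)%VF.

Definition rmod_iso (M N : rmodule) : Prop :=
  exists (f : 'Hom(M, N)) (g : 'Hom(N, M)),
    [/\ is_rmorph f, is_rmorph g, (g \o f)%VF = \1%VF & (f \o g)%VF = \1%VF].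

Lemma rmorph_id (M : rmodule) : is_rmorph (\1%VF : 'End(M)).
Proof. by move=> a; rewrite comp_lfun1l comp_lfun1r. Qed.

Lemma rmorph0 (M N : rmodule) : is_rmorph (0 : 'Hom(M, N)).
Proof. by move=> a; rewrite comp_lfun0l comp_lfun0r. Qed.

Lemma rmorphZ (M N : rmodule) (c : k) (f : 'Hom(M, N)) :
  is_rmorph f -> is_rmorph (c *: f).
Proof. by move=> fP a; rewrite -comp_lfunZl -comp_lfunZr fP. Qed.

Lemma rmorph_comp (M N P : rmodule) (f : 'Hom(M, N)) (g : 'Hom(N, P)) :
  is_rmorph f -> is_rmorph g -> is_rmorph (g \o f)%VF.
Proof. by move=> fP gP a; rewrite -comp_lfunA fP !comp_lfunA gP. Qed.

Definition rmod0 : rmodule.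
Proof.
by refine (@RModule 'rV[k]_0 (fun=> 0) _ _ _) => [c a b||a b];
  apply/lfunP => v; rewrite [LHS]thinmx0 [RHS]thinmx0.
Defined.

Definition lfun_prod (U V U' V' : vectType k) (f : 'Hom(U, U')) (g : 'Hom(V, V')) :
  'Hom((U * V)%type, (U' * V')%type) := linfun (fun p => (f p.1, g p.2)).

Lemma lfun_prodE (U V U' V' : vectType k) (f : 'Hom(U, U')) (g : 'Hom(V, V')) p :
  lfun_prod f g p = (f p.1, g p.2).
Proof.
have lin : linear (fun p : U * V => (f p.1, g p.2)).
  by move=> c p1 p2; rewrite /= !linearP.
pose h := GRing.isLinear.Build k (U * V)%type (U' * V')%type _ _ lin.
pose F : {linear (U * V)%type -> (U' * V')%type} := HB.pack (fun p : U * V => (f p.1, g p.2)) h.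
exact: (lfunE F).
Qed.

Lemma lfun_prod_comp (U V U' V' U'' V'' : vectType k) (f : 'Hom(U, U'))
    (g : 'Hom(V, V')) (f' : 'Hom(U', U'')) (g' : 'Hom(V', V'')) :
  (lfun_prod f' g' \o lfun_prod f g)%VF = lfun_prod (f' \o f)%VF (g' \o g)%VF.
Proof. by apply/lfunP => p; rewrite comp_lfunE !lfun_prodE !comp_lfunE. Qed.

Lemma lfun_prod0 (U V U' V' : vectType k) :
  lfun_prod (0 : 'Hom(U, U')) (0 : 'Hom(V, V')) = 0.
Proof. by apply/lfunP => p; rewrite lfun_prodE !lfunE. Qed.

Definition rmod_sum (M N : rmodule) : rmodule.
Proof.
refine (@RModule (M * N)%type (fun a => lfun_prod (ract M a) (ract N a)) _ _ _).
- move=> c a b; apply/lfunP => p.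
  rewrite lfun_prodE !ract_linear [RHS]lfunE /= [X in _ = X + _]lfunE /=.
  by rewrite !lfun_prodE; congr pair; do 2!rewrite lfunE /=.
- by apply/lfunP => -[u v]; rewrite lfun_prodE !ract1 !lfunE.
- by move=> a b; rewrite !ractM lfun_prod_comp.
Defined.

Lemma rmorph_prod (M N M' N' : rmodule) (f : 'Hom(M, M')) (g : 'Hom(N, N')) :
  is_rmorph f -> is_rmorph g ->
  is_rmorph (lfun_prod f g : 'Hom(rmod_sum M N, rmod_sum M' N')).
Proof. by move=> fP gP a; rewrite /= !lfun_prod_comp fP gP. Qed.

(* The right ideal [eA], as a subspace of A. *)
Definition rideal (e : A) : {vspace A} := limg (amull e).

Lemma rideal_stable (e : A) (u : subvs_of (rideal e)) (a : A) :
  vsval u * a \in rideal e.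
Proof.
have /memv_imgP[x _ ->] := subvsP u.
have -> : amull e x * a = amull e (x * a) by rewrite !lfunE /= mulrA.
by rewrite memv_img ?memvf.
Qed.

Definition rideal_act (e a : A) : 'End(subvs_of (rideal e)) :=
  (linfun (vsproj (rideal e)) \o (amulr a \o linfun vsval))%VF.

Lemma rideal_actE (e a : A) (u : subvs_of (rideal e)) :
  vsval (rideal_act e a u) = vsval u * a.
Proof. by rewrite !comp_lfunE !lfunE /= vsprojK ?rideal_stable. Qed.

Definition rideal_mod (e : A) : rmodule.
Proof.
refine (@RModule (subvs_of (rideal e)) (rideal_act e) _ _ _).
- move=> c a b; apply/lfunP => u; apply: val_inj => /=.
  rewrite rideal_actE lfunE /= lfunE mulrDr -scalerAr.
  by rewrite -!rideal_actE.
- by apply/lfunP => u; apply: val_inj; rewrite /= rideal_actE mulr1 lfunE.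
- move=> a b; apply/lfunP => u; apply: val_inj.
  by rewrite /= comp_lfunE !rideal_actE mulrA.
Defined.

Definition idempotent_elt (e : A) : Prop := e * e = e.

Definition primitive_idempotent (e : A) : Prop :=
  [/\ e != 0, idempotent_elt e &
    forall f g, idempotent_elt f -> idempotent_elt g ->
      f * g = 0 -> g * f = 0 -> e = f + g -> f = 0 \/ g = 0].

Definition complete_primitive_orthogonal n (e : 'I_n -> A) : Prop :=
  [/\ forall i, primitive_idempotent (e i),
      forall i j, i != j -> e i * e j = 0 &
      \sum_i e i = 1].

Definition basic_algebra : Prop :=
  exists n (e : 'I_n -> A), complete_primitive_orthogonal e /\
    forall i j, i != j -> ~ rmod_iso (rideal_mod (e i)) (rideal_mod (e j)).

Definition connected_algebra : Prop :=
  forall e : A, idempotent_elt e -> (forall a, e * a = a * e) -> e = 0 \/ e = 1.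

End Modules.

Section Complexes.
Variables (k : fieldType) (A : falgType k).

(* The differential is indexed by both of its ends and vanishes unless they are *)
(* consecutive, so that no transport along [i - 1 + 1 = i] is ever needed.      *)
(* [cbound] is any half-width of a window containing the support; nothing below *)
(* depends on the particular value.                                             *)
Record complex := Complex {
  cobj :> int -> rmodule A;
  cdiff : forall i j, 'Hom(cobj i, cobj j);
  cdiff_rmorph : forall i j, is_rmorph (cdiff i j);
  cdiff_shape : forall i j, j != i + 1 -> cdiff i j = 0;
  cdiffK : forall i j l, (cdiff j l \o cdiff i j)%VF = 0;
  cbound : nat;
  cboundP : forall i : int, (cbound < `|i|)%N -> forall v : cobj i, v = 0 }.

Definition cocycles (X : complex) (i : int) : {vspace X i} :=
  lker (cdiff X i (i + 1)).
Definition coboundaries (X : complex) (i : int) : {vspace X i} :=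
  limg (cdiff X (i - 1) i).

Lemma coboundaries_sub X i : (coboundaries X i <= cocycles X i)%VS.
Proof.
apply/subvP => _ /memv_imgP[v _ ->].
by rewrite memv_ker -comp_lfunE cdiffK lfunE.
Qed.

(* dim_k H^i(X), where H^i(X) = cocycles / coboundaries. *)
Definition hdim (X : complex) (i : int) : nat :=
  (\dim (cocycles X i) - \dim (coboundaries X i))%N.

Record cmap (X Y : complex) := CMap {
  cfun :> forall i, 'Hom(X i, Y i);
  cfun_rmorph : forall i, is_rmorph (cfun i);
  cfun_diff : forall i j,
    (cfun j \o cdiff X i j)%VF = (cdiff Y i j \o cfun i)%VF }.

Definition cmap_id (X : complex) : cmap X X.
Proof.
refine (@CMap X X (fun i => \1%VF) (fun i => rmorph_id _) _).
by move=> i j; rewrite comp_lfun1l comp_lfun1r.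
Defined.

Definition cmap_comp (X Y Z : complex) (g : cmap Y Z) (f : cmap X Y) : cmap X Z.
Proof.
refine (@CMap X Z (fun i => (g i \o f i)%VF)
          (fun i => rmorph_comp (cfun_rmorph f i) (cfun_rmorph g i)) _).
by move=> i j; rewrite -comp_lfunA cfun_diff !comp_lfunA cfun_diff.
Defined.

Definition homotopic (X Y : complex) (f g : cmap X Y) : Prop :=
  exists h : forall i j, 'Hom(X i, Y j),
    (forall i j, is_rmorph (h i j)) /\
    forall i, f i - g i = (cdiff Y (i - 1) i \o h i (i - 1)%R)%VF
                        + (h (i + 1)%R i \o cdiff X i (i + 1))%VF.

(* The two clauses say that the maps H^i(f) are injective, resp. surjective. *)
Definition quasi_iso (X Y : complex) (f : cmap X Y) : Prop :=
  forall i,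
    (forall x, x \in cocycles X i -> f i x \in coboundaries Y i ->
       x \in coboundaries X i) /\
    (forall y, y \in cocycles Y i ->
       exists2 x, x \in cocycles X i & y - f i x \in coboundaries Y i).

Lemma quasi_iso_id X : quasi_iso (cmap_id X).
Proof.
move=> i; split=> [x _|y yZ]; first by rewrite lfunE.
by exists y => //; rewrite lfunE /= subrr mem0v.
Qed.

Definition complex0 : complex.
Proof.
refine (@Complex (fun=> rmod0 A) (fun _ _ => 0) (fun _ _ => rmorph0 _ _)
          (fun _ _ _ => erefl) _ 0%N _).
- by move=> i j l; rewrite comp_lfun0l.
- by move=> i _ v; rewrite [LHS]thinmx0 [RHS]thinmx0.
Defined.

Definition complex_sum (X Y : complex) : complex.
Proof.
refine (@Complex (fun i => rmod_sum (X i) (Y i))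
  (fun i j => lfun_prod (cdiff X i j) (cdiff Y i j))
  (fun i j => rmorph_prod (cdiff_rmorph X i j) (cdiff_rmorph Y i j)) _ _
  (maxn (cbound X) (cbound Y)) _).
- by move=> i j ij; rewrite !cdiff_shape // lfun_prod0.
- by move=> i j l; rewrite lfun_prod_comp !cdiffK lfun_prod0.
- move=> i; rewrite gtn_max => /andP[Xi Yi] [u v].
  by rewrite (cboundP Xi u) (cboundP Yi v).
Defined.

(* X[n]^i = X^(n+i), with differential (-1)^n d. *)
Definition shift (n : int) (X : complex) : complex.
Proof.
refine (@Complex (fun i => X (n + i)%R)
  (fun i j => (-1) ^ n *: cdiff X (n + i) (n + j))
  (fun i j => rmorphZ _ (cdiff_rmorph X _ _)) _ _ (cbound X + `|n|)%N _).
- move=> i j ij; rewrite cdiff_shape ?scaler0 //.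
  by rewrite -addrA (inj_eq (addrI n)).
- by move=> i j l; rewrite -comp_lfunZl -comp_lfunZr cdiffK !scaler0.
- move=> i lti; apply: cboundP; rewrite -(ltn_add2r `|n|).
  apply: leq_trans lti _; rewrite -[i in `|i|%N](addKr n) addrC.
  by apply: leq_trans (leqD_dist _ 0 _) _; rewrite !subr0 ?sub0r ?abszN.
Defined.

(* Objects are bounded complexes; a morphism X -> Y is a roof                   *)
(*   X <-- apex --> Y   with left leg a quasi-isomorphism,                      *)
(* taken modulo [roof_eq].  As legs are compared up to homotopy, this is the    *)
(* localization of the homotopy category K^b(mod A) at the quasi-isomorphisms.  *)
Record roof (X Y : complex) := Roof {
  apex : complex;
  lleg : cmap apex X;
  lleg_qis : quasi_iso lleg;
  rleg : cmap apex Y }.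

Definition roof_eq (X Y : complex) (r s : roof X Y) : Prop :=
  exists (V : complex) (u : cmap V (apex r)) (v : cmap V (apex s)),
    [/\ quasi_iso (cmap_comp (lleg r) u),
        homotopic (cmap_comp (lleg r) u) (cmap_comp (lleg s) v) &
        homotopic (cmap_comp (rleg r) u) (cmap_comp (rleg s) v)].

Definition roof_id (X : complex) : roof X X :=
  Roof (@quasi_iso_id X) (cmap_id X).

(* [t] represents the composite of [r] followed by [s], computed by completing  *)
(* the two inner legs to a square commuting up to homotopy.                     *)
Definition roof_comp (X Y Z : complex) (r : roof X Y) (s : roof Y Z)
    (t : roof X Z) : Prop :=
  exists (V : complex) (u : cmap V (apex r)) (v : cmap V (apex s))
         (q : quasi_iso (cmap_comp (lleg r) u)),
    homotopic (cmap_comp (rleg r) u) (cmap_comp (lleg s) v) /\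
    roof_eq t (Roof q (cmap_comp (rleg s) v)).

Definition db_iso (X Y : complex) : Prop :=
  exists (r : roof X Y) (s : roof Y X),
    roof_comp r s (roof_id X) /\ roof_comp s r (roof_id Y).

Definition db_zero (X : complex) : Prop := db_iso X complex0.

Definition db_indecomposable (X : complex) : Prop :=
  ~ db_zero X /\
  forall Y Z, db_iso X (complex_sum Y Z) -> db_zero Y \/ db_zero Z.

(* The degree [- cbound X + i]; as [i] runs over ['I_(cbound X).*2.+1] these    *)
(* degrees exhaust the support of X.                                            *)
Definition wdeg (X : complex) (i : nat) : int := i%:Z - (cbound X)%:Z.

Definition hl (X : complex) : nat :=
  \max_(i < (cbound X).*2.+1) hdim X (wdeg X i).

(* Pairs with j < i never achieve the maximum, since i = j is allowed. *)
Definition hw (X : complex) : nat :=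
  \max_(i < (cbound X).*2.+1)
    \max_(j < (cbound X).*2.+1 |
            [&& (i <= j)%N, hdim X (wdeg X i) != 0%N & hdim X (wdeg X j) != 0%N])
      (j - i + 1)%N.

Definition hr (X : complex) : nat := (hl X * hw X)%N.

End Complexes.

(* gl.hr A < oo: the supremum of [hr] over the indecomposables is finite. *)
Definition derived_bounded (k : fieldType) (A : falgType k) : Prop :=
  exists N : nat, forall X : complex A, db_indecomposable X -> (hr X <= N)%N.

Definition derived_finite (k : fieldType) (A : falgType k) : Prop :=
  exists (n : nat) (Y : 'I_n -> complex A),
    forall X : complex A, db_indecomposable X ->
      exists (i : 'I_n) (m : int), db_iso X (shift m (Y i)).

(* Main.v *)
(* If [derived_finite] holds then the invariant [hr] takes finitely many values, being
   invariant under isomorphism and shift.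

   Conversely let [hr <= N] on indecomposables.  Truncate a projective resolution of a
   complex far below its cohomology and split it into complexes of projectives without
   nontrivial idempotent.  No summand can have cohomology both at the bottom and near the
   top, so discarding the bottom ones leaves a bounded projective model whose size is
   controlled by the cohomology alone; in particular indecomposables have projective models
   of total dimension at most some [M].

   The rest is Auslander's argument for the first Brauer-Thrall conjecture.  Let [Y] be an
   indecomposable complex of projectives.  A functional on graded endomorphisms of [Y] which
   kills the chain maps that are not isomorphisms and null-homotopic maps, but not the
   identity, gives by Serre duality a map [Y -> nu Y].  Its cocone [E -> Y] is right almost
   split: it has no section, and every map to [Y] that is not a split epimorphism factors
   through it.  Start with a projective model [T] of the dual of [A], to which every complex
   with cohomology in degree [0] has a nonzero map.  If [X] is none of the finitely many
   summands obtained by iterating [E] from [T] up to [2 ^ M - 1] times, then a nonzero map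
   from [X] to [T] factors through a nonzero composite of [2 ^ M - 1] non-isomorphisms between
   indecomposables of total dimension at most [M], against the Harada-Sai lemma. *)

Require Import Defs.
From HB Require Import structures.
From mathcomp Require Import all_boot all_order all_algebra all_field.
From mathcomp Require Import boolp zify.
From Stdlib Require List.

Set Implicit Arguments.
Unset Strict Implicit.
Unset Printing Implicit Defensive.

Import GRing.Theory VectorInternalTheory.
Local Open Scope ring_scope.

(** * Linear algebra and modules *)

Arguments ract : simpl never.

(** Two constructions lead out of bounded complexes of projectives: projective resolutions may be
    infinite, and the cocone [E] has injective modules among its summands, because [nu] turns
    projectives into injectives. The bound on [hr] repairs both at once, since it gives every
    bounded complex, [E] included, a bounded projective model; this is what allows almost split
    triangles to be iterated. Decompositions, isomorphisms and ranks are taken for strict chain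
    maps, where Fitting's lemma and dimension counts apply directly; only vanishing is read up to
    homotopy. The link with the derived category is that maps out of complexes of projectives lift,
    up to homotopy, along quasi-isomorphisms. In this strict setting contractible complexes are
    present too; they are kept out of the Harada-Sai argument by following a composite that is not
    null-homotopic. Maps to [T] detect cohomology in degree 0 only, so an indecomposable has to be
    shifted first: hence finiteness up to shift. *)

Definition lfE := (add_lfunE, opp_lfunE, zero_lfunE, scale_lfunE, comp_lfunE, id_lfunE).

Lemma dchoice (T : Type) (F : T -> Type) (P : forall t, F t -> Prop) :
  (forall t, exists x, P t x) -> exists f : forall t, F t, forall t, P t (f t).
Proof. by move=> H; exists (fun t => projT1 (cid (H t))) => t; case: (cid (H t)). Qed.

Section LinearAlgebra.
Variable k : fieldType.
Implicit Types U V W : vectType k.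

Lemma linfun_linE U V (f : U -> V) : linear f -> linfun f =1 f.
Proof.
move=> lin; pose h := GRing.isLinear.Build k U V _ f lin.
pose F : {linear U -> V} := HB.pack f h.
exact: (lfunE F).
Qed.

(** Among the subspaces contained in [P] one has maximal dimension; adding the line of a vector of
    [P] stays inside [P], so that vector was already there. This turns conditions stated in [Prop],
    such as not being an isomorphism, into subspaces. *)
Lemma vspace_of V (P : V -> Prop) : P 0 ->
  (forall c x y, P x -> P y -> P (c *: x + y)) ->
  {U : {vspace V} | forall v, v \in U <-> P v}.
Proof.
move=> P0 PL; apply: cid.
pose Q n := `[< exists U : {vspace V}, (forall v, v \in U -> P v) /\ \dim U = n >].
have exQ : exists n, Q n.
  exists 0%N; apply/asboolP; exists 0%VS; split; last by rewrite dimv0.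
  by move=> v; rewrite memv0 => /eqP->.
have ubQ n : Q n -> (n <= \dim {:V})%N.
  by move=> /asboolP[U [_ <-]]; apply/dimvS/subvf.
have [n /asboolP[U [UP <-]] maxU] := ex_maxnP exQ ubQ.
exists U => v; split; first exact: UP.
move=> Pv; have /maxU le : Q (\dim (<[v]> + U)%VS).
  apply/asboolP; exists (<[v]> + U)%VS; split=> // w /memv_addP[x /vlineP[c ->] [y yU ->]].
  by apply: PL => //; exact: UP.
have /eqP -> : U == (<[v]> + U)%VS by rewrite eqEdim addvSr le.
by apply: subvP (addvSl _ _) _ _; exact: memv_line.
Qed.

Lemma functional_sep V (U : {vspace V}) v : v \notin U ->
  exists f : 'Hom(V, k^o), (forall u, u \in U -> f u = 0) /\ f v = 1.
Proof.
move=> vU; pose x := v - projv U v.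
have x0 : v2r x != 0.
  apply: contraNneq vU; rewrite -[RHS](linear0 (@v2r _ V)) => /v2r_inj/eqP.
  by rewrite subr_eq0 => /eqP->; exact: memv_proj.
have [j xj] : exists j, v2r x 0 j != 0.
  apply: contrapT => H; case/eqP: x0; apply/rowP => j; rewrite mxE.
  by apply/eqP/negPn/negP => Hj; apply: H; exists j.
have lin : linear (fun y : V => (v2r x 0 j)^-1 * v2r (y - projv U y) 0 j : k^o).
  move=> c y z; rewrite linearP opprD addrACA -scalerBr linearP !mxE mulrDr.
  by rewrite mulrCA.
exists (linfun (fun y : V => (v2r x 0 j)^-1 * v2r (y - projv U y) 0 j : k^o)); split.
- by move=> u uU; rewrite linfun_linE // projv_id // subrr linear0 mxE mulr0.
- by rewrite linfun_linE // mulVf.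
Qed.

(** Precomposing [D] with the projection on [U] makes the generalized inverse choose preimages that
    can be moved into [U], where the hypothesis compares them. *)
Lemma functional_factor V W (U : {vspace V}) (D : 'Hom(V, W)) (f : 'Hom(V, k^o)) :
  (forall u, u \in U -> D u = 0 -> f u = 0) ->
  exists g : 'Hom(W, k^o), forall u, u \in U -> f u = g (D u).
Proof.
move=> H; pose E := (D \o projv U)%VF.
exists ((f \o projv U) \o E^-1)%VF => u uU.
have Eu : E u = D u by rewrite comp_lfunE projv_id.
have EV : D (projv U ((E^-1)%VF (D u))) = D u.
  rewrite -[LHS](comp_lfunE D); apply: (@limg_lfunVK _ _ _ E).
  by rewrite -Eu memv_img ?memvf.
rewrite !comp_lfunE; apply/eqP; rewrite -subr_eq0 -linearB; apply/eqP.
apply: H; first by rewrite memvB ?memv_proj.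
by rewrite linearB /= EV subrr.
Qed.

End LinearAlgebra.

Section Modules.
Variables (k : fieldType) (A : falgType k).
Implicit Types M N P : rmodule A.

Lemma ract_rmap M N (f : 'Hom(M, N)) a x :
  is_rmorph f -> f (ract M a x) = ract N a (f x).
Proof. by move=> /(_ a)/lfunP/(_ x); rewrite !comp_lfunE. Qed.

Lemma is_rmorphI M N (f : 'Hom(M, N)) :
  (forall a x, f (ract M a x) = ract N a (f x)) -> is_rmorph f.
Proof. by move=> H a; apply/lfunP => x; rewrite !comp_lfunE. Qed.

Lemma is_rmorphD M N (f g : 'Hom(M, N)) : is_rmorph f -> is_rmorph g -> is_rmorph (f + g).
Proof. by move=> fP gP; apply: is_rmorphI => a x; rewrite !lfE linearD !ract_rmap. Qed.

Lemma is_rmorphN M N (f : 'Hom(M, N)) : is_rmorph f -> is_rmorph (- f).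
Proof. by move=> fP; apply: is_rmorphI => a x; rewrite !lfE linearN !ract_rmap. Qed.

Lemma is_rmorph_inv M N (f : 'Hom(M, N)) :
  lker f == 0%VS -> limg f = fullv -> is_rmorph f -> is_rmorph (f^-1)%VF.
Proof.
move=> /lker0P fI f1 fP; apply: is_rmorphI => a x; apply: fI.
by rewrite (ract_rmap _ _ fP) !limg_lfunVK ?f1 ?memvf.
Qed.

Lemma ract_linearl M c a b x : ract M (c *: a + b) x = c *: ract M a x + ract M b x.
Proof. by rewrite ract_linear !lfE. Qed.

Lemma ract0l M x : ract M 0 x = 0.
Proof. by have := ract_linearl (-1) 0 0 x; rewrite scaler0 addr0 scaleN1r addNr. Qed.

Lemma ractZl M c a x : ract M (c *: a) x = c *: ract M a x.
Proof. by rewrite -[c *: a]addr0 ract_linearl ract0l addr0. Qed.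

Lemma ract1E M x : ract M 1 x = x.
Proof. by rewrite ract1 id_lfunE. Qed.

Lemma ractME M a b x : ract M (a * b) x = ract M b (ract M a x).
Proof. by rewrite ractM comp_lfunE. Qed.

Definition regmod : rmodule A.
Proof.
refine (@RModule k A A (fun a => amulr a) _ _ _).
- by move=> c a b; apply/lfunP => x; rewrite linearP.
- by apply/lfunP => x; rewrite !lfunE /= mulr1.
- by move=> a b; apply/lfunP => x; rewrite comp_lfunE !lfunE /= mulrA.
Defined.

Lemma regmodE a (x : regmod) : ract regmod a x = (x : A) * a.
Proof. by rewrite lfunE. Qed.

Definition gen_map M N n (f : 'I_n -> 'Hom(M, A)) (b : 'I_n -> N) : 'Hom(M, N) :=
  linfun (fun x => \sum_i ract N (f i x) (b i)).

Lemma gen_mapE M N n (f : 'I_n -> 'Hom(M, A)) (b : 'I_n -> N) x :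
  gen_map f b x = \sum_i ract N (f i x) (b i).
Proof.
rewrite linfun_linE // => c y z; rewrite scaler_sumr -big_split /=.
by apply: eq_bigr => i _; rewrite linearP ract_linearl.
Qed.

Lemma gen_map_rmorph M N n (f : 'I_n -> 'Hom(M, A)) (b : 'I_n -> N) :
  (forall i, is_rmorph (f i : 'Hom(M, regmod))) -> is_rmorph (gen_map f b).
Proof.
move=> fP; apply: is_rmorphI => a x; rewrite !gen_mapE linear_sum /=.
by apply: eq_bigr => i _; rewrite (ract_rmap _ _ (fP i)) regmodE ractME.
Qed.

(* Projectivity, encoded by the existence of a finite dual basis. *)
Definition projective M : Prop :=
  exists (n : nat) (x : 'I_n -> M) (f : 'I_n -> 'Hom(M, A)),
    (forall i, is_rmorph (f i : 'Hom(M, regmod))) /\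
    forall v, v = \sum_i ract M (f i v) (x i).

Lemma projective_lift M N P (f : 'Hom(M, P)) (g : 'Hom(N, P)) :
  projective M -> is_rmorph f -> is_rmorph g -> (limg f <= limg g)%VS ->
  exists2 h : 'Hom(M, N), is_rmorph h & forall x, g (h x) = f x.
Proof.
move=> [n [x [e [eP xE]]]] fP gP le.
exists (gen_map e (fun i => (g^-1)%VF (f (x i)))); first exact: gen_map_rmorph.
move=> v; rewrite gen_mapE linear_sum /= [in RHS](xE v) linear_sum /=.
apply: eq_bigr => i _; rewrite !ract_rmap // limg_lfunVK //.
by apply: (subvP le); rewrite memv_img ?memvf.
Qed.

Lemma projective_retract M N (i : 'Hom(M, N)) (r : 'Hom(N, M)) :
  is_rmorph i -> is_rmorph r -> (forall x, r (i x) = x) -> projective N -> projective M.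
Proof.
move=> iP rP ri [n [x [e [eP xE]]]].
exists n, (fun j => r (x j)), (fun j => (e j \o i)%VF); split.
  by move=> j; apply: (@rmorph_comp k A M N regmod).
move=> v; rewrite -[LHS]ri [i v in LHS]xE linear_sum /=.
by apply: eq_bigr => j _; rewrite ract_rmap // comp_lfunE.
Qed.

Lemma inl_lin (U V : vectType k) : linear (fun x : U => (x, 0 : V)).
Proof. by move=> c x y; apply: injective_projections; rewrite /= ?scaler0 ?addr0. Qed.
Lemma inr_lin (U V : vectType k) : linear (fun x : V => (0 : U, x)).
Proof. by move=> c x y; apply: injective_projections; rewrite /= ?scaler0 ?addr0. Qed.

Definition lfst (U V : vectType k) : 'Hom((U * V)%type, U) := linfun (fun p => p.1).
Definition lsnd (U V : vectType k) : 'Hom((U * V)%type, V) := linfun (fun p => p.2).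
Definition linl (U V : vectType k) : 'Hom(U, (U * V)%type) := linfun (fun x => (x, 0)).
Definition linr (U V : vectType k) : 'Hom(V, (U * V)%type) := linfun (fun x => (0, x)).
Lemma lfstE U V p : lfst U V p = p.1. Proof. by rewrite linfun_linE. Qed.
Lemma lsndE U V p : lsnd U V p = p.2. Proof. by rewrite linfun_linE. Qed.
Lemma linlE U V x : linl U V x = (x, 0).
Proof. by rewrite linfun_linE //; exact: inl_lin. Qed.
Lemma linrE U V x : linr U V x = (0, x).
Proof. by rewrite linfun_linE //; exact: inr_lin. Qed.

Lemma rmod_sumE M N a p : ract (rmod_sum M N) a p = (ract M a p.1, ract N a p.2).
Proof. by rewrite /= lfun_prodE. Qed.

Lemma lfst_rmorph M N : is_rmorph (lfst M N : 'Hom(rmod_sum M N, M)).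
Proof. by apply: is_rmorphI => a x; rewrite rmod_sumE !lfstE. Qed.
Lemma lsnd_rmorph M N : is_rmorph (lsnd M N : 'Hom(rmod_sum M N, N)).
Proof. by apply: is_rmorphI => a x; rewrite rmod_sumE !lsndE. Qed.
Lemma linl_rmorph M N : is_rmorph (linl M N : 'Hom(M, rmod_sum M N)).
Proof. by apply: is_rmorphI => a x; rewrite rmod_sumE !linlE linear0. Qed.
Lemma linr_rmorph M N : is_rmorph (linr M N : 'Hom(N, rmod_sum M N)).
Proof. by apply: is_rmorphI => a x; rewrite rmod_sumE !linrE linear0. Qed.

Lemma projective_sum M N : projective M -> projective N -> projective (rmod_sum M N).
Proof.
move=> [m [x [e [eP xE]]]] [n [y [f [fP yE]]]].
exists (m + n)%N, (fun i => match split i with inl i => linl M N (x i) | inr i => linr M N (y i) end),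
  (fun i => match split i with inl i => (e i \o lfst M N)%VF | inr i => (f i \o lsnd M N)%VF end); split.
  move=> i; case: (split i) => j.
    by apply: (@rmorph_comp k A (rmod_sum M N) M regmod) => //; exact: lfst_rmorph.
  by apply: (@rmorph_comp k A (rmod_sum M N) N regmod) => //; exact: lsnd_rmorph.
move=> v; rewrite big_split_ord /=.
under eq_bigr => i _.
  rewrite (unsplitK (inl i : 'I_m + 'I_n)) comp_lfunE lfstE -(ract_rmap _ _ (@linl_rmorph M N)); over.
under [in X in _ + X]eq_bigr => i _.
  rewrite (unsplitK (inr i : 'I_m + 'I_n)) comp_lfunE lsndE -(ract_rmap _ _ (@linr_rmorph M N)); over.
rewrite -!(linear_sum (linl _ _)) -!(linear_sum (linr _ _)) /= -xE -yE linlE linrE.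
by case: v => a b; congr pair; rewrite /= ?addr0 ?add0r.
Qed.

Lemma projective0 M : (forall v : M, v = 0) -> projective M.
Proof.
move=> M0; exists 0%N, (fun=> 0), (fun=> 0); split; first by case.
by move=> v; rewrite big_ord0.
Qed.

(** * Free modules on a vector space *)

Section Free.
Variable W : vectType k.
Local Notation n := (dim W).

Definition free_act (a : A) : 'End({ffun 'I_n -> A}) :=
  linfun (fun v : {ffun 'I_n -> A} => [ffun j => v j * a] : {ffun 'I_n -> A}).

Lemma free_actE a v : free_act a v = [ffun j => v j * a].
Proof.
rewrite linfun_linE // => c x y; apply/ffunP => j.
by rewrite !ffunE mulrDl scalerAl.
Qed.

(** This is the tensor product of [W] with [A] over [k], written in the coordinates of [W];
    [free_ex] and [free_ext] give its universal property. *)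
Definition free_mod : rmodule A.
Proof.
refine (@RModule k A {ffun 'I_n -> A} free_act _ _ _).
- move=> c a b; apply/lfunP => x; apply/ffunP => j.
  by rewrite !lfE !free_actE !ffunE mulrDr scalerAr.
- by apply/lfunP => x; apply/ffunP => j; rewrite free_actE lfE ffunE mulr1.
- by move=> a b; apply/lfunP => x; apply/ffunP => j; rewrite !lfE !free_actE !ffunE mulrA.
Defined.

Definition free_unit : 'Hom(W, free_mod) :=
  linfun (fun w => [ffun j => (v2r w 0 j)%:A] : {ffun 'I_n -> A}).

Lemma free_unitE w : free_unit w = [ffun j => (v2r w 0 j)%:A].
Proof.
rewrite linfun_linE // => c x y; apply/ffunP => j.
by rewrite !ffunE linearP !mxE scalerDl scalerA.
Qed.

Definition free_gen (j : 'I_n) : free_mod := free_unit (r2v (delta_mx 0 j)).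
Definition free_coord (j : 'I_n) : 'Hom(free_mod, A) :=
  linfun (fun v : {ffun 'I_n -> A} => v j).

Lemma free_coordE j v : free_coord j v = (v : {ffun 'I_n -> A}) j.
Proof. by rewrite linfun_linE // => c x y; rewrite !ffunE. Qed.

Lemma free_coord_rmorph j : is_rmorph (free_coord j : 'Hom(free_mod, regmod)).
Proof. by apply: is_rmorphI => a x; rewrite regmodE !free_coordE free_actE ffunE. Qed.

Lemma free_expand (v : free_mod) : v = \sum_j ract free_mod (free_coord j v) (free_gen j).
Proof.
apply/ffunP => i; rewrite sum_ffunE (bigD1 i) //= big1 ?addr0.
  by rewrite /free_gen free_actE free_unitE !ffunE r2vK mxE !eqxx scale1r mul1r free_coordE.
move=> j ji; rewrite /free_gen free_actE free_unitE !ffunE r2vK mxE eqxx /= eq_sym.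
by rewrite (negPf ji) scale0r mul0r.
Qed.

Lemma free_projective : projective free_mod.
Proof.
exists n, free_gen, free_coord; split; [exact: free_coord_rmorph | exact: free_expand].
Qed.

Lemma free_dim : dim free_mod = (dim W * dim A)%N.
Proof. by rewrite -[LHS]/(#|'I_n| * dim A)%N card_ord. Qed.

Lemma free_ex M (g : 'Hom(W, M)) :
  exists2 f : 'Hom(free_mod, M), is_rmorph f & forall w, f (free_unit w) = g w.
Proof.
exists (gen_map free_coord (fun j => g (r2v (delta_mx 0 j)))).
  exact/gen_map_rmorph/free_coord_rmorph.
move=> w; rewrite gen_mapE -[in RHS](v2rK w) [v2r w in RHS]row_sum_delta !linear_sum /=.
apply: eq_bigr => j _; rewrite free_coordE free_unitE ffunE ractZl ract1E.
by rewrite !linearZ.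
Qed.

Lemma free_ext M (f g : 'Hom(free_mod, M)) : is_rmorph f -> is_rmorph g ->
  (forall w, f (free_unit w) = g (free_unit w)) -> f = g.
Proof.
move=> fP gP fg; apply/lfunP => v; rewrite (free_expand v) !linear_sum /=.
by apply: eq_bigr => j _; rewrite (ract_rmap _ _ fP) (ract_rmap _ _ gP) fg.
Qed.

End Free.

End Modules.

(** * Complexes, homotopies and cohomology *)

Section Complexes.
Variables (k : fieldType) (A : falgType k).
Implicit Types (M N : rmodule A) (X Y Z W : complex A).

Lemma cdiffKE X i j l x : cdiff X j l (cdiff X i j x) = 0.
Proof. by rewrite -comp_lfunE cdiffK zero_lfunE. Qed.

Lemma cmapE X Y (f : cmap X Y) i j x : f j (cdiff X i j x) = cdiff Y i j (f i x).
Proof. by rewrite -!comp_lfunE cfun_diff. Qed.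

Lemma cdiff_ract X i j a x : cdiff X i j (ract _ a x) = ract _ a (cdiff X i j x).
Proof. by rewrite (ract_rmap _ _ (cdiff_rmorph X i j)). Qed.

Lemma cfun_ract X Y (f : cmap X Y) i a x : f i (ract _ a x) = ract _ a (f i x).
Proof. by rewrite (ract_rmap _ _ (cfun_rmorph f i)). Qed.

Lemma cocP X i j (x : X i) : j = i + 1 -> (x \in cocycles X i) = (cdiff X i j x == 0).
Proof. by move=> ->; rewrite memv_ker. Qed.

Lemma cobP X i j (x : X j) : i = j - 1 ->
  x \in coboundaries X j <-> exists y, x = cdiff X i j y.
Proof.
move=> ->; split; first by case/memv_imgP=> y _ ->; exists y.
by case=> y ->; rewrite memv_img ?memvf.
Qed.

Lemma cdiff_cob X i j x : cdiff X i j x \in coboundaries X j.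
Proof.
case: (eqVneq j (i + 1)) => [e|/cdiff_shape ->]; last by rewrite zero_lfunE mem0v.
by apply/(@cobP X i); [rewrite e addrK | exists x].
Qed.

Section MkCmap.
Variables (X Y : complex A) (f : forall i, 'Hom(X i, Y i)).
Hypothesis fm : forall i, is_rmorph (f i).
Hypothesis fd : forall i x, f (i + 1) (cdiff X i (i + 1) x) = cdiff Y i (i + 1) (f i x).

Lemma mkcmap_diff i j : (f j \o cdiff X i j)%VF = (cdiff Y i j \o f i)%VF.
Proof.
apply/lfunP => x; rewrite !comp_lfunE.
have [->|ne] := eqVneq j (i + 1); first exact: fd.
by rewrite !cdiff_shape // !zero_lfunE linear0.
Qed.

Definition mkcmap : cmap X Y := CMap fm mkcmap_diff.
End MkCmap.

(** The identity between degrees that are equal only propositionally, and zero otherwise. It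
    replaces transports: families can be given for all pairs of degrees, and the equation between
    degrees is discharged afterwards. *)
Definition idfam X a b : 'Hom(X a, X b) :=
  match a =P b with
  | ReflectT e => eq_rect a (fun c => 'Hom(X a, X c)) \1%VF b e
  | ReflectF _ => 0
  end.

Lemma idfam_id X a x : idfam X a a x = x.
Proof. by rewrite /idfam; case: eqP => // e; rewrite (eq_axiomK e) id_lfunE. Qed.

Lemma idfam_neq X a b : a != b -> idfam X a b = 0.
Proof. by rewrite /idfam; case: eqP. Qed.

Lemma idfam_rmorph X a b : is_rmorph (idfam X a b).
Proof.
rewrite /idfam; case: eqP => [e|_]; last exact: Defs.rmorph0.
by case: _ / e; exact: rmorph_id.
Qed.

Lemma cdiff_idfam X a b c x : a = b -> cdiff X b c (idfam X a b x) = cdiff X a c x.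
Proof. by move=> e; case: _ / e; rewrite idfam_id. Qed.

Lemma idfam_cdiff X a b c x : b = c -> idfam X b c (cdiff X a b x) = cdiff X a c x.
Proof. by move=> e; case: _ / e; rewrite idfam_id. Qed.

Lemma cmap_idfam X Y (f : cmap X Y) a b x : f b (idfam X a b x) = idfam Y a b (f a x).
Proof.
case: (eqVneq a b) => [e|ne]; last by rewrite !idfam_neq // !zero_lfunE linear0.
by case: _ / e; rewrite !idfam_id.
Qed.

Lemma idfamK X a b x : a = b -> idfam X b a (idfam X a b x) = x.
Proof. by move=> e; case: _ / e; rewrite !idfam_id. Qed.

Definition nullh X Y (f : forall i, 'Hom(X i, Y i)) : Prop :=
  exists h : forall i j, 'Hom(X i, Y j),
    (forall i j, is_rmorph (h i j)) /\
    forall i p n x, p = i - 1 -> n = i + 1 ->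
      f i x = cdiff Y p i (h i p x) + h n i (cdiff X i n x).

Lemma homotopicE X Y (f g : cmap X Y) :
  homotopic f g <-> nullh (fun i => f i - g i).
Proof.
split=> -[h [hm H]]; exists h; split=> // i.
  by move=> p n x -> ->; rewrite H !lfE.
by apply/lfunP => x; rewrite [LHS](H i _ _ x erefl erefl) !lfE.
Qed.

Lemma nullh_eq X Y (f g : forall i, 'Hom(X i, Y i)) :
  (forall i x, f i x = g i x) -> nullh f -> nullh g.
Proof. by move=> fg [h [hm H]]; exists h; split=> // i p n x ep en; rewrite -fg; exact: H. Qed.

Lemma nullh0 X Y (f : forall i, 'Hom(X i, Y i)) : (forall i x, f i x = 0) -> nullh f.
Proof.
move=> f0; exists (fun _ _ => 0); split; first by move=> *; exact: Defs.rmorph0.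
by move=> i p n x _ _; rewrite f0 !lfE linear0 addr0.
Qed.

Lemma nullhD X Y (f g : forall i, 'Hom(X i, Y i)) :
  nullh f -> nullh g -> nullh (fun i => f i + g i).
Proof.
move=> [h [hm H]] [h' [hm' H']]; exists (fun i j => h i j + h' i j); split.
  by move=> i j; exact: is_rmorphD.
move=> i p n x ep en; rewrite !lfE (H i p n) // (H' i p n) //.
by rewrite linearD /= addrACA.
Qed.

Lemma nullhN X Y (f : forall i, 'Hom(X i, Y i)) : nullh f -> nullh (fun i => - f i).
Proof.
move=> [h [hm H]]; exists (fun i j => - h i j); split.
  by move=> i j; exact: is_rmorphN.
by move=> i p n x ep en; rewrite !lfE (H i p n) // linearN opprD.
Qed.

Lemma nullh_compl X Y Z (f : forall i, 'Hom(X i, Y i)) (g : cmap Y Z) :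
  nullh f -> nullh (fun i => (g i \o f i)%VF).
Proof.
move=> [h [hm H]]; exists (fun i j => (g j \o h i j)%VF); split.
  by move=> i j; apply: rmorph_comp => //; exact: cfun_rmorph.
by move=> i p n x ep en; rewrite !lfE (H i p n) // linearD /= cmapE.
Qed.

Lemma nullh_compr X Y Z (f : cmap X Y) (g : forall i, 'Hom(Y i, Z i)) :
  nullh g -> nullh (fun i => (g i \o f i)%VF).
Proof.
move=> [h [hm H]]; exists (fun i j => (h i j \o f i)%VF); split.
  by move=> i j; apply: rmorph_comp => //; exact: cfun_rmorph.
by move=> i p n x ep en; rewrite !lfE (H i p n) // -cmapE.
Qed.

Lemma nullh_coc X Y (f : forall i, 'Hom(X i, Y i)) i x :
  nullh f -> x \in cocycles X i -> f i x \in coboundaries Y i.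
Proof.
move=> [h [_ H]] xZ; rewrite (H i _ _ x erefl erefl).
by rewrite (eqP (_ : cdiff X i (i + 1) x == 0)) ?linear0 ?addr0 ?cdiff_cob // -cocP.
Qed.

Lemma cmap_coc X Y (f : cmap X Y) i x : x \in cocycles X i -> f i x \in cocycles Y i.
Proof. by rewrite !(@cocP _ i (i + 1)) // -cmapE => /eqP->; rewrite linear0. Qed.

Lemma cmap_cob X Y (f : cmap X Y) i x :
  x \in coboundaries X i -> f i x \in coboundaries Y i.
Proof. by case/memv_imgP=> y _ ->; rewrite cmapE cdiff_cob. Qed.

(** The two halves of a quasi-isomorphism are kept apart, and apart for each degree, because
    truncated resolutions satisfy them only in a range of degrees, injectivity one degree later than
    surjectivity. *)
Definition Hinj X Y (f : cmap X Y) i := forall x,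
  x \in cocycles X i -> f i x \in coboundaries Y i -> x \in coboundaries X i.
Definition Hsurj X Y (f : cmap X Y) i := forall y, y \in cocycles Y i ->
  exists2 x, x \in cocycles X i & y - f i x \in coboundaries Y i.
Definition Hzero X i := forall x, x \in cocycles X i -> x \in coboundaries X i.
Definition acyclic X := forall i, Hzero X i.

Lemma Hinj_comp X Y Z (f : cmap X Y) (g : cmap Y Z) i :
  Hinj f i -> Hinj g i -> Hinj (cmap_comp g f) i.
Proof.
move=> fI gI x xZ; rewrite /= lfE => /gI gx; apply: fI => //.
by apply: gx; exact: cmap_coc.
Qed.

Lemma Hsurj_comp X Y Z (f : cmap X Y) (g : cmap Y Z) i :
  Hsurj f i -> Hsurj g i -> Hsurj (cmap_comp g f) i.
Proof.
move=> fS gS z /gS[y /fS[x xZ fx] gy]; exists x; rewrite //= lfE.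
rewrite -[z](subrK (g i y)) -addrA -linearB memvD //; exact: cmap_cob.
Qed.

Lemma Hinj_cancel X Y Z (f : cmap X Y) (g : cmap Y Z) i :
  Hinj (cmap_comp g f) i -> Hinj f i.
Proof. by move=> H x xZ fx; apply: H => //=; rewrite lfE cmap_cob. Qed.

Lemma Hsurj_cancel X Y Z (f : cmap X Y) (g : cmap Y Z) i :
  Hsurj (cmap_comp g f) i -> Hsurj g i.
Proof.
move=> H z /H[x xZ]; rewrite /= lfE => Hx; exists (f i x) => //; exact: cmap_coc.
Qed.

Lemma Hinj_cancelr X Y Z (f : cmap X Y) (g : cmap Y Z) i :
  Hinj (cmap_comp g f) i -> Hsurj f i -> Hinj g i.
Proof.
move=> gf fS y yZ gy; have [x xZ xy] := fS _ yZ.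
rewrite -[y](subrK (f i x)) memvD // cmap_cob //; apply: gf => //=.
by rewrite lfE -[f i x](subKr y) linearB /= memvB // cmap_cob.
Qed.

Lemma Hsurj_cancell X Y Z (f : cmap X Y) (g : cmap Y Z) i :
  Hsurj (cmap_comp g f) i -> Hinj g i -> Hsurj f i.
Proof.
move=> gf gI y yZ; have [x xZ] := gf _ (cmap_coc g yZ); rewrite /= lfE -linearB /= => H.
by exists x => //; apply: gI H; rewrite memvB // cmap_coc.
Qed.

Lemma qis_comp X Y Z (f : cmap X Y) (g : cmap Y Z) :
  quasi_iso f -> quasi_iso g -> quasi_iso (cmap_comp g f).
Proof.
move=> fq gq i; have [fI fS] := fq i; have [gI gS] := gq i.
by split; [exact: Hinj_comp | exact: Hsurj_comp].
Qed.

Lemma qis_cancell X Y Z (f : cmap X Y) (g : cmap Y Z) :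
  quasi_iso (cmap_comp g f) -> quasi_iso g -> quasi_iso f.
Proof.
move=> fq gq i; have [fI fS] := fq i; have [gI gS] := gq i; split.
  exact: Hinj_cancel fI.
exact: Hsurj_cancell fS gI.
Qed.

Lemma Hinj_nullh X Y (f g : cmap X Y) i :
  nullh (fun i => f i - g i) -> Hinj f i -> Hinj g i.
Proof.
move=> H fI x xZ gx; apply: fI => //; rewrite -[f i x](subrK (g i x)) memvD //.
by have := nullh_coc H xZ; rewrite !lfE.
Qed.

Lemma Hsurj_nullh X Y (f g : cmap X Y) i :
  nullh (fun i => f i - g i) -> Hsurj f i -> Hsurj g i.
Proof.
move=> H fS y /fS[x xZ fx]; exists x => //.
rewrite -[y](subrK (f i x)) -addrA memvD //.
by have := nullh_coc H xZ; rewrite !lfE.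
Qed.

Lemma nullh_sym X Y (f g : cmap X Y) :
  nullh (fun i => f i - g i) -> nullh (fun i => g i - f i).
Proof. by move=> /nullhN; apply: nullh_eq => i x; rewrite !lfE opprB. Qed.

Lemma qis_nullh X Y (f g : cmap X Y) :
  nullh (fun i => f i - g i) -> quasi_iso f -> quasi_iso g.
Proof.
move=> H fq i; have [fI fS] := fq i; split; first exact: Hinj_nullh fI.
exact: Hsurj_nullh fS.
Qed.

Lemma qis_acyclic X Y (f : cmap X Y) : quasi_iso f -> acyclic X <-> acyclic Y.
Proof.
move=> fq; split=> H i x xZ; have [fI fS] := fq i.
  have [y /H yB xy] := fS _ xZ.
  by rewrite -[x](subrK (f i y)) memvD // cmap_cob.
by apply: fI => //; apply: H; exact: cmap_coc.
Qed.

Lemma acyclic_qis X Y (f : cmap X Y) : acyclic X -> acyclic Y -> quasi_iso f.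
Proof.
move=> HX HY i; split=> [x /HX //|y /HY yB].
by exists 0; rewrite ?mem0v // linear0 subr0.
Qed.

End Complexes.

(** * Twisted sums and null-homotopies *)

Section Twisted.
Variables (k : fieldType) (A : falgType k) (Y Z : complex A).
Variable t : forall i j, 'Hom(Z i, Y j).
Hypothesis tm : forall i j, is_rmorph (t i j).
Hypothesis tn : forall i j, j != i + 1 -> t i j = 0.
Hypothesis td : forall i j l z, j = i + 1 -> l = j + 1 ->
  cdiff Y j l (t i j z) + t j l (cdiff Z i j z) = 0.

Definition tw_diff i j : 'Hom((Y i * Z i)%type, (Y j * Z j)%type) :=
  linfun (fun p => (cdiff Y i j p.1 + t i j p.2, cdiff Z i j p.2)).

Lemma tw_diffE i j p : tw_diff i j p = (cdiff Y i j p.1 + t i j p.2, cdiff Z i j p.2).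
Proof.
rewrite linfun_linE // => c x y; apply: injective_projections => /=; last by rewrite linearP.
by rewrite !linearP /= scalerDr addrACA.
Qed.

(* Mapping cones, cell attachments and the middle terms of almost split triangles are
   all of this form. *)
Definition tw : complex A.
Proof.
refine (@Complex k A (fun i => rmod_sum (Y i) (Z i)) tw_diff _ _ _
  (maxn (cbound Y) (cbound Z)) _).
- move=> i j; apply: is_rmorphI => a p; rewrite !tw_diffE !rmod_sumE /=.
  by rewrite !cdiff_ract (ract_rmap _ _ (tm i j)) linearD.
- move=> i j ij; apply/lfunP => p; rewrite tw_diffE tn // !cdiff_shape // !lfE.
  by rewrite addr0.
- move=> i j l; apply/lfunP => p; rewrite [RHS]lfE comp_lfunE !tw_diffE /= !cdiffKE.
  rewrite linearD /= cdiffKE add0r; congr pair.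
  have [ji|ne] := eqVneq j (i + 1); last first.
    by rewrite (tn ne) (cdiff_shape _ ne) !lfE !linear0 addr0.
  have [lj|ne] := eqVneq l (j + 1); first exact: td.
  by rewrite (tn ne) (cdiff_shape _ ne) !lfE addr0.
- move=> i; rewrite gtn_max => /andP[Yi Zi] [u v].
  by rewrite (cboundP Yi u) (cboundP Zi v).
Defined.

Lemma twE i j (p : tw i) : cdiff tw i j p = (cdiff Y i j p.1 + t i j p.2, cdiff Z i j p.2).
Proof. exact: tw_diffE. Qed.

Definition tw_snd : cmap tw Z.
Proof.
refine (@mkcmap k A tw Z (fun i => lsnd (Y i) (Z i)) (fun i => @lsnd_rmorph k A _ _) _).
by move=> i x; rewrite !lsndE twE.
Defined.

Lemma tw_sndE i x : tw_snd i x = x.2. Proof. by rewrite /= lsndE. Qed.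

Definition tw_inl : cmap Y tw.
Proof.
refine (@mkcmap k A Y tw (fun i => linl (Y i) (Z i)) (fun i => @linl_rmorph k A _ _) _).
by move=> i x; rewrite !linlE twE /= !linear0 addr0.
Defined.

Lemma tw_inlE i x : tw_inl i x = (x, 0). Proof. by rewrite /= linlE. Qed.

Section Out.
Variables (W : complex A) (a : cmap Y W) (b : forall i, 'Hom(Z i, W i)).
Hypothesis bm : forall i, is_rmorph (b i).
Hypothesis bd : forall i j z, j = i + 1 ->
  b j (cdiff Z i j z) + a j (t i j z) = cdiff W i j (b i z).

Definition tw_out_fun i : 'Hom((Y i * Z i)%type, W i) :=
  ((a i \o lfst _ _) + (b i \o lsnd _ _))%VF.

Lemma tw_out_funE i p : tw_out_fun i p = a i p.1 + b i p.2.
Proof. by rewrite !lfE lfstE lsndE. Qed.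

(** By [bd], extending [a] over [Z] amounts to choosing a null-homotopy [b] of the composite of [a]
    with the attaching map [t]. *)
Definition tw_out : cmap tw W.
Proof.
refine (@mkcmap k A tw W tw_out_fun _ _).
- move=> i; apply: is_rmorphI => c p; rewrite !tw_out_funE rmod_sumE /= cfun_ract.
  by rewrite (ract_rmap _ _ (bm i)) linearD.
- move=> i p; rewrite !tw_out_funE twE /= !linearD /= -(@bd i) // cmapE.
  by rewrite -addrA [_ + b _ _]addrC.
Defined.

Lemma tw_outE i p : tw_out i p = a i p.1 + b i p.2.
Proof. exact: tw_out_funE. Qed.
End Out.

Section In.
Variables (W : complex A) (a : cmap W Z) (b : forall i, 'Hom(W i, Y i)).
Hypothesis bm : forall i, is_rmorph (b i).
Hypothesis bd : forall i j w, j = i + 1 ->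
  b j (cdiff W i j w) = cdiff Y i j (b i w) + t i j (a i w).

Definition tw_in_fun i : 'Hom(W i, (Y i * Z i)%type) :=
  ((linl _ _ \o b i) + (linr _ _ \o a i))%VF.

Lemma tw_in_funE i w : tw_in_fun i w = (b i w, a i w).
Proof. by rewrite !lfE linlE linrE; apply: injective_projections; rewrite /= ?addr0 ?add0r. Qed.

(** Dually, lifting [a] to the twisted sum amounts to choosing a null-homotopy [b] of the composite
    of [t] with [a]. *)
Definition tw_in : cmap W tw.
Proof.
refine (@mkcmap k A W tw tw_in_fun _ _).
- move=> i; apply: is_rmorphI => c p; rewrite !tw_in_funE rmod_sumE /= cfun_ract.
  by rewrite (ract_rmap _ _ (bm i)).
- by move=> i w; rewrite !tw_in_funE twE /= (@bd i) // cmapE.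
Defined.

Lemma tw_inE i w : tw_in i w = (b i w, a i w).
Proof. exact: tw_in_funE. Qed.
End In.

End Twisted.

Section Lifting.
Variables (k : fieldType) (A : falgType k).
Implicit Types (X Y Z V Q C : complex A).

Definition projc Q := forall i, projective (Q i).

Lemma cdiff_hom_eq X Y (h : forall i j, 'Hom(X i, Y j)) c a a' b x :
  a = a' -> cdiff Y a b (h c a x) = cdiff Y a' b (h c a' x).
Proof. by move=> ->. Qed.

Section Boundary.
Variables (X Y : complex A) (h : forall i j, 'Hom(X i, Y j)).
Hypothesis hm : forall i j, is_rmorph (h i j).

Definition bnd_fun i : 'Hom(X i, Y i) :=
  ((cdiff Y (i - 1) i \o h i (i - 1)%R) + (h (i + 1)%R i \o cdiff X i (i + 1)))%VF.

Definition bnd : cmap X Y.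
Proof.
refine (@mkcmap k A X Y bnd_fun _ _).
- move=> i; apply: is_rmorphD; apply: Defs.rmorph_comp => //; exact: cdiff_rmorph.
- move=> i x; rewrite !lfE linearD /= !cdiffKE linear0 addr0 add0r.
  exact/cdiff_hom_eq/addrK.
Defined.

Lemma bndE i p n x : p = i - 1 -> n = i + 1 ->
  bnd i x = cdiff Y p i (h i p x) + h n i (cdiff X i n x).
Proof. by move=> -> ->; rewrite /= !lfE. Qed.

Lemma bnd_nullh : nullh bnd.
Proof. by exists h; split=> // i p n x; exact: bndE. Qed.
End Boundary.

Definition csub X Y (f g : cmap X Y) : cmap X Y.
Proof.
refine (@mkcmap k A X Y (fun i => f i - g i) _ _).
- by move=> i; apply: is_rmorphD; [|apply: is_rmorphN]; exact: cfun_rmorph.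
- by move=> i x; rewrite !lfE linearB /= !cmapE.
Defined.

Lemma csubE X Y (f g : cmap X Y) i x : csub f g i x = f i x - g i x.
Proof. by rewrite /= !lfE. Qed.

(** The homotopy is built from the top degree down. In the highest degree [n] where [g] may be
    nonzero, its values are cocycles, hence coboundaries, so [g n] lifts through the differential of
    [C]. Subtracting the boundary of this single component kills degree [n] and changes [g]
    otherwise only in degree [n - 1]. The number [r] counts the degrees left. *)
Lemma proj_acyclic_nullh Q C (f : cmap Q C) : projc Q -> acyclic C -> nullh f.
Proof.
move=> Qp Ca.
suff H (r : nat) (g : cmap Q C) :
    (forall i : int, (- (cbound Q)%:Z - 1 + r%:Z < i)%R -> forall x, g i x = 0) -> nullh g.
  apply: (H ((cbound Q).*2.+1)%N) => i lti x.
  rewrite (cboundP (_ : (cbound Q < `|i|)%N) x) ?linear0 //.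
  by move: lti; rewrite -addnn; case: i x => n x; lia.
elim: r g => [|r IHr] g g0.
  apply: nullh0 => i x; case: (boolP (i <= - (cbound Q)%:Z - 1)%R) => lti.
    rewrite (cboundP (_ : (cbound Q < `|i|)%N) x) ?linear0 //; lia.
  by apply: g0; lia.
set n : int := - (cbound Q)%:Z - 1 + r.+1%:Z in g0.
(* A family whose only possibly nonzero component is the lift, from degree [n] to degree [n - 1];
   choosing over pairs of degrees avoids a transport. *)
have [|h hP] := @dchoice (int * int) (fun p => 'Hom(Q p.1, C p.2)) (fun p hp =>
    is_rmorph hp /\ (p.1 = n -> p.2 = n - 1 -> forall x, cdiff C p.2 p.1 (hp x) = g p.1 x)
    /\ (p.1 != n -> hp = 0)).
  move=> -[i j] /=.
  have [->|ni] := eqVneq i n; last first.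
    exists 0; split; first exact: Defs.rmorph0.
    by split=> // e; rewrite e eqxx in ni.
  have [ej|nj] := eqVneq j (n - 1); last first.
    exists 0; split; first exact: Defs.rmorph0.
    by split=> // _ e; rewrite e eqxx in nj.
  have [||//|h hm hE] := @projective_lift k A (Q n) (C j) (C n) (g n) (cdiff C j n) (Qp n).
  - exact: cfun_rmorph.
  - exact: cdiff_rmorph.
  - apply/subvP => _ /memv_imgP[x _ ->].
    have : g n x \in coboundaries C n.
      apply: Ca; rewrite (@cocP _ _ _ _ (n + 1)) // -cmapE g0 ?linear0 //; lia.
    by move/(@cobP _ _ _ j n _ ej) => [y ->]; rewrite memv_img ?memvf.
  - by exists h.
pose h' i j := h (i, j).
have hm i j : is_rmorph (h' i j) by case: (hP (i, j)).
have h0 i j : i != n -> h' i j = 0 by case: (hP (i, j)) => _ [_]; apply.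
have hn j : j = n - 1 -> forall x, cdiff C j n (h' n j x) = g n x.
  by case: (hP (n, j)) => _ [H _]; apply: H.
have Hf : nullh (csub g (bnd hm)).
  apply: IHr => i lti x; rewrite csubE (@bndE _ _ _ hm i (i - 1) (i + 1)) //.
  have [en|ni] := eqVneq i n.
    clear lti; move: x; rewrite en => x.
    by rewrite hn // h0 ?zero_lfunE ?addr0 ?subrr // -subr_eq0 addrAC subrr add0r.
  rewrite g0; last by rewrite /n; move: ni lti; rewrite /n; lia.
  rewrite !h0 //; last by rewrite /n; move: ni lti; rewrite /n; lia.
  by rewrite !zero_lfunE linear0 addr0 subrr.
apply: nullh_eq (nullhD Hf (bnd_nullh hm)) => i x.
by rewrite add_lfunE csubE subrK.
Qed.

End Lifting.

(** * Mapping cones and lifting along quasi-isomorphisms *)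

Section QisLift.
Variables (k : fieldType) (A : falgType k).
Implicit Types (X Y Z V Q C : complex A).

Lemma shiftE n X i j x :
  cdiff (shift n X) i j x = (-1) ^ n *: cdiff X (n + i) (n + j) x.
Proof. by rewrite /= lfE. Qed.

Section Cone.
Variables (V Y : complex A) (f : cmap V Y).

Definition cone_map i j : 'Hom(shift 1 V i, Y j) := (idfam Y (1 + i) j \o f (1 + i)%R)%VF.

Lemma cone_mapE i j z : cone_map i j z = idfam Y (1 + i) j (f (1 + i) z).
Proof. exact: comp_lfunE. Qed.

Lemma cone_map_rmorph i j : is_rmorph (cone_map i j).
Proof.
apply: (@Defs.rmorph_comp k A (V (1 + i)) (Y (1 + i)) (Y j)); last exact: idfam_rmorph.
exact: cfun_rmorph.
Qed.

Lemma cone_map_shape i j : j != i + 1 -> cone_map i j = 0.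
Proof. by move=> ne; rewrite /cone_map idfam_neq ?comp_lfun0l // addrC eq_sym. Qed.

Lemma cone_map_diff i j l z : j = i + 1 -> l = j + 1 ->
  cdiff Y j l (cone_map i j z) + cone_map j l (cdiff (shift 1 V) i j z) = 0.
Proof.
move=> ej el; rewrite !cone_mapE shiftE expr1z scaleN1r cdiff_idfam; last by lia.
rewrite !linearN /= cmapE idfam_cdiff ?subrr //; lia.
Qed.

Definition cone : complex A := tw cone_map_rmorph cone_map_shape cone_map_diff.

(** For a cocycle [(y, v)] of the cone, [v] is a cocycle with [f v] a coboundary, so injectivity
    gives [v = d v']. Then [y + f v'] is a cocycle, and surjectivity writes it as [f w + d y'] with
    [w] a cocycle; the preimage is [(y', w - v')]. *)
Lemma qis_cone_acyclic : quasi_iso f -> acyclic cone.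
Proof.
move=> fq i p; rewrite (@cocP _ _ cone i (i + 1)) // => /eqP; rewrite twE => -[e1 e2].
have p2Z : cdiff V (1 + i) (1 + (i + 1)) p.2 = 0.
  by move/eqP: e2; rewrite shiftE expr1z scaleN1r oppr_eq0 => /eqP.
have p2B : p.2 \in coboundaries V (1 + i).
  apply: (proj1 (fq (1 + i))).
    by rewrite (@cocP _ _ _ _ (1 + (i + 1))) ?p2Z //; lia.
  have -> : f (1 + i) p.2 = cdiff Y i (1 + i) (- p.1).
    have e1' : idfam Y (1 + i) (i + 1) (f (1 + i) p.2) = - cdiff Y i (i + 1) p.1.
      apply/eqP; rewrite -addr_eq0 -(cone_mapE _ p.2); apply/eqP.
      by rewrite -[RHS]e1; exact: (addrC (cone_map i (i + 1) p.2)).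
    have e : i + 1 = 1 + i by lia.
    rewrite linearN /= -(@idfam_cdiff _ _ Y i (i + 1) (1 + i) p.1 e) -linearN /= -e1' idfamK //.
  exact: cdiff_cob.
have [v' p2E] : exists v', p.2 = cdiff V (1 + (i - 1)) (1 + i) v'.
  by apply/cobP => //; lia.
have tv : cone_map i (i + 1) p.2 = cdiff Y i (i + 1) (cone_map (i - 1) i v').
  have := @cone_map_diff (i - 1) i (i + 1) v'; rewrite shiftE expr1z scaleN1r -p2E.
  move=> /(_ _ _)/eqP; rewrite linearN /= subr_eq0 => H.
  by rewrite (eqP (H _ _)) //; lia.
have yZ : p.1 + cone_map (i - 1) i v' \in cocycles Y i.
  by rewrite (@cocP _ _ _ _ (i + 1)) // linearD /= -tv e1.
have [w wZ /(@cobP _ _ _ (i - 1)) H] := proj2 (fq i) _ yZ.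
have [y yE] := H erefl.
apply/(@cobP _ _ cone (i - 1)) => //.
pose q : cone (i - 1) := (y, idfam V i (1 + (i - 1)) w - v').
exists q; rewrite twE /= shiftE expr1z scaleN1r -yE !linearB /= cdiff_idfam; last by lia.
have -> : cone_map (i - 1) i (idfam V i (1 + (i - 1)) w) = f i w.
  rewrite cone_mapE cmap_idfam idfamK //; lia.
rewrite -p2E [cdiff V _ _ w](eqP (_ : _ == 0)); last first.
  by rewrite -cocP //; lia.
by rewrite addrA subrK addrK oppr0 sub0r opprK; case: (p).
Qed.
End Cone.

(** The composite of [g] with the inclusion of [Y] in the acyclic cone is null-homotopic. The
    component of the homotopy in [V] is the lift [s], and minus its component in [Y] is the homotopy
    from [f \o s] to [g]. *)
Lemma qis_lift Q V Y (f : cmap V Y) (g : cmap Q Y) :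
  projc Q -> quasi_iso f ->
  exists s : cmap Q V, nullh (fun i => (f i \o s i)%VF - g i).
Proof.
move=> Qp fq; pose gC := cmap_comp (tw_inl (@cone_map_rmorph _ _ f) (@cone_map_shape _ _ f)
  (@cone_map_diff _ _ f)) g : cmap Q (cone f).
have [h [hm hE]] := proj_acyclic_nullh gC Qp (qis_cone_acyclic fq).
pose hY i j : 'Hom(Q i, Y j) := (lfst _ _ \o h i j)%VF.
pose hV i j : 'Hom(Q i, V (1 + j)) := (lsnd _ _ \o h i j)%VF.
have hYm i j : is_rmorph (hY i j).
  apply: (@Defs.rmorph_comp k A (Q i) (cone f j) (Y j)) => //; exact: lfst_rmorph.
have hVm i j : is_rmorph (hV i j).
  apply: (@Defs.rmorph_comp k A (Q i) (cone f j) (V (1 + j))) => //.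
  exact: (@lsnd_rmorph k A (Y j) (V (1 + j))).
have E i p n x : p = i - 1 -> n = i + 1 ->
    g i x = cdiff Y p i (hY i p x) + cone_map f p i (hV i p x) + hY n i (cdiff Q i n x)
    /\ hV n i (cdiff Q i n x) = cdiff V (1 + p) (1 + i) (hV i p x).
  move=> ep en; have := hE i p n x ep en.
  rewrite [cdiff (cone f) p i _]twE {1}/gC comp_lfunE tw_inlE => H.
  have [H1 H2] := (congr1 fst H, congr1 snd H); split; rewrite /= in H1 H2.
    by rewrite H1 /hY /hV !lfE !lfstE !lsndE.
  move: H2; rewrite /hV !lfE !lsndE ?shiftE ?lfE expr1z scaleN1r => /esym/eqP.
  by rewrite addr_eq0 => /eqP/oppr_inj.
pose s i : 'Hom(Q i, V i) := (idfam V (1 + (i - 1)) i \o hV i (i - 1)%R)%VF.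
have sm i : is_rmorph (s i).
  by apply: Defs.rmorph_comp => //; exact: idfam_rmorph.
have sE i p x : p = i - 1 -> s i x = idfam V (1 + p) i (hV i p x).
  by move=> ->; rewrite /s lfE.
have sd i x : s (i + 1) (cdiff Q i (i + 1) x) = cdiff V i (i + 1) (s i x).
  rewrite (@sE _ i); last by lia.
  have [//|//|_ ->] := E i (i - 1) (i + 1) x.
  rewrite idfam_cdiff; last by lia.
  by rewrite /s lfE cdiff_idfam //; lia.
exists (mkcmap sm sd), (fun i j => - hY i j); split.
  by move=> i j; exact: is_rmorphN.
move=> i p n x ep en; rewrite add_lfunE opp_lfunE comp_lfunE.
have [//|//|-> _] := E i p n x; rewrite cone_mapE (_ : f i _ = idfam Y (1 + p) i (f (1 + p) (hV i p x))).
  have aux (U : zmodType) (u a b : U) : u - (a + u + b) = - a - b.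
    by rewrite !opprD !addrA [u - a]addrC addrK.
  by rewrite aux !opp_lfunE linearN.
by rewrite -cmap_idfam -(sE _ _ _ ep).
Qed.

End QisLift.

(** * The derived category *)

Section Derived.
Variables (k : fieldType) (A : falgType k).
Implicit Types (X Y Z V Q C : complex A).

Lemma homotopic_refl X Y (f g : cmap X Y) : (forall i x, f i x = g i x) -> homotopic f g.
Proof. by move=> fg; apply/homotopicE/nullh0 => i x; rewrite !lfE fg subrr. Qed.

Lemma homotopic_qis X Y (f g : cmap X Y) : homotopic f g -> quasi_iso f -> quasi_iso g.
Proof. by move=> /homotopicE; exact: qis_nullh. Qed.

Lemma homotopic_Hinj X Y (f g : cmap X Y) i : homotopic f g -> Hinj f i -> Hinj g i.
Proof. by move=> /homotopicE; exact: Hinj_nullh. Qed.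

Lemma homotopic_compr X Y Z (f : cmap X Y) (g h : cmap Y Z) :
  homotopic g h -> homotopic (cmap_comp g f) (cmap_comp h f).
Proof.
move=> /homotopicE H; apply/homotopicE; apply: nullh_eq (nullh_compr f H) => i x.
by rewrite !lfE.
Qed.

Lemma homotopic_sym X Y (f g : cmap X Y) : homotopic f g -> homotopic g f.
Proof. by move=> /homotopicE/nullh_sym H; apply/homotopicE. Qed.

(** Homotopic maps act alike on cohomology, where left legs are invertible; so the identity factors
    through [rleg r] followed by [rleg s]. Used for both composites of an isomorphism, this makes
    both right legs quasi-isomorphisms. *)
Lemma roof_comp_id X Y (r : roof X Y) (s : roof Y X) : roof_comp r s (roof_id X) ->
  forall i, Hinj (rleg r) i /\ Hsurj (rleg s) i.
Proof.
move=> [V [u [v [q [Huv [V' [u' [v' [/= q' H1 H2]]]]]]]]].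
have Q1 := homotopic_qis H1 q'.
have Q2 := homotopic_qis H2 q' => {H1 H2 q'}.
have Q3 : quasi_iso (cmap_comp u v').
  apply: qis_cancell (@lleg_qis _ _ _ _ r); apply: homotopic_qis Q1.
  by apply: homotopic_refl => i x; rewrite /= !lfE.
move=> i; split; last by move: (proj2 (Q2 i)); do 2!move/Hsurj_cancel.
apply: (@Hinj_cancelr _ _ _ _ _ (cmap_comp u v')); last exact: (proj2 (Q3 i)).
have I1 : Hinj (cmap_comp v v') i.
  apply: (@Hinj_cancel _ _ _ _ _ _ (rleg s)); apply: homotopic_Hinj (proj1 (Q2 i)).
  by apply: homotopic_refl => j x; rewrite /= !lfE.
have I2 := Hinj_comp I1 (proj1 (@lleg_qis _ _ _ _ s i)).
apply: (@homotopic_Hinj _ _ (cmap_comp (cmap_comp (rleg r) u) v')).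
  by apply: homotopic_refl => j x; rewrite /= !lfE.
apply: homotopic_Hinj (homotopic_compr v' (homotopic_sym Huv)) _.
apply: homotopic_Hinj I2; by apply: homotopic_refl => j x; rewrite /= !lfE.
Qed.

(** From here on the calculus of roofs is replaced by spans of quasi-isomorphisms. *)
Lemma db_isoP X Y : db_iso X Y <->
  exists V (a : cmap V X) (b : cmap V Y), quasi_iso a /\ quasi_iso b.
Proof.
split=> [[r [s [rs sr]]]|[V [a [b [aq bq]]]]].
  exists (apex r), (lleg r), (rleg r); split; first exact: lleg_qis.
  by move=> i; case: (roof_comp_id rs i); case: (roof_comp_id sr i).
exists (Roof aq b), (Roof bq a).
have aux X' Y' (a' : cmap V X') (b' : cmap V Y') (aq' : quasi_iso a') (bq' : quasi_iso b') :
    roof_comp (Roof aq' b') (Roof bq' a') (roof_id X').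
  have q : quasi_iso (cmap_comp a' (cmap_id V)).
    by apply: qis_comp aq'; exact: quasi_iso_id.
  exists V, (cmap_id V), (cmap_id V), q; split; first exact: homotopic_refl.
  exists V, a', (cmap_id V); split=> /=.
  - by apply: qis_comp aq' _; exact: quasi_iso_id.
  - by apply: homotopic_refl => i x; rewrite /= !lfE.
  - by apply: homotopic_refl => i x; rewrite /= !lfE.
by split; exact: aux.
Qed.

Lemma qis_db_iso X Y (f : cmap X Y) : quasi_iso f -> db_iso Y X.
Proof. by move=> fq; apply/db_isoP; exists X, f, (cmap_id X); split=> //; exact: quasi_iso_id. Qed.

Definition cmap0 X Y : cmap X Y.
Proof.
refine (@mkcmap k A X Y (fun=> 0) (fun i => Defs.rmorph0 _ _) _).
by move=> i x; rewrite !zero_lfunE linear0.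
Defined.

Lemma acyclic0 : acyclic (complex0 A).
Proof. by move=> i x _; rewrite [x]thinmx0 mem0v. Qed.

Lemma db_zeroP X : db_zero X <-> acyclic X.
Proof.
split=> [/db_isoP[V [a [b [aq bq]]]]|XA].
  by apply/(qis_acyclic aq)/(qis_acyclic bq); exact: acyclic0.
apply: (@qis_db_iso _ _ (cmap0 (complex0 A) X)); exact: acyclic_qis acyclic0 XA.
Qed.

Lemma complex_sumE X Y i j p :
  cdiff (complex_sum X Y) i j p = (cdiff X i j p.1, cdiff Y i j p.2).
Proof. by rewrite /= lfun_prodE. Qed.

Definition csum_fst X Y : cmap (complex_sum X Y) X.
Proof.
refine (@mkcmap k A (complex_sum X Y) X (fun i => lfst _ _) (fun i => @lfst_rmorph k A _ _) _).
by move=> i p; rewrite complex_sumE !lfstE.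
Defined.

Definition csum_snd X Y : cmap (complex_sum X Y) Y.
Proof.
refine (@mkcmap k A (complex_sum X Y) Y (fun i => lsnd _ _) (fun i => @lsnd_rmorph k A _ _) _).
by move=> i p; rewrite complex_sumE !lsndE.
Defined.

Definition csum_inl X Y : cmap X (complex_sum X Y).
Proof.
refine (@mkcmap k A X (complex_sum X Y) (fun i => linl _ _) (fun i => @linl_rmorph k A _ _) _).
by move=> i p; rewrite complex_sumE !linlE linear0.
Defined.

Definition csum_inr X Y : cmap Y (complex_sum X Y).
Proof.
refine (@mkcmap k A Y (complex_sum X Y) (fun i => linr _ _) (fun i => @linr_rmorph k A _ _) _).
by move=> i p; rewrite complex_sumE !linrE linear0.
Defined.

Lemma csum_fstE X Y i p : csum_fst X Y i p = p.1. Proof. exact: lfstE. Qed.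
Lemma csum_sndE X Y i p : csum_snd X Y i p = p.2. Proof. exact: lsndE. Qed.
Lemma csum_inlE X Y i p : csum_inl X Y i p = (p, 0). Proof. exact: linlE. Qed.
Lemma csum_inrE X Y i p : csum_inr X Y i p = (0, p). Proof. exact: linrE. Qed.

Definition csum_in X Y Z (f : cmap Z X) (g : cmap Z Y) : cmap Z (complex_sum X Y).
Proof.
refine (@mkcmap k A Z (complex_sum X Y) (fun i => (linl _ _ \o f i)%VF + (linr _ _ \o g i)%VF) _ _).
  move=> i; apply: is_rmorphD.
    by apply: (@Defs.rmorph_comp k A (Z i) (X i)); [exact: cfun_rmorph | exact: linl_rmorph].
  by apply: (@Defs.rmorph_comp k A (Z i) (Y i)); [exact: cfun_rmorph | exact: linr_rmorph].
move=> i x; rewrite complex_sumE !lfE !linlE !linrE; congr pair => /=.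
  by rewrite !addr0 cmapE.
by rewrite !add0r cmapE.
Defined.

Lemma csum_inE X Y Z (f : cmap Z X) (g : cmap Z Y) i x : csum_in f g i x = (f i x, g i x).
Proof.
by rewrite /= !lfE linlE linrE; apply: injective_projections; rewrite /= ?addr0 ?add0r.
Qed.

Definition csum_out X Y Z (f : cmap X Z) (g : cmap Y Z) : cmap (complex_sum X Y) Z.
Proof.
refine (@mkcmap k A (complex_sum X Y) Z (fun i => (f i \o lfst _ _)%VF + (g i \o lsnd _ _)%VF) _ _).
  move=> i; apply: is_rmorphD.
    by apply: (@Defs.rmorph_comp k A _ (X i)); [exact: lfst_rmorph | exact: cfun_rmorph].
  by apply: (@Defs.rmorph_comp k A _ (Y i)); [exact: lsnd_rmorph | exact: cfun_rmorph].
by move=> i x; rewrite complex_sumE !lfE !lfstE !lsndE /= !cmapE linearD.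
Defined.

Lemma csum_outE X Y Z (f : cmap X Z) (g : cmap Y Z) i p :
  csum_out f g i p = f i p.1 + g i p.2.
Proof. by rewrite /= !lfE lfstE lsndE. Qed.

Lemma csum_coc X Y i p :
  (p \in cocycles (complex_sum X Y) i) = (p.1 \in cocycles X i) && (p.2 \in cocycles Y i).
Proof. by rewrite !(@cocP _ _ _ i (i + 1)) // complex_sumE. Qed.

Lemma csum_cob X Y i p : (p \in coboundaries (complex_sum X Y) i) =
  (p.1 \in coboundaries X i) && (p.2 \in coboundaries Y i).
Proof.
apply/idP/andP=> [pB|[pX pY]].
  have := cmap_cob (csum_fst X Y) pB; have := cmap_cob (csum_snd X Y) pB.
  by rewrite csum_fstE csum_sndE.
have := memvD (cmap_cob (csum_inl X Y) pX) (cmap_cob (csum_inr X Y) pY).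
rewrite csum_inlE csum_inrE (_ : (p.1, 0) + (0, p.2) = p) //.
by apply: injective_projections; rewrite /= ?addr0 ?add0r.
Qed.

(** * Cohomology dimensions, length and width *)

Section Hdim.
Variables (X : complex A) (i : int).
Local Notation C := (cocycles X i :\: coboundaries X i)%VS.

(** The complement [C] stands in for the cohomology space, so that no quotient is ever formed. *)
Lemma hdim_diff : \dim C = hdim X i.
Proof.
have := dimv_cap_compl (cocycles X i) (coboundaries X i).
rewrite (capv_idPr _); last exact: coboundaries_sub.
by rewrite /hdim => <-; rewrite addKn.
Qed.

Lemma coc_split x : x \in cocycles X i ->
  exists c b, [/\ c \in C, b \in coboundaries X i & x = c + b].
Proof.
move=> xZ; have : x \in (C + coboundaries X i)%VS.
  by rewrite addv_diff (addv_idPl (coboundaries_sub X i)).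
by case/memv_addP=> c cC [b bB ->]; exists c, b.
Qed.
End Hdim.

Lemma hdim_Hsurj X Y (f : cmap X Y) i : Hsurj f i -> (hdim Y i <= hdim X i)%N.
Proof.
move=> fS; set C := (cocycles X i :\: coboundaries X i)%VS.
have le : (cocycles Y i <= (f i @: C) + coboundaries Y i)%VS.
  apply/subvP => y /fS[x /coc_split[c [b [cC bB ->]]] H].
  rewrite -[y](subrK (f i (c + b))) addrC memvD //.
    by rewrite linearD memv_add ?memv_img ?cmap_cob.
  exact: subvP (addvSr _ _) _ H.
rewrite leq_subLR addnC; apply: leq_trans (dimvS le) _.
apply: leq_trans (dimv_add_leqif _ _) _; rewrite leq_add2r -hdim_diff.
by rewrite -(limg_ker_dim (f i) C) leq_addl.
Qed.

Lemma hdim_Hinj X Y (f : cmap X Y) i : Hinj f i -> (hdim X i <= hdim Y i)%N.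
Proof.
move=> fI; set C := (cocycles X i :\: coboundaries X i)%VS.
have C0 c : c \in C -> f i c \in coboundaries Y i -> c = 0.
  move=> cC fc; have cZ := subvP (diffvSl _ _) _ cC.
  apply/eqP; rewrite -memv0 -(capv_diff (cocycles X i) (coboundaries X i)) memv_cap.
  by rewrite cC fI.
have capE : ((f i @: C) :&: coboundaries Y i = 0)%VS.
  apply/eqP; rewrite -subv0; apply/subvP => _ /memv_capP[/memv_imgP[c cC ->]] /(C0 _ cC) ->.
  by rewrite linear0 mem0v.
have le : ((f i @: C) + coboundaries Y i <= cocycles Y i)%VS.
  rewrite subv_add coboundaries_sub andbT; apply/subvP => _ /memv_imgP[c cC ->].
  exact/cmap_coc/(subvP (diffvSl _ _) _ cC).
have := dimvS le; rewrite dimv_disjoint_sum // limg_dim_eq.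
  by rewrite hdim_diff /hdim; lia.
apply/eqP; rewrite -subv0; apply/subvP => c /memv_capP[cC]; rewrite memv_ker => /eqP fc.
by rewrite memv0; apply/eqP/C0; rewrite // fc mem0v.
Qed.

Lemma hdim_qis X Y (f : cmap X Y) i : quasi_iso f -> hdim X i = hdim Y i.
Proof.
by move=> fq; have [fI fS] := fq i; apply/eqP; rewrite eqn_leq (hdim_Hinj fI) (hdim_Hsurj fS).
Qed.

Lemma hdim_db_iso X Y i : db_iso X Y -> hdim X i = hdim Y i.
Proof.
by move=> /db_isoP[V [a [b [aq bq]]]]; rewrite -(hdim_qis i aq) (hdim_qis i bq).
Qed.

Lemma hdim_eq0 X i : hdim X i = 0%N <-> Hzero X i.
Proof.
rewrite /hdim; split=> [/eqP|H].
  rewrite subn_eq0 => le; have /eqP e : coboundaries X i == cocycles X i.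
    by rewrite eqEdim coboundaries_sub.
  by rewrite /Hzero e.
by apply/eqP; rewrite subn_eq0; apply: dimvS; apply/subvP.
Qed.

Lemma Hzero_out X i : (cbound X < `|i|)%N -> Hzero X i.
Proof. by move=> lti x _; rewrite (cboundP lti x) mem0v. Qed.

Lemma hdim_win X i : hdim X i != 0%N ->
  exists2 a : nat, (a < (cbound X).*2.+1)%N & i = wdeg X a.
Proof.
move=> hi; have le : (`|i| <= cbound X)%N.
  by rewrite leqNgt; apply: contra_neqN hi => /Hzero_out/hdim_eq0.
exists (absz (i + (cbound X)%:Z)); rewrite ?/wdeg -?addnn; lia.
Qed.

Lemma hdim_le_hl X i : (hdim X i <= hl X)%N.
Proof.
have [->//|/hdim_win[a la ->]] := eqVneq (hdim X i) 0%N.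
exact: (@leq_bigmax _ (fun b : 'I_(cbound X).*2.+1 => hdim X (wdeg X b)) (Ordinal la)).
Qed.

Lemma width_le_hw X i j : hdim X i != 0%N -> hdim X j != 0%N -> (i <= j)%R ->
  (`|j - i|%N + 1 <= hw X)%N.
Proof.
move=> hi hj; have [a la ei] := hdim_win hi; have [b lb ej] := hdim_win hj.
rewrite ei ej in hi hj * => leij.
apply: leq_trans (@leq_bigmax _ (fun i : 'I_(cbound X).*2.+1 => \max_(j < (cbound X).*2.+1 |
  [&& (i <= j)%N, hdim X (wdeg X i) != 0%N & hdim X (wdeg X j) != 0%N]) (j - i + 1)%N) (Ordinal la)).
have leab : (a <= b)%N by rewrite /wdeg in leij; lia.
apply: leq_trans (@leq_bigmax_cond _ (fun j : 'I_(cbound X).*2.+1 =>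
  [&& (a <= j)%N, hdim X (wdeg X a) != 0%N & hdim X (wdeg X j) != 0%N])
  (fun j : 'I_(cbound X).*2.+1 => (j - a + 1)%N) (Ordinal lb) _); last by rewrite /= leab hi hj.
rewrite /= /wdeg; lia.
Qed.

Lemma hl_le X n : (forall i, hdim X i <= n)%N -> (hl X <= n)%N.
Proof. by move=> H; apply/bigmax_leqP => i _. Qed.

Lemma hw_le X n : (forall i j, hdim X i != 0%N -> hdim X j != 0%N -> (i <= j)%R ->
  (`|j - i|%N + 1 <= n)%N) -> (hw X <= n)%N.
Proof.
move=> H; apply/bigmax_leqP => i _; apply/bigmax_leqP => j /and3P[le hi hj].
apply: leq_trans (H _ _ hi hj _); rewrite /wdeg; lia.
Qed.

(** When some cohomology is nonzero, [hl] and [hw] are both positive, so each is at most their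
    product. *)
Lemma hr_bounds X N : (hr X <= N)%N -> ~ acyclic X ->
  (forall i, hdim X i <= N)%N /\
  (forall i j, hdim X i != 0%N -> hdim X j != 0%N -> (`|j - i| < N)%N).
Proof.
move=> le nA; have [i0 hi0] : exists i, hdim X i != 0%N.
  apply: contrapT => H; apply: nA => i; apply/hdim_eq0/eqP/negPn/negP => hi.
  by apply: H; exists i.
have hw0 : (0 < hw X)%N.
  by apply: leq_trans (width_le_hw hi0 hi0 _); rewrite ?addn1.
have hl0 : (0 < hl X)%N by apply: leq_trans (hdim_le_hl X i0); rewrite lt0n.
have hwN : (hw X <= N)%N by apply: leq_trans le; rewrite leq_pmull.
split=> [i|i j hi hj].
  by apply: leq_trans (hdim_le_hl X i) _; apply: leq_trans le; rewrite leq_pmulr.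
apply: leq_trans hwN; case: (boolP (i <= j)%R) => ij.
  by have := width_le_hw hi hj ij; rewrite addn1.
have ji : (j <= i)%R by lia.
by have := width_le_hw hj hi ji; lia.
Qed.

(** * Shifts and isomorphisms of complexes *)

Lemma shift_coc n X i (x : shift n X i) :
  (x \in cocycles (shift n X) i) = (x \in cocycles X (n + i)).
Proof.
rewrite (@cocP _ _ (shift n X) i (i + 1)) // (@cocP _ _ X (n + i) (n + (i + 1))); last exact: addrA.
have nz : (-1 : k) ^ n != 0 by rewrite expfz_neq0 // oppr_eq0 oner_eq0.
by rewrite shiftE scaler_eq0 (negPf nz).
Qed.

Lemma shift_cob n X i (x : shift n X i) :
  (x \in coboundaries (shift n X) i) = (x \in coboundaries X (n + i)).
Proof.
have en : n + (i - 1) = n + i - 1 by rewrite addrA.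
apply/idP/idP=> [/(@cobP _ _ (shift n X) (i - 1) i _ erefl)|/(@cobP _ _ X (n + (i - 1)) _ _ en)] [y ->].
  by rewrite shiftE; apply: memvZ; exact: (@cdiff_cob k A X (n + (i - 1)) (n + i) y).
apply/(@cobP _ _ (shift n X) (i - 1) i _ erefl); exists ((-1) ^ (- n) *: y).
by rewrite shiftE linearZ scalerA -expfzDr ?oppr_eq0 ?oner_eq0 // subrr expr0z scale1r.
Qed.

Lemma shift_Hzero n X i : Hzero (shift n X) i <-> Hzero X (n + i).
Proof.
split=> H x xZ; last by rewrite shift_cob; apply: H; rewrite -shift_coc.
by have := H x; rewrite shift_coc shift_cob; apply.
Qed.

Lemma hdim_shift n X i : hdim (shift n X) i = hdim X (n + i).
Proof.
apply: (congr2 (fun U V : {vspace X (n + i)} => (\dim U - \dim V)%N)).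
  by apply/vspaceP => x; exact: shift_coc.
by apply/vspaceP => x; exact: shift_cob.
Qed.

Definition shift_map n X Y (f : cmap X Y) : cmap (shift n X) (shift n Y).
Proof.
refine (@mkcmap k A (shift n X) (shift n Y) (fun i => f (n + i)) (fun i => cfun_rmorph f _) _).
by move=> i x; rewrite !shiftE linearZ /= cmapE.
Defined.

Lemma qis_shift n X Y (f : cmap X Y) : quasi_iso f -> quasi_iso (shift_map n f).
Proof.
move=> fq i; have [fI fS] := fq (n + i); split=> x; rewrite shift_coc.
  by move=> xZ; rewrite shift_cob shift_cob; exact: fI.
by case/fS=> y yZ yx; exists y; rewrite ?shift_coc ?shift_cob.
Qed.

Definition ciso X Y (f : cmap X Y) := forall i, lker (f i) = 0%VS /\ limg (f i) = fullv.

Lemma cisoP X Y (f : cmap X Y) : (forall i, bijective (f i)) -> ciso f.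
Proof.
move=> fb i; have [g fK gK] := fb i; split.
  by apply/eqP/lker0P; exact: can_inj fK.
by apply/vspaceP => y; rewrite memvf -[y]gK memv_img ?memvf.
Qed.

Section Inverse.
Variables (X Y : complex A) (f : cmap X Y).
Hypothesis fi : ciso f.

Lemma cinvK1 i x : (f i)^-1%VF (f i x) = x.
Proof. by apply: lker0_lfunK; case: (fi i) => ->. Qed.
Lemma cinvK2 i y : f i ((f i)^-1%VF y) = y.
Proof. by apply: limg_lfunVK; case: (fi i) => _ ->; rewrite memvf. Qed.

Definition cinv : cmap Y X.
Proof.
refine (@mkcmap k A Y X (fun i => (f i)^-1%VF) _ _).
  by move=> i; have [f0 f1] := fi i; apply: is_rmorph_inv; rewrite ?f0 //; exact: cfun_rmorph.
by move=> i y; rewrite -[in LHS](cinvK2 y) -cmapE cinvK1.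
Defined.

Lemma cinvK i x : cinv i (f i x) = x. Proof. exact: cinvK1. Qed.
Lemma cinvVK i x : f i (cinv i x) = x. Proof. exact: cinvK2. Qed.

Lemma ciso_qis : quasi_iso f.
Proof.
move=> i; split=> [x xZ /(cmap_cob cinv)|y yZ]; first by rewrite cinvK.
by exists (cinv i y); rewrite ?cmap_coc // cinvVK subrr mem0v.
Qed.
End Inverse.

Definition unshift n X : cmap (shift (- n) (shift n X)) X.
Proof.
refine (@mkcmap k A (shift (- n) (shift n X)) X (fun i => idfam X (n + (- n + i)) i) _ _).
  by move=> i; exact: (@idfam_rmorph k A X (n + (- n + i)) i).
move=> i x; rewrite !shiftE scalerA -expfzDr ?oppr_eq0 ?oner_eq0 // addNr expr0z scale1r.
rewrite cdiff_idfam; last by lia.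
apply: (@idfam_cdiff k A X (n + (- n + i)) (n + (- n + (i + 1))) (i + 1) x); lia.
Defined.

Lemma unshift_qis n X : quasi_iso (unshift n X).
Proof.
apply: ciso_qis; apply: cisoP => i.
have e : n + (- n + i) = i by rewrite addrA addrN add0r.
by exists (idfam X i (n + (- n + i))) => x; rewrite /= idfamK.
Qed.

Definition shift_sum n X Y : cmap (shift n (complex_sum X Y)) (complex_sum (shift n X) (shift n Y)).
Proof.
refine (@mkcmap k A (shift n (complex_sum X Y)) (complex_sum (shift n X) (shift n Y))
  (fun i => \1%VF) (fun i => rmorph_id _) _).
by move=> i x; rewrite !lfE complex_sumE !shiftE complex_sumE.
Defined.

Lemma shift_sum_qis n X Y : quasi_iso (shift_sum n X Y).
Proof. by apply: ciso_qis; apply: cisoP => i; exists id => x; rewrite /= id_lfunE. Qed.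

Lemma db_indecomposableP X : db_indecomposable X <-> ~ acyclic X /\
  forall Y Z V (a : cmap V X) (b : cmap V (complex_sum Y Z)),
    quasi_iso a -> quasi_iso b -> acyclic Y \/ acyclic Z.
Proof.
split=> -[nz H]; split.
- by move/db_zeroP.
- move=> Y Z V a b aq bq; have /H : db_iso X (complex_sum Y Z) by apply/db_isoP; exists V, a, b.
  by case=> /db_zeroP; [left | right].
- by move/db_zeroP.
- move=> Y Z /db_isoP[V [a [b [aq bq]]]].
  by case: (H _ _ _ _ _ aq bq) => /db_zeroP; [left | right].
Qed.

Lemma shift_acyclic n X : acyclic (shift n X) <-> acyclic X.
Proof.
split=> H i; last exact/shift_Hzero.
by have /shift_Hzero := H (- n + i); rewrite addrA addrN add0r.
Qed.

Lemma shift_indec n X : db_indecomposable X -> db_indecomposable (shift n X).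
Proof.
move=> /db_indecomposableP[nA H]; apply/db_indecomposableP; split.
  by move/shift_acyclic.
move=> Y Z V a b aq bq.
have aq' := qis_comp (qis_shift (- n) aq) (@unshift_qis n X).
have bq' := qis_comp (qis_shift (- n) bq) (@shift_sum_qis (- n) Y Z).
by case: (H _ _ _ _ _ aq' bq') => /shift_acyclic; [left | right].
Qed.

Lemma derived_finite_bounded : derived_finite A -> derived_bounded A.
Proof.
move=> [n [Y HY]]; exists (\max_(i < n) hr (Y i)) => X /HY[i [m iso]].
apply: leq_trans (leq_bigmax i).
have hE j : hdim X j = hdim (Y i) (m + j) by rewrite (hdim_db_iso j iso) hdim_shift.
apply: leq_mul.
  by apply: hl_le => j; rewrite hE hdim_le_hl.
apply: hw_le => j l; rewrite !hE => hj hl le; have := width_le_hw hj hl.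
by rewrite (_ : m + l - (m + j) = l - j); [apply; lia | lia].
Qed.

End Derived.

(** * Indecomposable complexes of projectives *)

Section Indecomposable.
Variables (k : fieldType) (A : falgType k).
Implicit Types (X Y Z V Q : complex A).

Lemma daddv_pi0 (W : vectType k) (U V : {vspace W}) v :
  (U :&: V = 0)%VS -> v \in V -> daddv_pi U V v = 0.
Proof.
move=> UV vV; have := daddv_pi_add UV (subvP (addvSr U V) _ vV).
by rewrite (@daddv_pi_id _ _ V U) ?[(V :&: U)%VS]capvC // => /(canRL (addrK _)); rewrite subrr.
Qed.

Lemma daddv_pi_morph (W W' : vectType k) (U V : {vspace W}) (U' V' : {vspace W'})
    (f : 'Hom(W, W')) x :
  (U :&: V = 0)%VS -> (U + V = fullv)%VS -> (U' :&: V' = 0)%VS ->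
  (forall u, u \in U -> f u \in U') -> (forall v, v \in V -> f v \in V') ->
  f (daddv_pi U V x) = daddv_pi U' V' (f x).
Proof.
move=> UV UVf UV' fU fV; have : x \in (U + V)%VS by rewrite UVf memvf.
case/memv_addP=> u uU [v vV ->]; rewrite linearD /= (daddv_pi_id UV uU) (daddv_pi0 UV vV) addr0.
rewrite [f (u + v)]linearD linearD /= (daddv_pi_id UV' (fU _ uU)).
by rewrite (daddv_pi0 UV' (fV _ vV)) addr0.
Qed.

(** The idempotents are strict chain maps, not homotopy classes. The zero complex and contractible
    complexes may therefore satisfy this, and non-acyclicity is added wherever the derived category
    is concerned. *)
Definition cind X := forall e : cmap X X, (forall i x, e i (e i x) = e i x) ->
  (forall i x, e i x = 0) \/ (forall i x, e i x = x).

Lemma cind_compl X (U V : forall i, {vspace X i}) : cind X ->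
  (forall i a x, x \in U i -> ract (X i) a x \in U i) ->
  (forall i a x, x \in V i -> ract (X i) a x \in V i) ->
  (forall i j x, x \in U i -> cdiff X i j x \in U j) ->
  (forall i j x, x \in V i -> cdiff X i j x \in V j) ->
  (forall i, (U i :&: V i = 0)%VS) -> (forall i, (U i + V i = fullv)%VS) ->
  (forall i, U i = 0%VS) \/ (forall i, V i = 0%VS).
Proof.
move=> Xi Ua Va Ud Vd UV UVf; pose e i := daddv_pi (U i) (V i).
have em i : is_rmorph (e i).
  by apply: is_rmorphI => a x; apply/esym/daddv_pi_morph => //; [exact: Ua | exact: Va].
have ed i x : e (i + 1) (cdiff X i (i + 1) x) = cdiff X i (i + 1) (e i x).
  by apply/esym/daddv_pi_morph => //; [exact: Ud | exact: Vd].
have [|e0|e1] := Xi (mkcmap em ed).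
- by move=> i x; rewrite /= /e daddv_pi_proj.
- left=> i; apply/eqP; rewrite -subv0; apply/subvP => u uU.
  by rewrite memv0 -(e0 i u) /= /e daddv_pi_id.
- right=> i; apply/eqP; rewrite -subv0; apply/subvP => v vV.
  by rewrite memv0 -(e1 i v) /= /e daddv_pi0.
Qed.

Fixpoint cpow X (e : cmap X X) m : cmap X X :=
  if m is n.+1 then cmap_comp e (cpow e n) else cmap_id X.

Lemma cpowE X (e : cmap X X) m i x : cpow e m i x = iter m (e i) x.
Proof. by elim: m => [|m IHm] /=; rewrite lfE // IHm. Qed.

Definition win X : seq int := [seq wdeg X a | a <- iota 0 (cbound X).*2.+1].

Lemma win_uniq X : uniq (win X).
Proof. by rewrite map_inj_uniq ?iota_uniq // => a b; rewrite /wdeg; lia. Qed.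

Lemma mem_win X i : (i \in win X) = (`|i| <= cbound X)%N.
Proof.
apply/mapP/idP => [[a]|le].
  by rewrite mem_iota add0n /wdeg -addnn => le ->; lia.
exists (absz (i + (cbound X)%:Z)); first by rewrite mem_iota -addnn; lia.
by rewrite /wdeg; lia.
Qed.

Lemma win_out X i (x : X i) : i \notin win X -> x = 0.
Proof. by rewrite mem_win -ltnNge => /cboundP; apply. Qed.

Lemma dim0 (U : vectType k) : (forall v : U, v = 0) -> dim U = 0%N.
Proof.
move=> U0; rewrite -dimvf; apply/eqP; rewrite dimv_eq0 -subv0.
by apply/subvP => v _; rewrite (U0 v) mem0v.
Qed.

Lemma big_win (R : Type) (idx : R) (op : Monoid.com_law idx) (F : int -> R) X s :
  uniq s -> {subset win X <= s} -> (forall i, i \notin win X -> F i = idx) ->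
  \big[op/idx]_(i <- s) F i = \big[op/idx]_(i <- win X) F i.
Proof.
move=> su sub F0; rewrite (bigID (mem (win X))) /= [X in op _ X]big1 ?Monoid.mulm1 => [|i /F0//].
rewrite -big_filter; apply: perm_big; apply: uniq_perm; rewrite ?filter_uniq ?win_uniq //.
move=> i; rewrite mem_filter; apply/andP/idP => [[]//|iX]; split=> //; exact: sub.
Qed.

(** An upper bound on the total of [F] by that of [F'] leaves no room for a strict inequality in any
    single degree. Equalities of total ranks thus become equalities of ranks in each degree. *)
Lemma sum_leq_eq (s : seq int) (F F' : int -> nat) i : i \in s -> uniq s ->
  (forall j, F' j <= F j)%N -> (\sum_(j <- s) F j <= \sum_(j <- s) F' j)%N -> (F i <= F' i)%N.
Proof.
move=> si su le; rewrite !(bigD1_seq i si su) /= => H.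
have H' : (\sum_(j <- s | j != i) F' j <= \sum_(j <- s | j != i) F j)%N by apply: leq_sum.
by rewrite -(leq_add2r (\sum_(j <- s | j != i) F' j)) (leq_trans _ H) // leq_add2l.
Qed.

Definition tdim X := (\sum_(i <- win X) dim (X i))%N.

Lemma tdim_seq X s : uniq s -> {subset win X <= s} ->
  (\sum_(i <- s) dim (X i) = tdim X)%N.
Proof.
by move=> su sub; apply: big_win => // i Hi; apply: dim0 => v; exact: win_out.
Qed.

Lemma tdim_le X Y : (forall i, dim (X i) <= dim (Y i))%N -> (tdim X <= tdim Y)%N.
Proof.
move=> H; have su := undup_uniq (win X ++ win Y).
rewrite -(tdim_seq su) => [|i]; last by rewrite mem_undup mem_cat => ->.
rewrite -(tdim_seq su) => [|i]; last by rewrite mem_undup mem_cat orbC => ->.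
exact: leq_sum.
Qed.

Lemma tdimD X Y Z : (forall i, dim (X i) = dim (Y i) + dim (Z i))%N ->
  (tdim X = tdim Y + tdim Z)%N.
Proof.
move=> H; have su := undup_uniq (win X ++ win Y ++ win Z).
rewrite -(tdim_seq su) => [|i]; last by rewrite mem_undup !mem_cat => ->.
rewrite -(@tdim_seq Y _ su) => [|i]; last by rewrite mem_undup !mem_cat => ->; rewrite orbT.
rewrite -(@tdim_seq Z _ su) => [|i]; last by rewrite mem_undup !mem_cat => ->; rewrite !orbT.
by rewrite -big_split; apply: eq_bigr.
Qed.

Lemma dim_le_tdim X i : (dim (X i) <= tdim X)%N.
Proof.
have [iX|iX] := boolP (i \in win X); last by rewrite dim0 // => v; exact: win_out.
by rewrite /tdim (bigD1_seq i) ?win_uniq //= leq_addr.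
Qed.

Lemma tdim_gt0 X i : dim (X i) != 0%N -> (0 < tdim X)%N.
Proof. by rewrite -lt0n => /leq_trans; apply; exact: dim_le_tdim. Qed.

(** Take a positive power [g] of [e] of minimal total rank. Then [g] and its square have the same
    rank in every degree, so the image and the kernel of [g] are complementary subcomplexes, and one
    of them vanishes. *)
Lemma fitting X (e : cmap X X) : cind X ->
  (exists m, forall i x, iter m (e i) x = 0) \/ ciso e.
Proof.
move=> Xi; pose f m := (\sum_(i <- win X) \dim (limg (cpow e m i)))%N.
have exP : exists n, `[< exists m, n = f m.+1 >] by exists (f 1%N); apply/asboolP; exists 0%N.
have [_ /asboolP[m ->] minf] := ex_minnP exP.
(* The exponent is positive so that the kernel of [e] lies in that of [g]; with exponent 0 the
   kernel of [g] would vanish for no reason. *)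
set p := m.+1 in minf; pose g := cpow e p.
have gg i x : cpow e (p + p) i x = g i (g i x) by rewrite !cpowE iterD.
have imgE i : (limg (cpow e (p + p) i) = g i @: limg (g i))%VS.
  rewrite -limg_comp; apply: eq_in_limg => x _; by rewrite gg lfE.
have le i : (\dim (limg (cpow e (p + p) i)) <= \dim (limg (g i)))%N.
  by rewrite imgE; apply/dimvS/limgS/subvf.
have eqd i : \dim (limg (cpow e (p + p) i)) = \dim (limg (g i)).
  have [iX|iX] := boolP (i \in win X); last first.
    have U0 (U : {vspace X i}) : \dim U = 0%N.
      apply/eqP; rewrite -leqn0 -(dim0 (fun v : X i => win_out v iX)) -dimvf.
      exact/dimvS/subvf.
    by rewrite !U0.
  have : (f p <= f (p + p))%N.
    by apply: minf; apply/asboolP; exists (m + p)%N; rewrite /p addSn.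
  move/(sum_leq_eq iX (win_uniq X) le) => H.
  by apply/eqP; rewrite eqn_leq le.
have [||||i|i|H|H] := @cind_compl X (fun i => limg (g i)) (fun i => lker (g i)) Xi.
- by move=> i a _ /memv_imgP[x _ ->]; rewrite -cfun_ract memv_img ?memvf.
- by move=> i a x; rewrite !memv_ker cfun_ract => /eqP ->; rewrite linear0.
- by move=> i j _ /memv_imgP[x _ ->]; rewrite -cmapE memv_img ?memvf.
- by move=> i j x; rewrite !memv_ker cmapE => /eqP ->; rewrite linear0.
- apply/eqP; rewrite -dimv_eq0; have := limg_ker_dim (g i) (limg (g i)).
  rewrite -imgE eqd; lia.
- apply/eqP; rewrite eqEdim subvf dimv_disjoint_sum.
    by have := limg_ker_dim (g i) fullv; rewrite capfv => <-; rewrite addnC leqnn.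
  apply/eqP; rewrite -dimv_eq0; have := limg_ker_dim (g i) (limg (g i)).
  rewrite -imgE eqd; lia.
- left; exists p => i x; rewrite -cpowE; apply/eqP; rewrite -memv0 -(H i).
  by rewrite memv_img ?memvf.
- right=> i; have e0 : lker (e i) == 0%VS.
    rewrite -subv0 -(H i); apply/subvP => x; rewrite !memv_ker /g cpowE => /eqP ex.
    by rewrite /p iterSr ex; elim: (m) => //= n /eqP ->; rewrite linear0.
  by rewrite lker0_limgf // (eqP e0).
Qed.

Lemma ciso_comp X Y Z (f : cmap X Y) (g : cmap Y Z) :
  ciso f -> ciso g -> ciso (cmap_comp g f).
Proof.
move=> fi gi; apply: cisoP => i; exists (fun z => cinv fi i (cinv gi i z)) => x /=.
  by rewrite lfE !cinvK.
by rewrite lfE !cinvVK.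
Qed.

Lemma ciso_ext X Y (f g : cmap X Y) : (forall i x, f i x = g i x) -> ciso f -> ciso g.
Proof. by move=> fg fi i; have -> : g i = f i by apply/lfunP => x; rewrite fg. Qed.

(** The endomorphism ring is local: apply [fitting] to the composite of [e] with the inverse of [g].
    It is the identity on the kernel of [f], so if it is nilpotent then [f] is injective. *)
Lemma cind_local X (e f g : cmap X X) : cind X ->
  (forall i x, g i x = e i x + f i x) -> ciso g -> ciso e \/ ciso f.
Proof.
move=> Xi gE gi.
have [[m em]|ei] := fitting (cmap_comp (cinv gi) e) Xi; last first.
  left; apply: ciso_ext (ciso_comp ei gi) => i x.
  by rewrite /= !lfE cinvVK.
right=> i; have f0 : lker (f i) == 0%VS.
  rewrite -subv0; apply/subvP => x; rewrite memv_ker memv0 => /eqP fx.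
  have ex : cmap_comp (cinv gi) e i x = x.
    by rewrite /= lfE -[e i x]addr0 -fx -gE cinvK.
  by rewrite -(em i x); elim: (m) => //= n /eqP <-; rewrite ex.
by rewrite lker0_limgf // (eqP f0).
Qed.

(** * Splitting strict idempotents *)

Definition lvsval (V : vectType k) (U : {vspace V}) : 'Hom(subvs_of U, V) := linfun vsval.
Definition lvsproj (V : vectType k) (U : {vspace V}) : 'Hom(V, subvs_of U) := linfun (vsproj U).
Lemma lvsvalE (V : vectType k) (U : {vspace V}) u : lvsval U u = vsval u.
Proof. exact: lfunE. Qed.
Lemma lvsprojE (V : vectType k) (U : {vspace V}) x : lvsproj U x = vsproj U x.
Proof. exact: lfunE. Qed.

Section Submodule.
Variables (M : rmodule A) (U : {vspace M}).
Hypothesis Us : forall a x, x \in U -> ract M a x \in U.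

Definition sub_act a : 'End(subvs_of U) := (lvsproj U \o (ract M a \o lvsval U))%VF.

Lemma sub_actE a u : vsval (sub_act a u) = ract M a (vsval u).
Proof.
by rewrite !comp_lfunE lvsprojE lvsvalE vsprojK ?Us ?subvsP.
Qed.

Definition submod : rmodule A.
Proof.
refine (@RModule k A (subvs_of U) sub_act _ _ _).
- move=> c a b; apply/lfunP => u; apply: val_inj; rewrite /= sub_actE ract_linearl.
  by rewrite add_lfunE scale_lfunE /= !sub_actE.
- by apply/lfunP => u; apply: val_inj; rewrite /= sub_actE ract1E id_lfunE.
- by move=> a b; apply/lfunP => u; apply: val_inj; rewrite /= sub_actE ractME comp_lfunE !sub_actE.
Defined.

Lemma submodE a (u : submod) : vsval (ract submod a u : subvs_of U) = ract M a (vsval (u : subvs_of U)).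
Proof. exact: sub_actE. Qed.
End Submodule.

Section Split.
Variables (X : complex A) (e : cmap X X).
Hypothesis ee : forall i x, e i (e i x) = e i x.
Local Notation U i := (limg (e i)).

Lemma split_stable i a x : x \in U i -> ract (X i) a x \in U i.
Proof. by case/memv_imgP=> y _ ->; rewrite -cfun_ract memv_img ?memvf. Qed.

Lemma split_diffP i j (u : subvs_of (U i)) : cdiff X i j (vsval u) \in U j.
Proof. by have /memv_imgP[y _ ->] := subvsP u; rewrite -cmapE memv_img ?memvf. Qed.

Definition split_diff i j : 'Hom(subvs_of (U i), subvs_of (U j)) :=
  (lvsproj (U j) \o (cdiff X i j \o lvsval (U i)))%VF.

Lemma split_diffE i j u : vsval (split_diff i j u) = cdiff X i j (vsval u).
Proof.
by rewrite !comp_lfunE lvsprojE lvsvalE vsprojK // split_diffP.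
Qed.

Definition cimg : complex A.
Proof.
refine (@Complex k A (fun i => submod (@split_stable i)) split_diff _ _ _ (cbound X) _).
- move=> i j; apply: is_rmorphI => a u; apply: val_inj; rewrite /= split_diffE.
  by rewrite !submodE split_diffE cdiff_ract.
- move=> i j ij; apply/lfunP => u; apply: val_inj.
  by rewrite /= split_diffE cdiff_shape // !zero_lfunE.
- move=> i j l; apply/lfunP => u; apply: val_inj.
  by rewrite /= comp_lfunE !split_diffE cdiffKE zero_lfunE.
- by move=> i Xi v; apply: val_inj; exact: (cboundP Xi).
Defined.

Definition cimg_in : cmap cimg X.
Proof.
refine (@mkcmap k A cimg X (fun i => lvsval (U i)) _ _).
- by move=> i; apply: is_rmorphI => a u; rewrite !lvsvalE; exact: submodE.
- by move=> i u; rewrite !lvsvalE; exact: split_diffE.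
Defined.

Lemma cimg_inE i u : cimg_in i u = vsval (u : subvs_of (U i)).
Proof. exact: lvsvalE. Qed.

Definition cimg_out_fun i : 'Hom(X i, subvs_of (U i)) := (lvsproj (U i) \o e i)%VF.

Lemma cimg_out_funE i x : vsval (cimg_out_fun i x) = e i x.
Proof. by rewrite comp_lfunE lvsprojE vsprojK ?memv_img ?memvf. Qed.

Definition cimg_out : cmap X cimg.
Proof.
refine (@mkcmap k A X cimg cimg_out_fun _ _).
- move=> i; apply: is_rmorphI => a x; apply: val_inj; rewrite /= cimg_out_funE cfun_ract.
  by rewrite -(cimg_out_funE x); apply/esym; exact: submodE.
- move=> i x; apply: val_inj; rewrite /= cimg_out_funE cmapE -(cimg_out_funE x).
  by apply/esym; exact: split_diffE.
Defined.

Lemma cimg_outE i x : vsval (cimg_out i x : subvs_of (U i)) = e i x.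
Proof. exact: cimg_out_funE. Qed.

Lemma cimg_out_in i u : cimg_out i (cimg_in i u) = u.
Proof.
apply: val_inj; rewrite /= cimg_outE cimg_inE.
by have /memv_imgP[y _ ->] := subvsP u; rewrite ee.
Qed.

Lemma cimg_in_out i x : cimg_in i (cimg_out i x) = e i x.
Proof. by rewrite cimg_inE cimg_outE. Qed.
End Split.

Definition splits X Y Z (i1 : cmap Y X) (r1 : cmap X Y) (i2 : cmap Z X) (r2 : cmap X Z) :=
  [/\ forall i y, r1 i (i1 i y) = y, forall i z, r2 i (i2 i z) = z &
      forall i x, i1 i (r1 i x) + i2 i (r2 i x) = x].

Lemma retract_proj X Y (i1 : cmap Y X) (r1 : cmap X Y) :
  (forall i y, r1 i (i1 i y) = y) -> projc X -> projc Y.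
Proof.
move=> ri Xp i; apply: projective_retract (cfun_rmorph i1 i) (cfun_rmorph r1 i) _ (Xp i).
exact: ri.
Qed.

Lemma splits0 X Y Z (i1 : cmap Y X) (r1 : cmap X Y) (i2 : cmap Z X) (r2 : cmap X Z) :
  splits i1 r1 i2 r2 -> (forall i z, r1 i (i2 i z) = 0) /\ (forall i y, r2 i (i1 i y) = 0).
Proof.
move=> [ri1 ri2 ir]; split=> i z.
  have /eqP := ir i (i2 i z); rewrite ri2 -subr_eq0 addrK => /eqP H.
  by rewrite -(ri1 i (r1 i (i2 i z))) H linear0.
have /eqP := ir i (i1 i z); rewrite ri1 -subr_eq0 addrAC subrr add0r => /eqP H.
by rewrite -(ri2 i (r2 i (i1 i z))) H linear0.
Qed.

Lemma splits_dim X Y Z (i1 : cmap Y X) (r1 : cmap X Y) (i2 : cmap Z X) (r2 : cmap X Z) i :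
  splits i1 r1 i2 r2 -> dim (X i) = (dim (Y i) + dim (Z i))%N.
Proof.
move=> S; have [ri1 ri2 ir] := S; have [r12 r21] := splits0 S.
have d1 : \dim (limg (r1 i)) = dim (Y i).
  rewrite -dimvf; congr (\dim _); apply/vspaceP => y.
  by rewrite memvf -(ri1 i y) memv_img ?memvf.
have kE : lker (r1 i) = limg (i2 i).
  apply/vspaceP => x; rewrite memv_ker; apply/eqP/memv_imgP => [rx|[z _ ->]]; last exact: r12.
  by exists (r2 i x); rewrite ?memvf // -[LHS]ir rx linear0 add0r.
have d2 : \dim (limg (i2 i)) = dim (Z i).
  rewrite limg_dim_eq ?dimvf // capfv; apply/eqP/lker0P.
  exact: can_inj (ri2 i).
by rewrite -dimvf -(limg_ker_dim (r1 i)) capfv kE d1 d2 addnC.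
Qed.

(** A nontrivial idempotent cuts [X] into two nonzero summands, each of smaller total dimension.
    This replaces a decomposition into a list of indecomposables by an induction. *)
Lemma cdec_ind (P : complex A -> Prop) :
  (forall X, projc X -> cind X -> P X) ->
  (forall X Y Z (i1 : cmap Y X) (r1 : cmap X Y) (i2 : cmap Z X) (r2 : cmap X Z),
     splits i1 r1 i2 r2 -> projc X -> projc Y -> projc Z -> P Y -> P Z -> P X) ->
  forall X, projc X -> P X.
Proof.
move=> Pi Ps X; have [n] := ubnP (tdim X); elim: n X => // n IHn X ltn Xp.
have [/(Pi _ Xp)//|nXi] := pselect (cind X).
have [e [ee [e0 e1]]] : exists e : cmap X X, (forall i x, e i (e i x) = e i x) /\
    ~ (forall i x, e i x = 0) /\ ~ (forall i x, e i x = x).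
  apply: contrapT => H; apply: nXi => e ee.
  have [|H0] := pselect (forall i x, e i x = 0); first by left.
  have [|H1] := pselect (forall i x, e i x = x); first by right.
  by case: H; exists e.
pose f := csub (cmap_id X) e.
have fE i x : f i x = x - e i x by rewrite csubE id_lfunE.
have ff i x : f i (f i x) = f i x by rewrite !fE linearB /= ee subrr subr0.
have S : splits (cimg_in e) (cimg_out e) (cimg_in f) (cimg_out f).
  split=> i x; rewrite ?cimg_out_in //.
  by rewrite !cimg_in_out fE addrC subrK.
have td := tdimD (fun i => splits_dim i S).
have [S1 S2 S3] := S.
have neY i x : e i x != 0 -> (0 < tdim (cimg e))%N.
  move=> ex; apply: (@tdim_gt0 _ i); apply: contra_neqN ex => /eqP d0.
  rewrite -cimg_in_out (_ : cimg_out e i x = 0) ?linear0 //.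
  apply/eqP; rewrite -memv0; have /eqP <- : fullv == 0%VS :> {vspace cimg e i}.
    by rewrite -dimv_eq0 dimvf d0.
  exact: memvf.
have neZ i x : f i x != 0 -> (0 < tdim (cimg f))%N.
  move=> ex; apply: (@tdim_gt0 _ i); apply: contra_neqN ex => /eqP d0.
  rewrite -cimg_in_out (_ : cimg_out f i x = 0) ?linear0 //.
  apply/eqP; rewrite -memv0; have /eqP <- : fullv == 0%VS :> {vspace cimg f i}.
    by rewrite -dimv_eq0 dimvf d0.
  exact: memvf.
have Y0 : (0 < tdim (cimg e))%N.
  apply/negPn/negP => H; apply: e0 => i x; apply/eqP/negPn/negP => ex.
  by case/negP: H; exact: neY ex.
have Z0 : (0 < tdim (cimg f))%N.
  apply/negPn/negP => H; apply: e1 => i x; apply/eqP; rewrite eq_sym -subr_eq0 -fE.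
  by apply/negPn/negP => ex; case/negP: H; exact: neZ ex.
have Yp := retract_proj S1 Xp; have Zp := retract_proj S2 Xp.
by apply: (Ps _ _ _ _ _ _ _ S) => //; apply: IHn => //; move: ltn; rewrite ltnS; lia.
Qed.

(** A decomposition in the derived category comes from a quasi-isomorphism [p] from [Q] to the sum,
    as [Q] consists of projectives. The projection on [Y] lifts along [p] to an endomorphism [e]
    that is idempotent only up to homotopy, hence the appeal to [fitting]: a nilpotent [e] kills the
    cohomology of [Y], an invertible one that of [Z]. *)
Lemma cind_db_indec Q : projc Q -> cind Q -> ~ acyclic Q -> db_indecomposable Q.
Proof.
move=> Qp Qi nA; apply/db_indecomposableP; split=> // Y Z V a b aq bq.
have [s Hs] := qis_lift (cmap_id Q) Qp aq.
have asq : quasi_iso (cmap_comp a s).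
  apply: (@qis_nullh _ _ _ _ (cmap_id Q)); last exact: quasi_iso_id.
  exact: (@nullh_sym _ _ _ _ (cmap_comp a s) (cmap_id Q)).
pose p := cmap_comp b s; have pq : quasi_iso p by exact: qis_comp (qis_cancell asq aq) bq.
pose g := cmap_comp (csum_inl Y Z) (cmap_comp (csum_fst Y Z) p).
have gE i x : g i x = ((p i x).1, 0) by rewrite /g comp_lfunE csum_inlE comp_lfunE csum_fstE.
have [e He] := qis_lift g Qp pq.
have pe i x : x \in cocycles Q i -> p i (e i x) - ((p i x).1, 0) \in coboundaries _ i.
  by move=> xZ; have := nullh_coc He xZ; rewrite add_lfunE opp_lfunE gE comp_lfunE.
have [[m em]|ei] := fitting e Qi; [left|right] => i y yZ.
  have : (y, 0) \in cocycles (complex_sum Y Z) i by rewrite csum_coc /= yZ mem0v.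
  case/(proj2 (pq i)) => x xZ xy.
  (* Modulo coboundaries [p] turns [e] into the projection on [Y], which fixes [(y, 0)]; so the
     class of [(y, 0)] is reached from every iterate of [e], eventually from 0. *)
  suff : (y, 0) - p i (iter m (e i) x) \in coboundaries (complex_sum Y Z) i.
    by rewrite em linear0 subr0 csum_cob => /andP[].
  elim: (m) => [//|n IHn] /=.
  have xnZ : iter n (e i) x \in cocycles Q i by rewrite -cpowE cmap_coc.
  have H := pe _ _ xnZ.
  rewrite -[(y, 0)](subrK ((p i (iter n (e i) x)).1, 0)) -addrA -[X in _ + X]opprB memvD //.
    move: IHn; rewrite !csum_cob => /andP[/= ? _].
    by rewrite subr0 mem0v andbT.
  by rewrite memvN.
have : (0, y) \in cocycles (complex_sum Y Z) i by rewrite csum_coc /= yZ mem0v.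
case/(proj2 (pq i)) => x xZ xy.
have := pe i (cinv ei i x) (cmap_coc _ xZ); rewrite cinvVK csum_cob => /andP[_ /= H].
move: xy; rewrite csum_cob => /andP[_ /= H'].
rewrite subr0 in H; by rewrite -[y](subrK (p i x).2) memvD.
Qed.

End Indecomposable.

(** * Projective models *)

Section Stalk.
Variables (k : fieldType) (A : falgType k) (n : int) (F : rmodule A).
Implicit Types X Y : complex A.

(** The degree test is abstracted to a boolean, so that the maps from and to [F] are defined by
    cases on it without transport. *)
Definition stalk_obj (b : bool) : rmodule A := if b then F else rmod0 A.
Definition stalk_pr_b (b : bool) : 'Hom(stalk_obj b, F) :=
  if b return 'Hom(stalk_obj b, F) then \1%VF else 0.
Definition stalk_in_b (b : bool) : 'Hom(F, stalk_obj b) :=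
  if b return 'Hom(F, stalk_obj b) then \1%VF else 0.

Definition stalk : complex A.
Proof.
refine (@Complex k A (fun i => stalk_obj (i == n)) (fun _ _ => 0)
  (fun _ _ => Defs.rmorph0 _ _) (fun _ _ _ => erefl) _ `|n|%N _).
- by move=> i j l; rewrite comp_lfun0l.
- move=> i ni; have /negPf -> : i != n by apply: contraTneq ni => ->; rewrite ltnn.
  by move=> v; rewrite [LHS]thinmx0 [RHS]thinmx0.
Defined.

Definition stalk_pr i : 'Hom(stalk i, F) := stalk_pr_b (i == n).
Definition stalk_in i : 'Hom(F, stalk i) := stalk_in_b (i == n).

Lemma stalk_pr_rmorph i : is_rmorph (stalk_pr i).
Proof.
rewrite /stalk_pr /=; case: (i == n); first exact: rmorph_id.
exact: Defs.rmorph0.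
Qed.

Lemma stalk_in_rmorph i : is_rmorph (stalk_in i).
Proof.
rewrite /stalk_in /=; case: (i == n); first exact: rmorph_id.
exact: Defs.rmorph0.
Qed.

Lemma stalk_inK i x : i = n -> stalk_pr i (stalk_in i x) = x.
Proof. by move=> ->; rewrite /stalk_pr /stalk_in /= eqxx /= !id_lfunE. Qed.

Lemma stalk_prK i x : stalk_in i (stalk_pr i x) = x.
Proof.
rewrite /stalk_pr /stalk_in /=; move: x; rewrite /=; case: (i == n) => x /=.
  by rewrite !id_lfunE.
by rewrite [LHS]thinmx0 [RHS]thinmx0.
Qed.

Lemma stalk_pr_neq i : i != n -> stalk_pr i = 0.
Proof. by move/negPf; rewrite /stalk_pr /=; case: (i == n). Qed.

Lemma stalk_dE i j x : cdiff stalk i j x = 0.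
Proof. exact: zero_lfunE. Qed.

Lemma stalk_cob i (x : stalk i) : x \in coboundaries stalk i -> x = 0.
Proof. by case/(@cobP _ _ stalk (i - 1) i _ erefl) => y ->; rewrite stalk_dE. Qed.

Lemma stalk_zero i (x : stalk i) : i != n -> x = 0.
Proof. by move=> ni; rewrite -[x]stalk_prK stalk_pr_neq // zero_lfunE linear0. Qed.

Lemma stalk_projc : projective F -> projc stalk.
Proof.
move=> Fp i; rewrite /= /stalk_obj; case: (i == n) => //.
by apply: projective0 => v; rewrite [LHS]thinmx0 [RHS]thinmx0.
Qed.

Lemma tdim_stalk : (tdim stalk <= dim F)%N.
Proof.
have nw : n \in win stalk by rewrite mem_win.
rewrite /tdim (bigD1_seq n) ?win_uniq //= big1 ?addn0 /stalk_obj ?eqxx //.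
by move=> i ni; apply: dim0 => v; exact: (@stalk_zero i).
Qed.
End Stalk.

Section ProjectiveModel.
Variables (k : fieldType) (A : falgType k).
Implicit Types (X Y Z V Q : complex A).

Section Cell.
Variables (Q Y : complex A) (q : cmap Q Y) (n : int) (F : rmodule A).
Variables (t : 'Hom(F, Q (n + 1))) (s : 'Hom(F, Y n)).
Hypothesis tm : is_rmorph t.
Hypothesis sm : is_rmorph s.
Hypothesis dt : forall l v, cdiff Q (n + 1) l (t v) = 0.
Hypothesis qt : forall v, q (n + 1) (t v) = cdiff Y n (n + 1) (s v).

Definition cell_att i j : 'Hom(stalk n F i, Q j) :=
  (idfam Q (n + 1) j \o (t \o stalk_pr n F i))%VF.

Lemma cell_attE i j z : cell_att i j z = idfam Q (n + 1) j (t (stalk_pr n F i z)).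
Proof. by rewrite !comp_lfunE. Qed.

Lemma cell_att_rmorph i j : is_rmorph (cell_att i j).
Proof.
apply: Defs.rmorph_comp; last exact: idfam_rmorph.
by apply: Defs.rmorph_comp => //; exact: stalk_pr_rmorph.
Qed.

Lemma cell_att_shape i j : j != i + 1 -> cell_att i j = 0.
Proof.
move=> ji; apply/lfunP => z; rewrite cell_attE zero_lfunE.
have [ei|ni] := eqVneq i n; last by rewrite stalk_pr_neq // zero_lfunE !linear0.
by rewrite idfam_neq ?zero_lfunE // -ei eq_sym.
Qed.

Lemma cell_att_diff i j l z : j = i + 1 -> l = j + 1 ->
  cdiff Q j l (cell_att i j z) + cell_att j l (cdiff (stalk n F) i j z) = 0.
Proof.
move=> ej _; rewrite stalk_dE linear0 addr0 cell_attE.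
have [ei|ni] := eqVneq i n; last by rewrite stalk_pr_neq // zero_lfunE !linear0.
by rewrite cdiff_idfam ?dt // ej ei.
Qed.

Definition cell : complex A := tw cell_att_rmorph cell_att_shape cell_att_diff.

Definition cell_fun i : 'Hom(stalk n F i, Y i) :=
  (idfam Y n i \o (s \o stalk_pr n F i))%VF.

Lemma cell_funE i z : cell_fun i z = idfam Y n i (s (stalk_pr n F i z)).
Proof. by rewrite !comp_lfunE. Qed.

Lemma cell_fun_rmorph i : is_rmorph (cell_fun i).
Proof.
apply: Defs.rmorph_comp; last exact: idfam_rmorph.
by apply: Defs.rmorph_comp => //; exact: stalk_pr_rmorph.
Qed.

Lemma cell_fun_diff i j z : j = i + 1 ->
  cell_fun j (cdiff (stalk n F) i j z) + q j (cell_att i j z) = cdiff Y i j (cell_fun i z).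
Proof.
move=> ej; rewrite stalk_dE linear0 add0r cell_attE cell_funE cmap_idfam qt.
have [ei|ni] := eqVneq i n; last by rewrite stalk_pr_neq // zero_lfunE !linear0.
by rewrite cdiff_idfam ?idfam_cdiff // ej ei.
Qed.

Definition cell_map : cmap cell Y := tw_out cell_att_rmorph cell_att_shape cell_att_diff
  cell_fun_rmorph cell_fun_diff.

Lemma cell_mapE i p : cell_map i p = q i p.1 + idfam Y n i (s (stalk_pr n F i p.2)).
Proof. by rewrite /cell_map tw_outE cell_funE. Qed.

Lemma cell_dE i j (p : cell i) : cdiff cell i j p =
  (cdiff Q i j p.1 + idfam Q (n + 1) j (t (stalk_pr n F i p.2)), 0).
Proof. by rewrite twE cell_attE stalk_dE. Qed.
End Cell.

(** Free generators in degree [n] do two things. Those indexed by [B] bound the cocycles of degree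
    [n + 1] that become coboundaries in [Y], which gives injectivity there; those indexed by [C] hit
    the cohomology of [Y] in degree [n]. Hence at most [tdim Q + h] generators, each of dimension
    [dim A]. *)
Lemma add_cell Y Q (q : cmap Q Y) (n : int) h :
  projc Q -> (forall i, (i <= n)%R -> forall x : Q i, x = 0) ->
  (forall i, (n < i)%R -> Hsurj q i) -> (forall i, (n + 1 < i)%R -> Hinj q i) ->
  (hdim Y n <= h)%N ->
  exists Q' (q' : cmap Q' Y), [/\ projc Q',
    forall i, (i <= n - 1)%R -> forall x : Q' i, x = 0,
    forall i, (n - 1 < i)%R -> Hsurj q' i,
    forall i, (n < i)%R -> Hinj q' i &
    (tdim Q' <= tdim Q + (tdim Q + h) * dim A)%N].
Proof.
move=> Qp Q0 qS qI hY.
pose B := (cocycles Q (n + 1) :&: (q (n + 1) @^-1: coboundaries Y (n + 1)))%VS.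
pose C := (cocycles Y n :\: coboundaries Y n)%VS.
pose W : vectType k := (subvs_of B * subvs_of C)%type.
(* A generator from [B] has itself as differential and goes to a chosen primitive in [Y] of its
   image under [q]; a generator from [C] has differential 0 and goes to itself. *)
pose lt : 'Hom(W, Q (n + 1)) := (lvsval B \o lfst _ _)%VF.
pose ls : 'Hom(W, Y n) := (((cdiff Y n (n + 1))^-1 \o (q (n + 1)%R \o lt)) +
   (lvsval C \o lsnd _ _))%VF.
have ltE w : lt w = vsval w.1 by rewrite comp_lfunE lfstE lvsvalE.
have lsE w : ls w = ((cdiff Y n (n + 1))^-1)%VF (q (n + 1) (vsval w.1)) + vsval w.2.
  by rewrite add_lfunE 2!comp_lfunE ltE comp_lfunE lsndE lvsvalE.
have BP (u : subvs_of B) : vsval u \in cocycles Q (n + 1) /\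
    q (n + 1) (vsval u) \in coboundaries Y (n + 1).
  by have := subvsP u; rewrite memv_cap -memv_preim => /andP[].
have qdE (u : subvs_of B) : cdiff Y n (n + 1) (((cdiff Y n (n + 1))^-1)%VF (q (n + 1) (vsval u))) =
    q (n + 1) (vsval u).
  apply: limg_lfunVK; have [_ /(@cobP _ _ Y n) H] := BP u.
  by have [|y ->] := H _; [rewrite addrK | rewrite memv_img ?memvf].
have [t tm tE] := @free_ex k A W (Q (n + 1)) lt.
have [s sm sE] := @free_ex k A W (Y n) ls.
pose F := free_mod A W.
have dt l v : cdiff Q (n + 1) l (t v) = 0.
  suff e : (cdiff Q (n + 1) l \o t)%VF = 0 by rewrite -comp_lfunE e zero_lfunE.
  apply: free_ext; first by apply: Defs.rmorph_comp => //; exact: cdiff_rmorph.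
    exact: Defs.rmorph0.
  move=> w; rewrite comp_lfunE tE ltE zero_lfunE.
  have [el|/cdiff_shape ->] := eqVneq l (n + 1 + 1); last by rewrite zero_lfunE.
  by apply/eqP; rewrite -cocP //; case: (BP w.1).
have qt v : q (n + 1) (t v) = cdiff Y n (n + 1) (s v).
  rewrite -!comp_lfunE; congr (fun_of_lfun _ v); apply: free_ext.
  - by apply: Defs.rmorph_comp => //; exact: cfun_rmorph.
  - by apply: Defs.rmorph_comp => //; exact: cdiff_rmorph.
  - move=> w; rewrite !comp_lfunE tE sE ltE lsE linearD /= qdE.
    have /(subvP (diffvSl _ _)) : vsval w.2 \in C by exact: subvsP.
    by rewrite (@cocP _ _ _ _ (n + 1)) // => /eqP ->; rewrite addr0.
exists (cell tm dt), (cell_map tm sm dt qt); split.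
- move=> i; apply: projective_sum; first exact: Qp.
  by apply: stalk_projc; exact: free_projective.
- move=> i lei [x y]; rewrite (Q0 _ _ x); last by lia.
  by rewrite (@stalk_zero _ _ n F i y) //; lia.
- move=> i lti y yZ.
  have [ei|ni] := eqVneq i n.
    move: y yZ; rewrite ei => y /coc_split[c [b [cC bB ->]]].
    pose w : W := (0, vsproj C c).
    have tw0 : t (free_unit A W w) = 0 by rewrite tE ltE.
    have sw : s (free_unit A W w) = c.
      by rewrite sE lsE /= vsprojK // !linear0 add0r.
    exists (0, stalk_in n F n (free_unit A W w)).
      rewrite (@cocP _ _ (cell tm dt) n (n + 1)) // cell_dE /= stalk_inK // tw0.
      by rewrite !linear0 addr0.
    by rewrite cell_mapE /= stalk_inK // sw idfam_id linear0 add0r addrAC subrr add0r.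
  have lti' : (n < i)%R by lia.
  have [x xZ xy] := qS _ lti' _ yZ; exists (x, 0); last first.
    by rewrite cell_mapE /= !linear0 addr0.
  rewrite (@cocP _ _ (cell tm dt) i (i + 1)) // cell_dE /= !linear0 addr0.
  by move: xZ; rewrite (@cocP _ _ _ i (i + 1)) // => /eqP ->.
- move=> i lti [x y]; rewrite (@stalk_zero _ _ n F i y); last by lia.
  rewrite (@cocP _ _ (cell tm dt) i (i + 1)) // cell_dE cell_mapE /= !linear0 !addr0.
  move=> /eqP[dx] qx.
  have xZ : x \in cocycles Q i by rewrite (@cocP _ _ _ i (i + 1)) // dx.
  have [ei|ni] := eqVneq i (n + 1).
    move: x {dx} qx xZ; rewrite ei => x qx xZ.
    have xB : x \in B by rewrite memv_cap xZ -memv_preim.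
    pose w : W := (vsproj B x, 0).
    apply/(@cobP _ _ (cell tm dt) n (n + 1)); first by rewrite addrK.
    exists (0, stalk_in n F n (free_unit A W w)).
    by rewrite cell_dE /= stalk_inK // tE ltE /= vsprojK // linear0 add0r idfam_id.
  have lti' : (n + 1 < i)%R by lia.
  have /(@cobP _ _ Q (i - 1) i _ erefl)[z ->] := qI _ lti' _ xZ qx.
  apply/(@cobP _ _ (cell tm dt) (i - 1) i) => //; exists (z, 0).
  by rewrite cell_dE /= !linear0 addr0.
- rewrite (@tdimD _ _ (cell tm dt) Q (stalk n F)) // leq_add2l.
  apply: leq_trans (tdim_stalk _ _) _; rewrite free_dim leq_mul2r; apply/orP; right.
  rewrite -[dim W]/(\dim B + \dim C)%N leq_add //; last by rewrite hdim_diff.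
  apply: leq_trans (dimvS (subvf _)) _; rewrite dimvf; exact: dim_le_tdim.
Qed.

Lemma top_degree Q : ~ acyclic Q ->
  exists m, hdim Q m != 0%N /\ forall i, (m < i)%R -> Hzero Q i.
Proof.
move=> nA.
have [i0 hi0] : exists i, ~ Hzero Q i by apply: contrapT => H; apply: nA => i; apply: contrapT => Hi; apply: H; exists i.
have exP : exists a, `[< ~ Hzero Q ((cbound Q)%:Z - a%:Z) >].
  exists (absz ((cbound Q)%:Z - i0)); apply/asboolP => H; apply: (hi0).
  have le : (`|i0| <= cbound Q)%N by rewrite leqNgt; apply/negP => /Hzero_out /hi0.
  move: H; rewrite (_ : (cbound Q)%:Z - _ = i0) //; lia.
have [a /asboolP ha mina] := ex_minnP exP.
exists ((cbound Q)%:Z - a%:Z); split; first by apply/eqP => /hdim_eq0.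
move=> i lti; apply: contrapT => Hi.
have le : (`|i| <= cbound Q)%N by rewrite leqNgt; apply/negP => /Hzero_out /Hi.
have /mina : `[< ~ Hzero Q ((cbound Q)%:Z - (absz ((cbound Q)%:Z - i))%:Z) >].
  apply/asboolP; rewrite (_ : (cbound Q)%:Z - _ = i) //; lia.
by lia.
Qed.

Section Bounded.
Variable N : nat.
Hypothesis HN : forall X : complex A, db_indecomposable X -> (hr X <= N)%N.

(** Cohomology degrees of a non-acyclic indecomposable summand differ by less than [N], so with
    cohomology at or below [b] it cannot reach beyond the gap of length [N] above [b]. Such a
    summand has no cohomology above [b] at all and is replaced by 0; the others are kept. *)
Lemma gap_split Q (b : int) : projc Q ->
  (forall i, (b < i)%R -> (i <= b + N%:Z)%R -> Hzero Q i) ->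
  exists Q' (f : cmap Q' Q), [/\ projc Q', forall i, (dim (Q' i) <= dim (Q i))%N,
    forall i, (i <= b)%R -> Hzero Q' i &
    forall i, (b < i)%R -> Hinj f i /\ Hsurj f i].
Proof.
move: Q; apply: cdec_ind => [Q Qp Qi Q0|X Y Z i1 r1 i2 r2 S Xp Yp Zp IY IZ X0].
  have [lo|/existsNP[i /not_implyP[lei Hi]]] :=
      pselect (forall i, (i <= b)%R -> Hzero Q i).
    exists Q, (cmap_id Q); split=> // i _; exact: quasi_iso_id.
  have nA : ~ acyclic Q by move=> H; apply: Hi; exact: H.
  have [_ wd] := hr_bounds (HN (cind_db_indec Qp Qi nA)) nA.
  have hi j : (b < j)%R -> Hzero Q j.
    move=> ltj; apply: contrapT => Hj.
    have hij : (`|j - i| < N)%N by apply: wd; apply/eqP => /hdim_eq0.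
    by apply: Hj; apply: Q0 => //; lia.
  exists (complex0 A), (cmap0 _ _); split=> //.
  - by move=> j; apply: projective0 => v; rewrite [LHS]thinmx0 [RHS]thinmx0.
  - by move=> j _; exact: acyclic0.
  - move=> j /hi Hj; split=> [x xZ _|y /Hj yB]; first exact: acyclic0.
    by exists 0; rewrite ?mem0v // linear0 subr0.
have [ri1 ri2 ir] := S.
have [Y' [f [Y'p df Y'0 fq]]] : exists Q' (f : cmap Q' Y), [/\ projc Q',
    forall i, (dim (Q' i) <= dim (Y i))%N, forall i, (i <= b)%R -> Hzero Q' i &
    forall i, (b < i)%R -> Hinj f i /\ Hsurj f i].
  apply: IY => i bi ib y yZ; rewrite -(ri1 i y); apply: cmap_cob.
  by apply: X0 => //; exact: cmap_coc.
have [Z' [g [Z'p dg Z'0 gq]]] : exists Q' (f : cmap Q' Z), [/\ projc Q',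
    forall i, (dim (Q' i) <= dim (Z i))%N, forall i, (i <= b)%R -> Hzero Q' i &
    forall i, (b < i)%R -> Hinj f i /\ Hsurj f i].
  apply: IZ => i bi ib y yZ; rewrite -(ri2 i y); apply: cmap_cob.
  by apply: X0 => //; exact: cmap_coc.
have [r12 r21] := splits0 S.
pose F := csum_out (cmap_comp i1 f) (cmap_comp i2 g).
have FE i p : F i p = i1 i (f i p.1) + i2 i (g i p.2).
  by rewrite csum_outE !comp_lfunE.
exists (complex_sum Y' Z'), F; split.
- by move=> i; apply: projective_sum.
- by move=> i; rewrite (splits_dim i S); exact: leq_add.
- move=> i lei p; rewrite csum_coc csum_cob => /andP[p1 p2].
  by rewrite Y'0 ?Z'0.
- move=> i lti; have [fI fS] := fq i lti; have [gI gS] := gq i lti; split.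
    move=> p; rewrite csum_coc csum_cob => /andP[p1 p2] Fp.
    have := cmap_cob r1 Fp; have := cmap_cob r2 Fp.
    rewrite FE !linearD /= ri1 ri2 r12 r21 addr0 add0r => g2 f1.
    by rewrite fI ?gI.
  move=> x xZ; have [y yZ yx] := fS _ (cmap_coc r1 xZ); have [z zZ zx] := gS _ (cmap_coc r2 xZ).
  exists (y, z); first by rewrite csum_coc yZ zZ.
  rewrite FE -[x in x - _](ir i) /= opprD addrACA -!linearB /= memvD //; exact: cmap_cob.
Qed.

Fixpoint cell_bound h t : nat :=
  if t is t'.+1 then (cell_bound h t' + (cell_bound h t' + h) * dim A)%N else 0%N.

Lemma cells Y (m : int) h t : (forall i, (m < i)%R -> Hzero Y i) ->
  (forall i, hdim Y i <= h)%N ->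
  exists Q (q : cmap Q Y), [/\ projc Q,
    forall i, (i <= m - t%:Z)%R -> forall x : Q i, x = 0,
    forall i, (m - t%:Z < i)%R -> Hsurj q i,
    forall i, (m - t%:Z + 1 < i)%R -> Hinj q i &
    (tdim Q <= cell_bound h t)%N].
Proof.
move=> Y0 hY; elim: t => [|t [Q [q [Qp Q0 qS qI dQ]]]].
  exists (complex0 A), (cmap0 _ _); split.
  - by move=> j; apply: projective0 => v; rewrite [LHS]thinmx0 [RHS]thinmx0.
  - by move=> i _ x; rewrite [LHS]thinmx0 [RHS]thinmx0.
  - move=> i lti y yZ; exists 0; rewrite ?mem0v // linear0 subr0; apply: Y0 => //; lia.
  - by move=> i _ x xZ _; exact: acyclic0.
  - by rewrite leqn0 /tdim big1 // => i _; apply: dim0 => v; rewrite [LHS]thinmx0 [RHS]thinmx0.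
have [Q' [q' [Q'p Q'0 q'S q'I dQ']]] := add_cell Qp Q0 qS qI (hY _).
exists Q', q'; split=> //.
- by move=> i lei; apply: Q'0; lia.
- by move=> i lti; apply: q'S; lia.
- by move=> i lti; apply: q'I; lia.
- apply: leq_trans dQ' _; rewrite /= leq_add // leq_mul2r; apply/orP; right.
  by rewrite leq_add2r.
Qed.

(** The gap is the interval above [m - w - N] up to [m - w], where [Y] has no cohomology. The
    constant depends on [w] and [h] only, neither on [Y] nor on its position. *)
Lemma projective_model w h : exists K, forall Y (m : int),
  (forall i, (m < i)%R -> Hzero Y i) -> (forall i, (i <= m - w%:Z)%R -> Hzero Y i) ->
  (forall i, hdim Y i <= h)%N ->
  exists Q (q : cmap Q Y), [/\ projc Q, (tdim Q <= K)%N & quasi_iso q].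
Proof.
(* The extra cell makes up for injectivity lagging one degree behind surjectivity: it now holds
   everywhere above [m - w - N]. *)
exists (cell_bound h (w + N).+1) => Y m Yhi Ylo hY.
have [Q [q [Qp Q0 qS qI dQ]]] := cells (w + N).+1 Yhi hY.
pose b : int := m - w%:Z - N%:Z.
have [|Q' [f [Q'p df Q'0 fq]]] := @gap_split Q b Qp.
  move=> i lti lei x xZ; apply: (qI i _ x xZ); first by rewrite /b in lti; lia.
  by apply: Ylo; [rewrite /b in lei; lia | exact: cmap_coc].
exists Q', (cmap_comp q f); split=> //; first by apply: leq_trans dQ; exact: tdim_le.
move=> i; case: (boolP (i <= b)%R) => lei.
  have HY : Hzero Y i by apply: Ylo; rewrite /b in lei; lia.
  split=> [x xZ _|y /HY yB]; first exact: Q'0.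
  by exists 0; rewrite ?mem0v // linear0 subr0.
have [fI fS] : Hinj f i /\ Hsurj f i by apply: fq; lia.
split.
  by apply: Hinj_comp fI _; apply: qI; move: lei; rewrite /b; lia.
by apply: Hsurj_comp fS _; apply: qS; move: lei; rewrite /b; lia.
Qed.

Lemma projective_model_ex Y : exists Q (q : cmap Q Y), projc Q /\ quasi_iso q.
Proof.
have [h hY] : exists h, forall i, (hdim Y i <= h)%N by exists (hl Y) => i; exact: hdim_le_hl.
have [K HK] := projective_model (cbound Y).*2.+1 h.
have [|||Q [q [Qp _ qq]]] := HK Y (cbound Y)%:Z.
- by move=> i lti; apply: Hzero_out; lia.
- by move=> i lti; apply: Hzero_out; move: lti; rewrite -addnn; lia.
- by move=> i; exact: hY.
- by exists Q, q.
Qed.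

(** The small model [p] of [Q] has a section [s] up to homotopy. The composite [p \o s] is the
    identity on cohomology, so it is not nilpotent, and [fitting] makes it a strict isomorphism.
    Thus [s] is injective and [Q] is no larger than its model. *)
Lemma cind_tdim_bound : exists M, forall Q, projc Q -> cind Q -> ~ acyclic Q ->
  (tdim Q <= M)%N.
Proof.
have [K HK] := projective_model N N; exists K => Q Qp Qi nA.
have [hN wd] := hr_bounds (HN (cind_db_indec Qp Qi nA)) nA.
have [m hm] := top_degree nA.
have [||//|Q1 [p [Q1p dQ1 pq]]] := HK Q m; first exact: (proj2 hm).
  move=> i lei; apply: contrapT => Hi.
  have := wd m i (proj1 hm) _; rewrite (_ : hdim Q i != 0%N); last by apply/eqP => /hdim_eq0.
  by move=> /(_ erefl); lia.
have [s Hs] := qis_lift (cmap_id Q) Qp pq.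
pose e := cmap_comp p s.
have [[l el]|ei] := fitting e Qi.
  case: nA => i x xZ; suff : x - iter l (e i) x \in coboundaries Q i by rewrite el subr0.
  have eB z : z \in cocycles Q i -> z - e i z \in coboundaries Q i.
    by move=> zZ; have := nullh_coc Hs zZ; rewrite -memvN !lfE opprB.
  elim: (l) => [|n IHn]; first by rewrite subrr mem0v.
  have nZ : iter n (e i) x \in cocycles Q i by rewrite -cpowE cmap_coc.
  rewrite iterS; move: (iter n _ x) (eB _ nZ) IHn => z zB xz.
  by rewrite -[x](subrK z) -addrA memvD.
apply: leq_trans dQ1; apply: tdim_le => i; rewrite -!dimvf.
rewrite -(@limg_dim_eq _ _ _ (s i) fullv); first exact/dimvS/subvf.
apply/eqP; rewrite -subv0; apply/subvP => x; rewrite capfv memv_ker => /eqP sx.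
by rewrite -(proj1 (ei i)) memv_ker /e /= comp_lfunE sx linear0.
Qed.

End Bounded.
End ProjectiveModel.

(** * The Harada-Sai lemma *)

Section HaradaSai.
Variables (k : fieldType) (A : falgType k).
Implicit Types (X Y Z W : complex A).

(** The first equality makes [g] injective on the image of [f]; the second then makes the dimensions
    of this image and of the kernel of [g] add up to that of [V]. *)
Lemma img_ker_compl (U V W : vectType k) (f : 'Hom(U, V)) (g : 'Hom(V, W)) :
  \dim (limg (g \o f)%VF) = \dim (limg f) -> \dim (limg (g \o f)%VF) = \dim (limg g) ->
  (limg f :&: lker g = 0)%VS /\ (limg f + lker g = fullv)%VS.
Proof.
rewrite limg_comp => e1 e2.
have cap0 : (limg f :&: lker g = 0)%VS.
  by apply/eqP; rewrite -dimv_eq0; have := limg_ker_dim g (limg f); lia.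
split=> //; apply/eqP; rewrite eqEdim subvf dimv_disjoint_sum //=.
by have := limg_ker_dim g fullv; rewrite capfv -e2 e1; lia.
Qed.

Lemma dim_limg_comp (U V W : vectType k) (f : 'Hom(U, V)) (g : 'Hom(V, W)) :
  (\dim (limg (g \o f)%VF) <= \dim (limg f))%N /\ (\dim (limg (g \o f)%VF) <= \dim (limg g))%N.
Proof.
rewrite limg_comp; split; last exact/dimvS/limgS/subvf.
by have := limg_ker_dim g (limg f); lia.
Qed.

Variable M : nat.

Definition small X := cind X /\ (tdim X <= M)%N.

(* The arbitrary last map makes length [0] meaningful without asking that [X = Z]. *)
Fixpoint radpath n X Z (p : cmap X Z) : Prop :=
  if n is m.+1 then exists Y (q : cmap X Y) (p' : cmap Y Z),
    [/\ small X, ~ ciso q, radpath m p' & forall i x, p i x = p' i (q i x)]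
  else small X /\ small Z.

Lemma radpath_small n X Z (p : cmap X Z) : radpath n p -> small X /\ small Z.
Proof.
elim: n X p => [//|n IHn] X p /= [Y [q [p' [Xs _ pp _]]]].
by split=> //; case: (IHn _ _ pp).
Qed.

Lemma radpath_split a b X Z (p : cmap X Z) : radpath (a + b.+1) p ->
  exists Y W (f : cmap X Y) (h : cmap Y W) (g : cmap W Z),
    [/\ radpath a f, ~ ciso h, radpath b g & forall i x, p i x = g i (h i (f i x))].
Proof.
elim: a X p => [|a IHa] X p /= [Y [q [p' [Xs nq pp pE]]]].
  exists X, Y, (cmap_id X), q, p'; split=> // i x.
  by rewrite pE id_lfunE.
have [Y' [W [f [h [g [fp nh gp p'E]]]]]] := IHa _ _ pp.
exists Y', W, (cmap_comp f q), h, g; split=> //.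
  by exists Y, q, f; split=> // i x; rewrite /= lfE.
by move=> i x; rewrite pE p'E /= lfE.
Qed.

(** Cut the path as [g \o h \o f] with [f] and [g] of length [2 ^ m - 1]. If the total rank failed
    to drop below [M - m], then [f], [g] and the whole path would have equal ranks in every degree,
    so [im f] and [ker (g \o h)] would be complementary, as would [im (h \o f)] and [ker g]. By
    indecomposability [h] would be an isomorphism. The list [s0] may be enlarged so that all three
    maps are measured on the same degrees. *)
Lemma harada_sai m X Z (p : cmap X Z) : radpath (2 ^ m - 1) p ->
  exists s0 : seq int, forall s, uniq s -> {subset s0 <= s} ->
    (\sum_(i <- s) \dim (limg (p i)) <= M - m)%N.
Proof.
elim: m X Z p => [|m IHm] X Z p.
  move=> /= [_ [_ Zs]]; exists (win Z) => s su sZ.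
  rewrite subn0; apply: leq_trans Zs; rewrite -(tdim_seq su sZ).
  by apply: leq_sum => i _; rewrite -dimvf; exact/dimvS/subvf.
have -> : (2 ^ m.+1 - 1 = (2 ^ m - 1) + (2 ^ m - 1).+1)%N.
  by rewrite expnS; have := expn_gt0 2 m; lia.
case/radpath_split=> [Y [W [f [h [g [fp nh gp pE]]]]]].
have [sf Hf] := IHm _ _ _ fp; have [sg Hg] := IHm _ _ _ gp.
exists (sf ++ sg ++ win Y ++ win W) => s su sub; rewrite leqNgt; apply/negP => lt.
have [_ [Yi _]] := radpath_small fp; have [[Wi _] _] := radpath_small gp.
have {}Hf : (\sum_(i <- s) \dim (limg (f i)) <= M - m)%N.
  by apply: Hf => // i Hi; apply: sub; rewrite mem_cat Hi.
have {}Hg : (\sum_(i <- s) \dim (limg (g i)) <= M - m)%N.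
  by apply: Hg => // i Hi; apply: sub; rewrite !mem_cat Hi orbT.
have subY i : i \notin s -> forall v : Y i, v = 0.
  by move=> Hi v; apply: win_out; apply: contra Hi => H; apply: sub; rewrite !mem_cat H !orbT.
have subW i : i \notin s -> forall v : W i, v = 0.
  by move=> Hi v; apply: win_out; apply: contra Hi => H; apply: sub; rewrite !mem_cat H !orbT.
have pE1 i : p i = ((g i \o h i) \o f i)%VF by apply/lfunP => x; rewrite pE !lfE.
have pE2 i : p i = (g i \o (h i \o f i))%VF by rewrite pE1 comp_lfunA.
have lef i : (\dim (limg (p i)) <= \dim (limg (f i)))%N.
  by rewrite pE1; exact: proj1 (dim_limg_comp _ _).
have leg i : (\dim (limg (p i)) <= \dim (limg (g i)))%N.
  by rewrite pE2; exact: proj2 (dim_limg_comp _ _).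
have sump : (M - m <= \sum_(i <- s) \dim (limg (p i)))%N by lia.
have ef i : \dim (limg (p i)) = \dim (limg (f i)).
  apply/eqP; rewrite eqn_leq lef /=; have [si|si] := boolP (i \in s).
    by apply: (sum_leq_eq si su lef); exact: leq_trans Hf sump.
  by apply: leq_trans (dimvS (subvf _)) _; rewrite dimvf dim0 //; exact: subY.
have eg i : \dim (limg (p i)) = \dim (limg (g i)).
  apply/eqP; rewrite eqn_leq leg /=; have [si|si] := boolP (i \in s).
    by apply: (sum_leq_eq si su leg); exact: leq_trans Hg sump.
  suff -> : limg (g i) = 0%VS by rewrite dimv0.
  apply/eqP; rewrite -subv0; apply/subvP => _ /memv_imgP[w _ ->].
  by rewrite (subW _ si w) linear0 mem0v.
have egh i : \dim (limg (p i)) = \dim (limg (g i \o h i)%VF).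
  apply/eqP; rewrite eqn_leq {1}pE1 (proj2 (dim_limg_comp _ _)) eg.
  exact: proj2 (dim_limg_comp _ _).
have ehf i : \dim (limg (p i)) = \dim (limg (h i \o f i)%VF).
  apply/eqP; rewrite eqn_leq {1}pE2 (proj1 (dim_limg_comp _ _)) ef.
  exact: proj1 (dim_limg_comp _ _).
have CY i : (limg (f i) :&: lker (g i \o h i)%VF = 0)%VS /\
    (limg (f i) + lker (g i \o h i)%VF = fullv)%VS.
  by apply: img_ker_compl; rewrite -pE1 ?ef // -egh ef.
have CW i : (limg (h i \o f i)%VF :&: lker (g i) = 0)%VS /\
    (limg (h i \o f i)%VF + lker (g i) = fullv)%VS.
  by apply: img_ker_compl; rewrite -pE2 ?ehf // -ehf eg.
have not0 : ~ forall i, \dim (limg (p i)) = 0%N.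
  by move=> H; move: lt; rewrite big1.
have hinj i : lker (h i) = 0%VS.
  have := @cind_compl _ _ Y (fun i => limg (f i)) (fun i => lker (g i \o h i)%VF) Yi.
  case.
  - by move=> j a _ /memv_imgP[x _ ->]; rewrite -cfun_ract memv_img ?memvf.
  - by move=> j a x; rewrite !memv_ker !comp_lfunE !cfun_ract => /eqP ->; rewrite linear0.
  - by move=> j l _ /memv_imgP[x _ ->]; rewrite -cmapE memv_img ?memvf.
  - by move=> j l x; rewrite !memv_ker !comp_lfunE !cmapE => /eqP ->; rewrite linear0.
  - by move=> j; case: (CY j).
  - by move=> j; case: (CY j).
  - by move=> H; case: not0 => j; rewrite ef H dimv0.
  - move=> H; apply/eqP; rewrite -subv0 -(H i); apply/subvP => x.
    by rewrite !memv_ker comp_lfunE => /eqP ->; rewrite linear0.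
have hsurj i : limg (h i) = fullv.
  have := @cind_compl _ _ W (fun i => limg (h i \o f i)%VF) (fun i => lker (g i)) Wi.
  case.
  - move=> j a _ /memv_imgP[x _ ->].
    by rewrite comp_lfunE -!cfun_ract -comp_lfunE memv_img ?memvf.
  - by move=> j a x; rewrite !memv_ker !cfun_ract => /eqP ->; rewrite linear0.
  - move=> j l _ /memv_imgP[x _ ->].
    by rewrite comp_lfunE -!cmapE -comp_lfunE memv_img ?memvf.
  - by move=> j l x; rewrite !memv_ker !cmapE => /eqP ->; rewrite linear0.
  - by move=> j; case: (CW j).
  - by move=> j; case: (CW j).
  - by move=> H; case: not0 => j; rewrite ehf H dimv0.
  - move=> H; apply/eqP; rewrite eqEsubv subvf -(proj2 (CW i)) H addv0 limg_comp.
    exact/limgS/subvf.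
by apply: nh => i; split.
Qed.

End HaradaSai.

(** * Serre duality *)

Section Flatten.
Variables (k : fieldType) (A : falgType k).
Implicit Types (X Y Z W : complex A).

(** [T] is the direct sum of the [X i] over [s]. Putting a graded object into a single space makes
    the lemmas on subspaces and functionals available for graded maps. *)
Definition flat_spec X (s : seq int) (T : vectType k)
    (inn : forall i, 'Hom(X i, T)) (pr : forall i, 'Hom(T, X i)) :=
  [/\ forall i x, i \in s -> pr i (inn i x) = x,
      forall i j x, i != j -> pr j (inn i x) = 0 &
      forall i, i \notin s -> inn i = 0 /\ pr i = 0].

Lemma flatten_ex X s : uniq s -> exists (T : vectType k) inn pr, @flat_spec X s T inn pr.
Proof.
elim: s => [_|j s IHs /= /andP[js /IHs[T [inn [pr [H1 H2 H3]]]]]].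
  exists 'rV[k]_0, (fun=> 0), (fun=> 0); split=> // i l x _.
  by rewrite zero_lfunE.
exists (X j * T)%type,
  (fun i => (linl _ _ \o idfam X i j)%VF + (linr _ _ \o inn i)%VF),
  (fun i => (idfam X j i \o lfst _ _)%VF + (pr i \o lsnd _ _)%VF).
have E i i' x : ((idfam X j i' \o lfst _ _)%VF + (pr i' \o lsnd _ _)%VF)
    (((linl _ _ \o idfam X i j)%VF + (linr _ _ \o inn i)%VF) x) =
    idfam X j i' (idfam X i j x) + pr i' (inn i x).
  by rewrite !lfE !linlE !linrE lfstE lsndE /= addr0 add0r.
split=> [i x|i i' x ii'|i].
- rewrite E inE => /orP[/eqP e|si].
    rewrite idfamK //; have [|-> _] := H3 i; first by rewrite e.
    by rewrite zero_lfunE linear0 addr0.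
  have ji : i != j by apply: contraNneq js => <-.
  by rewrite (idfam_neq _ ji) zero_lfunE linear0 add0r H1.
- rewrite E H2 // addr0; have [e|ij] := eqVneq i j.
    by rewrite (@idfam_neq _ _ X j i') ?zero_lfunE // -e.
  by rewrite (idfam_neq _ ij) zero_lfunE linear0.
- rewrite inE negb_or => /andP[ij si]; have [-> ->] := H3 i si.
  have ji : j != i by rewrite eq_sym.
  rewrite (idfam_neq _ ij) (idfam_neq _ ji).
  by rewrite !comp_lfun0r !comp_lfun0l !addr0.
Qed.

Definition clin X Y (c : k) (f g : cmap X Y) : cmap X Y.
Proof.
refine (@mkcmap k A X Y (fun i => c *: f i + g i) _ _).
- by move=> i; apply: is_rmorphD; [apply: rmorphZ|]; exact: cfun_rmorph.
- by move=> i x; rewrite !lfE linearD linearZ /= !cmapE.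
Defined.

Lemma clinE X Y c (f g : cmap X Y) i x : clin c f g i x = c *: f i x + g i x.
Proof. by rewrite /= !lfE. Qed.

Lemma lfun_out X Y i (f : 'Hom(X i, Y i)) : i \notin win X -> f = 0.
Proof. by move=> Hi; apply/lfunP => x; rewrite (win_out x Hi) !linear0. Qed.

Definition sandwich (U V U' V' : vectType k) (a : 'Hom(U', U)) (b : 'Hom(V, V')) :
  'Hom('Hom(U, V), 'Hom(U', V')) := linfun (fun h => (b \o (h \o a))%VF).

Lemma sandwichE (U V U' V' : vectType k) (a : 'Hom(U', U)) (b : 'Hom(V, V')) h :
  sandwich a b h = (b \o (h \o a))%VF.
Proof.
rewrite linfun_linE // => c x y.
by rewrite comp_lfunDl comp_lfunDr -comp_lfunZl -comp_lfunZr.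
Qed.

(** By [cind_local] the non-isomorphisms are closed under linear combinations, and 0 is one of them
    because [Y] is not acyclic; so a functional separates them from the identity. It is given on all
    pairs of degrees, zero off the diagonal, because it will be used in degrees that are only
    provably equal. *)
Lemma radical_functional Y : cind Y -> ~ acyclic Y ->
  exists F : forall i j, 'Hom('Hom(Y i, Y j), k^o),
    (forall i j, i != j -> F i j = 0) /\
    forall s, uniq s -> {subset win Y <= s} ->
      (forall e : cmap Y Y, ~ ciso e -> \sum_(i <- s) F i i (e i) = 0) /\
      \sum_(i <- s) F i i \1%VF = 1.
Proof.
move=> Yi nA; have [T [inn [pr [H1 H2 H3]]]] := flatten_ex Y (win_uniq Y).
pose emb (e : forall i, 'Hom(Y i, Y i)) : 'End(T) :=
  \sum_(i <- win Y) sandwich (pr i) (inn i) (e i).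
have prE e i x : i \in win Y -> pr i (emb e (inn i x)) = e i x.
  move=> iY; rewrite /emb sum_lfunE (bigD1_seq i) ?win_uniq //= big1 => [|j ji].
    by rewrite addr0 sandwichE !comp_lfunE !H1.
  by rewrite sandwichE !comp_lfunE H2 ?linear0 // eq_sym.
pose P (u : 'End(T)) := exists2 e : cmap Y Y, ~ ciso e & u = emb e.
have scale_ciso c (e f : cmap Y Y) : (forall i x, f i x = c *: e i x) -> ciso f -> ciso e.
  move=> fE fi i; have [f0 f1] := fi i; split.
    apply/eqP; rewrite -subv0 -f0; apply/subvP => x; rewrite !memv_ker fE => /eqP ->.
    by rewrite scaler0.
  apply/eqP; rewrite eqEsubv subvf /= -{1}f1; apply/subvP => _ /memv_imgP[x _ ->].
  by rewrite fE -linearZ memv_img ?memvf.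
have [|c x y [e ne ->] [f nf ->]|R RP] := @vspace_of k 'End(T) P.
- exists (cmap0 Y Y); last by rewrite /emb big1 // => i _; rewrite linear0.
  move=> H; apply: nA => i x _; suff -> : x = 0 by exact: mem0v.
  apply/eqP; rewrite -memv0 -(proj1 (H i)) memv_ker /=.
  by rewrite zero_lfunE.
- exists (clin c e f); last first.
    rewrite /emb scaler_sumr -big_split; apply: eq_bigr => i _ /=.
    by rewrite linearP.
  move=> H; pose ce := clin c e (cmap0 Y Y).
  have ceE i z : ce i z = c *: e i z by rewrite clinE /= zero_lfunE addr0.
  have [||Hce|//] := @cind_local _ _ _ ce f (clin c e f) Yi.
  + by move=> i z; rewrite clinE ceE.
  + exact: H.
  + by apply: ne; exact: scale_ciso Hce.
have vR : emb (fun i => \1%VF) \notin R.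
  apply/negP => /RP[e ne eE]; apply: ne; apply: cisoP => i; exists id => x /=.
    have [iY|iY] := boolP (i \in win Y); last by rewrite (win_out x iY) linear0.
    by rewrite -prE // -eE prE // id_lfunE.
  have [iY|iY] := boolP (i \in win Y); last by rewrite (win_out x iY) linear0.
  by rewrite -prE // -eE prE // id_lfunE.
have [f [fR f1]] := functional_sep vR.
exists (fun i j => if i == j then (f \o sandwich (pr i) (inn j))%VF else 0).
split=> [i j /negPf -> //|s su sub].
have FE (e : forall i, 'Hom(Y i, Y i)) : \sum_(i <- s) (if i == i then
    (f \o sandwich (pr i) (inn i))%VF else 0) (e i) = f (emb e).
  rewrite (big_win _ su sub) => [|i Hi]; last by rewrite (lfun_out (e i) Hi) linear0.
  by rewrite /emb linear_sum; apply: eq_bigr => i _; rewrite eqxx comp_lfunE.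
split=> [e ne|]; last by rewrite FE.
by rewrite FE; apply: fR; apply/RP; exists e.
Qed.

(* Cohomology commutes with k-duality on the total complex of graded maps from [X] to [Y]:
   a degree [0] functional that kills all chain maps is a coboundary. *)
Lemma functional_homotopy X Y (F : forall i, 'Hom('Hom(X i, Y i), k^o)) :
  (forall s, uniq s -> {subset win X <= s} -> forall u : cmap X Y, \sum_(i <- s) F i (u i) = 0) ->
  exists G : forall i j, 'Hom('Hom(X i, Y j), k^o),
    forall i p n (v : 'Hom(X i, Y i)), is_rmorph v -> p = i - 1 -> n = i + 1 ->
      F i v = G i n (cdiff Y i n \o v)%VF - G p i (v \o cdiff X p i)%VF.
Proof.
move=> HF; set s := undup (win X ++ win Y); have su : uniq s := undup_uniq _.
have sX : {subset win X <= s} by move=> i iX; rewrite mem_undup mem_cat iX.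
have sY : {subset win Y <= s} by move=> i iY; rewrite mem_undup mem_cat iY orbT.
have [T [inX [prX [X1 X2 X3]]]] := flatten_ex X su.
have [T' [inY [prY [Y1 Y2 Y3]]]] := flatten_ex Y su.
have X0 i : i \notin s -> forall x : X i, x = 0.
  by move=> Hi x; apply: win_out; apply: contra Hi; exact: sX.
have Y0 i : i \notin s -> forall x : Y i, x = 0.
  by move=> Hi x; apply: win_out; apply: contra Hi; exact: sY.
pose emb (u : forall i, 'Hom(X i, Y i)) : 'Hom(T, T') :=
  \sum_(i <- s) sandwich (prX i) (inY i) (u i).
have embE u i x : i \in s -> emb u (inX i x) = inY i (u i x).
  move=> si; rewrite /emb sum_lfunE (bigD1_seq i) //= big1 => [|j ji].
    by rewrite addr0 sandwichE !comp_lfunE X1.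
  by rewrite sandwichE !comp_lfunE X2 ?linear0 // eq_sym.
pose P (U : 'Hom(T, T')) := exists2 u : forall i, 'Hom(X i, Y i),
  (forall i, is_rmorph (u i)) & U = emb u.
have [|c x y [u um ->] [v vm ->]|V0 V0P] := @vspace_of k _ P.
- exists (fun=> 0); first by move=> i; exact: Defs.rmorph0.
  by rewrite /emb big1 // => i _; rewrite linear0.
- exists (fun i => c *: u i + v i).
    by move=> i; apply: is_rmorphD => //; apply: rmorphZ.
  rewrite /emb scaler_sumr -big_split; apply: eq_bigr => i _ /=.
  by rewrite linearP.
pose dX : 'End(T) := \sum_(i <- s) (inX (i + 1)%R \o (cdiff X i (i + 1) \o prX i))%VF.
pose dY : 'End(T') := \sum_(i <- s) (inY (i + 1)%R \o (cdiff Y i (i + 1) \o prY i))%VF.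
have dXE i n x : i \in s -> n = i + 1 -> dX (inX i x) = inX n (cdiff X i n x).
  move=> si ->; rewrite /dX sum_lfunE (bigD1_seq i) //= big1 => [|j ji].
    by rewrite addr0 !comp_lfunE X1.
  by rewrite !comp_lfunE X2 ?linear0 // eq_sym.
have dYE i n x : i \in s -> n = i + 1 -> dY (inY i x) = inY n (cdiff Y i n x).
  move=> si ->; rewrite /dY sum_lfunE (bigD1_seq i) //= big1 => [|j ji].
    by rewrite addr0 !comp_lfunE Y1.
  by rewrite !comp_lfunE Y2 ?linear0 // eq_sym.
have prdX i p z : i \in s -> p = i - 1 -> prX i (dX z) = cdiff X p i (prX p z).
  move=> si ep; have epi : p + 1 = i by rewrite ep subrK.
  rewrite /dX sum_lfunE linear_sum /=; have [sp|sp] := boolP (p \in s).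
    rewrite (bigD1_seq p) //= big1 => [|j jp].
      by rewrite addr0 !comp_lfunE epi X1.
    by rewrite !comp_lfunE X2 // -epi (inj_eq (addIr 1)).
  have [_ ->] := X3 p sp; rewrite zero_lfunE linear0 big_seq big1 // => j js.
  rewrite !comp_lfunE X2 // -epi (inj_eq (addIr 1)).
  by apply: contraNneq sp => <-.
(* The commutator with the total differentials: on the graded module maps [V0] its kernel consists
   of the chain maps. As [f] kills these it factors through [D], and the components of the factor
   are [G]. *)
pose D : 'Hom('Hom(T, T'), 'Hom(T, T')) := sandwich \1%VF dY - sandwich dX \1%VF.
have DE U z : D U z = dY (U z) - U (dX z).
  by rewrite /D !lfE !sandwichE !comp_lfunE !id_lfunE.
pose f : 'Hom('Hom(T, T'), k^o) := \sum_(i <- s) (F i \o sandwich (inX i) (prY i))%VF.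
have fE u : f (emb u) = \sum_(i <- s) F i (u i).
  rewrite /f sum_lfunE big_seq [RHS]big_seq; apply: eq_bigr => i si.
  rewrite comp_lfunE sandwichE; congr (F i _); apply/lfunP => x.
  by rewrite !comp_lfunE embE // Y1.
have [|g gE] := @functional_factor _ _ _ V0 D f.
  move=> _ /V0P[u um ->] Du; rewrite fE.
  suff ud i x : u (i + 1) (cdiff X i (i + 1) x) = cdiff Y i (i + 1) (u i x).
    exact: (HF s su sX (mkcmap um ud)).
  have [sn|sn] := boolP (i + 1 \in s); last by rewrite (Y0 _ sn (u _ _)) (Y0 _ sn (cdiff _ _ _ _)).
  have [si|si] := boolP (i \in s); last by rewrite (X0 _ si x) !linear0.
  have := DE (emb u) (inX i x); rewrite Du zero_lfunE => /esym/eqP.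
  rewrite subr_eq0 embE // (@dXE i (i + 1)) // (@dYE i (i + 1)) // embE // => /eqP.
  by move/(congr1 (prY (i + 1))); rewrite !Y1.
exists (fun i j => (g \o sandwich (prX i) (inY j))%VF) => i p n v vm ep en.
rewrite !comp_lfunE.
have [si|si] := boolP (i \in s); last first.
  have -> : v = 0 by apply/lfunP => x; rewrite (X0 _ si x) !linear0.
  by rewrite comp_lfun0l comp_lfun0r !linear0 ?subrr ?addr0.
pose u j : 'Hom(X j, Y j) := (idfam Y i j \o (v \o idfam X j i))%VF.
have ui : u i = v by apply/lfunP => x; rewrite !comp_lfunE !idfam_id.
have uj j : i != j -> u j = 0.
  by move=> ij; rewrite /u (idfam_neq _ ij) comp_lfun0l.
have um j : is_rmorph (u j).
  apply: Defs.rmorph_comp; last exact: idfam_rmorph.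
  by apply: Defs.rmorph_comp => //; exact: idfam_rmorph.
have embu : emb u = sandwich (prX i) (inY i) v.
  rewrite /emb (bigD1_seq i) //= big1 ?addr0 ?ui // => j ji.
  by rewrite uj ?linear0 // eq_sym.
have -> : F i v = f (emb u).
  rewrite fE (bigD1_seq i) //= big1 ?addr0 ?ui // => j ji.
  by rewrite uj ?linear0 // eq_sym.
rewrite gE; last by apply/V0P; exists u.
rewrite -linearB /=; congr (g _); apply/lfunP => z.
rewrite DE embu !lfE !sandwichE !comp_lfunE (@dYE i n) //.
by rewrite (prdX i p).
Qed.

End Flatten.

(** * The Nakayama functor and the Serre pairing *)

Section Nakayama.
Variables (k : fieldType) (A : falgType k).
Implicit Types (M N P : rmodule A).

Definition rhom_space M : {vspace 'Hom(M, A)} :=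
  projT1 (@vspace_of k 'Hom(M, A) (fun f => is_rmorph (f : 'Hom(M, regmod A)))
    (Defs.rmorph0 M (regmod A))
    (fun c f g fm gm => is_rmorphD (rmorphZ c fm) gm)).

Lemma rhom_spaceP M f : f \in rhom_space M <-> is_rmorph (f : 'Hom(M, regmod A)).
Proof. exact: (projT2 (@vspace_of k 'Hom(M, A) _ _ _)). Qed.

Definition mdual M : vectType k := subvs_of (rhom_space M).

(* Locked, lest [comp_lfunE] rewrite inside it. *)
Definition mdual_lmul M (a : A) : 'End(mdual M) :=
  locked (lvsproj _ \o (sandwich \1%VF (amull a) \o lvsval (rhom_space M)))%VF.

Lemma mdual_eq M (f g : mdual M) :
  (forall x, (vsval f : 'Hom(M, A)) x = (vsval g : 'Hom(M, A)) x) -> f = g.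
Proof. by move=> fg; apply: val_inj; apply/lfunP. Qed.

Lemma mdual_ract M (f : mdual M) a x :
  (vsval f : 'Hom(M, A)) (ract M a x) = (vsval f : 'Hom(M, A)) x * a.
Proof. by have /rhom_spaceP/(ract_rmap a x) := subvsP f; rewrite regmodE. Qed.

Lemma mdual_lmulE M a (f : mdual M) x :
  (vsval (mdual_lmul M a f) : 'Hom(M, A)) x = a * (vsval f : 'Hom(M, A)) x.
Proof.
rewrite /mdual_lmul -lock !comp_lfunE lvsprojE lvsvalE sandwichE comp_lfun1r vsprojK.
  by rewrite comp_lfunE lfunE.
apply/rhom_spaceP; apply: is_rmorphI => b y; rewrite regmodE !comp_lfunE !lfunE /=.
by rewrite mdual_ract mulrA.
Qed.

(* The Nakayama functor: [nakayama M] is the k-dual of the left module [Hom_A(M, A)]. *)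
Definition nakayama M : rmodule A.
Proof.
refine (@RModule k A 'Hom(mdual M, k^o)
  (fun a => sandwich (mdual_lmul M a) (\1%VF : 'End(k^o))) _ _ _).
- move=> c a b; apply/lfunP => h; apply/lfunP => f.
  rewrite !lfE !sandwichE !lfE -linearZ -linearD; congr (h _).
  by apply: mdual_eq => x; rewrite mdual_lmulE !lfE !mdual_lmulE mulrDl scalerAl.
- apply/lfunP => h; apply/lfunP => f; rewrite sandwichE !lfE; congr (h _).
  by apply: mdual_eq => x; rewrite mdual_lmulE mul1r.
- move=> a b; apply/lfunP => h; apply/lfunP => f; rewrite comp_lfunE !sandwichE !lfE.
  by congr (h _); apply: mdual_eq => x; rewrite !mdual_lmulE mulrA.
Defined.

Lemma nakayama_ract M a (h : nakayama M) (f : mdual M) :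
  (ract (nakayama M) a h : 'Hom(mdual M, k^o)) f =
  (h : 'Hom(mdual M, k^o)) (mdual_lmul M a f).
Proof. by rewrite [LHS](congr1 (fun g : 'Hom(_, _) => g f) (sandwichE _ _ h)) !lfE. Qed.

Lemma nakayama_eq M (h h' : nakayama M) :
  (forall f, (h : 'Hom(mdual M, k^o)) f = (h' : 'Hom(mdual M, k^o)) f) -> h = h'.
Proof. by move=> H; apply/lfunP. Qed.

Definition mdual_map M N (g : 'Hom(M, N)) : 'Hom(mdual N, mdual M) :=
  locked (lvsproj _ \o (sandwich g \1%VF \o lvsval (rhom_space N)))%VF.

Lemma mdual_mapE M N (g : 'Hom(M, N)) (f : mdual N) x : is_rmorph g ->
  (vsval (mdual_map g f) : 'Hom(M, A)) x = (vsval f : 'Hom(N, A)) (g x).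
Proof.
move=> gm; rewrite /mdual_map -lock !comp_lfunE lvsprojE lvsvalE sandwichE comp_lfun1l.
rewrite vsprojK ?comp_lfunE //.
by apply/rhom_spaceP; apply: (@Defs.rmorph_comp k A M N (regmod A)) => //; exact/rhom_spaceP/subvsP.
Qed.

Definition nakayama_map M N (g : 'Hom(M, N)) : 'Hom(nakayama M, nakayama N) :=
  sandwich (mdual_map g) (\1%VF : 'End(k^o)).

Lemma nakayama_mapE M N (g : 'Hom(M, N)) (h : nakayama M) (f : mdual N) :
  (nakayama_map g h : 'Hom(mdual N, k^o)) f = (h : 'Hom(mdual M, k^o)) (mdual_map g f).
Proof. by rewrite [LHS](congr1 (fun g : 'Hom(_, _) => g f) (sandwichE _ _ h)) !lfE. Qed.

Lemma nakayama_map_rmorph M N (g : 'Hom(M, N)) : is_rmorph g -> is_rmorph (nakayama_map g).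
Proof.
move=> gm; apply: is_rmorphI => a h; apply: nakayama_eq => f.
rewrite nakayama_mapE !nakayama_ract nakayama_mapE; congr (fun_of_lfun _ _).
by apply: mdual_eq => x; rewrite mdual_lmulE !mdual_mapE // mdual_lmulE.
Qed.

(** The map attached to the tensor of [y] with [f]; for projective [M] such maps span the module
    maps from [M] to [N]. *)
Definition tens M N (y : N) (f : 'Hom(M, A)) : 'Hom(M, N) :=
  linfun (fun x => ract N (f x) y).

Lemma tensE M N (y : N) (f : 'Hom(M, A)) x : tens y f x = ract N (f x) y.
Proof. by rewrite linfun_linE // => c u v; rewrite linearP ract_linearl. Qed.

Lemma tens_rmorph M N (y : N) (f : mdual M) : is_rmorph (tens y (vsval f)).
Proof. by apply: is_rmorphI => a x; rewrite !tensE mdual_ract ractME. Qed.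

Lemma tens_linr M N (y : N) : linear (fun f : mdual M => tens y (vsval f)).
Proof.
by move=> c f g; apply/lfunP => x; rewrite !lfE !tensE !lfE ract_linearl.
Qed.

(* Serre duality: for projective [M] this identifies the dual of [Hom_A(M, N)] with
   [Hom_A(N, nakayama M)]. *)
Definition serre M N (F : 'Hom('Hom(M, N), k^o)) : 'Hom(N, nakayama M) :=
  linfun (fun y => (F \o linfun (fun f : mdual M => tens y (vsval f)))%VF).

Lemma serreE M N (F : 'Hom('Hom(M, N), k^o)) y (f : mdual M) :
  (serre F y : 'Hom(mdual M, k^o)) f = F (tens y (vsval f)).
Proof.
rewrite linfun_linE; first by rewrite comp_lfunE linfun_linE //; exact: tens_linr.
move=> c u v; apply/lfunP => g; rewrite !lfE !linfun_linE; try exact: tens_linr.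
rewrite -linearP; congr (F _); apply/lfunP => x.
by rewrite !lfE !tensE linearP.
Qed.

Lemma serre_rmorph M N (F : 'Hom('Hom(M, N), k^o)) : is_rmorph (serre F).
Proof.
apply: is_rmorphI => a y; apply: nakayama_eq => f; rewrite nakayama_ract !serreE.
by congr (F _); apply/lfunP => x; rewrite !tensE mdual_lmulE ractME.
Qed.

Lemma serre0 M N : serre (0 : 'Hom('Hom(M, N), k^o)) = 0.
Proof.
apply/lfunP => y; apply: nakayama_eq => f; rewrite serreE zero_lfunE.
have -> : (0 : 'Hom(N, nakayama M)) y = 0 by exact: zero_lfunE.
exact/esym/zero_lfunE.
Qed.

(* Both sides are the trace of [h \o d], computed with dual bases of [M] and of [N]. *)
Lemma trace_swap M N (d : 'Hom(M, N)) (h : 'Hom(N, nakayama M)) m n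
    (x : 'I_m -> M) (e : 'I_m -> mdual M) (y : 'I_n -> N) (f : 'I_n -> mdual N) :
  is_rmorph d -> is_rmorph h ->
  (forall v, v = \sum_i ract M ((vsval (e i) : 'Hom(M, A)) v) (x i)) ->
  (forall v, v = \sum_i ract N ((vsval (f i) : 'Hom(N, A)) v) (y i)) ->
  \sum_i (h (d (x i)) : 'Hom(mdual M, k^o)) (e i) =
  \sum_j (h (y j) : 'Hom(mdual M, k^o)) (mdual_map d (f j)).
Proof.
move=> dm hm xE yE.
transitivity (\sum_i \sum_j (h (y j) : 'Hom(mdual M, k^o))
    (mdual_lmul M ((vsval (f j) : 'Hom(N, A)) (d (x i))) (e i))).
  apply: eq_bigr => i _; rewrite [d (x i) in LHS]yE linear_sum /= sum_lfunE.
  by apply: eq_bigr => j _; rewrite (ract_rmap _ _ hm) nakayama_ract.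
rewrite exchange_big; apply: eq_bigr => j _ /=; rewrite -linear_sum /=.
congr (fun_of_lfun _ _); apply: mdual_eq => v; rewrite mdual_mapE //.
rewrite [v in RHS]xE !linear_sum /= sum_lfunE; apply: eq_bigr => i _.
by rewrite mdual_lmulE (ract_rmap _ _ dm) mdual_ract.
Qed.

End Nakayama.

(** * Almost split triangles *)

Section AlmostSplit.
Variables (k : fieldType) (A : falgType k).
Implicit Types (X Y Z W : complex A).

(* No sign is put on the shifted differential: by [ar_att_diff] the maps [serre (F i i)]
   anticommute with the differentials. *)
Definition nakayama_shift Y : complex A.
Proof.
refine (@Complex k A (fun i => nakayama (Y (i - 1)))
  (fun i j => nakayama_map (cdiff Y (i - 1) (j - 1)))
  (fun i j => nakayama_map_rmorph (cdiff_rmorph Y _ _)) _ _ (cbound Y).+1 _).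
- move=> i j ij; apply/lfunP => h; apply: nakayama_eq => f.
  rewrite nakayama_mapE (_ : mdual_map _ f = 0).
    by rewrite linear0; have -> : (0 : 'Hom(nakayama (Y (i - 1)), nakayama (Y (j - 1)))) h = 0
      by [exact: zero_lfunE]; exact/esym/zero_lfunE.
  apply: mdual_eq => x; rewrite mdual_mapE; last exact: cdiff_rmorph.
  by rewrite cdiff_shape ?zero_lfunE ?linear0 ?zero_lfunE //; move: ij; rewrite addrAC (inj_eq (addIr _)).
- move=> i j l; apply/lfunP => h; apply: nakayama_eq => f.
  rewrite comp_lfunE !nakayama_mapE (_ : mdual_map _ (mdual_map _ f) = 0).
    by rewrite linear0; have -> : (0 : 'Hom(nakayama (Y (i - 1)), nakayama (Y (l - 1)))) h = 0
      by [exact: zero_lfunE]; exact/esym/zero_lfunE.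
  apply: mdual_eq => x; rewrite !mdual_mapE; try exact: cdiff_rmorph.
  by rewrite cdiffKE linear0 zero_lfunE.
- move=> i lti h; apply: nakayama_eq => f; have -> : f = 0.
    apply: mdual_eq => x; rewrite (_ : x = 0) ?linear0 //.
    by apply: (cboundP (c := Y) (i := i - 1)); lia.
  by rewrite linear0; exact/esym/zero_lfunE.
Defined.

Lemma nakayama_shiftE Y i j h (f : mdual (Y (j - 1))) :
  (cdiff (nakayama_shift Y) i j h : 'Hom(mdual (Y (j - 1)), k^o)) f =
  (h : 'Hom(mdual (Y (i - 1)), k^o)) (mdual_map (cdiff Y (i - 1) (j - 1)) f).
Proof. exact: nakayama_mapE. Qed.

Lemma tens_compl (M N P : rmodule A) (g : 'Hom(N, P)) (y : N) (f : 'Hom(M, A)) :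
  is_rmorph g -> tens (g y) f = (g \o tens y f)%VF.
Proof. by move=> gm; apply/lfunP => x; rewrite comp_lfunE !tensE (ract_rmap _ _ gm). Qed.

Lemma tens_compr (M N P : rmodule A) (g : 'Hom(M, N)) (y : P) (f : mdual N) :
  is_rmorph g -> tens y (vsval (mdual_map g f)) = (tens y (vsval f) \o g)%VF.
Proof. by move=> gm; apply/lfunP => x; rewrite comp_lfunE !tensE mdual_mapE. Qed.

Lemma dual_basis (M : rmodule A) : projective M ->
  exists b : {n : nat & (('I_n -> M) * ('I_n -> mdual M))%type},
    forall v, v = \sum_i ract M ((vsval ((projT2 b).2 i) : 'Hom(M, A)) v) ((projT2 b).1 i).
Proof.
move=> [n [x [e [em xE]]]].
exists (existT _ n (x, fun i => vsproj (rhom_space M) (e i))) => v /=.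
by rewrite {1}[v]xE; apply: eq_bigr => i _; rewrite vsprojK //; apply/rhom_spaceP.
Qed.

Section ARTriangle.
Variable Y : complex A.
Hypotheses (Yp : projc Y) (nA : ~ acyclic Y).
Variable F : forall i j, 'Hom('Hom(Y i, Y j), k^o).
Hypothesis F0 : forall i j, i != j -> F i j = 0.
Hypothesis FP : forall s, uniq s -> {subset win Y <= s} ->
  (forall e : cmap Y Y, ~ ciso e -> \sum_(i <- s) F i i (e i) = 0) /\
  \sum_(i <- s) F i i \1%VF = 1.

Lemma nullh_not_ciso (e : cmap Y Y) : nullh e -> ~ ciso e.
Proof.
move=> en ei; apply: nA => i x xZ; rewrite -(cinvVK ei x).
by apply: nullh_coc en _; exact: cmap_coc.
Qed.

(** Taken alone as a homotopy, [h] has a boundary with only two components, [h \o d] in degree [a]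
    and [d \o h] in degree [b]. Being null-homotopic it is not an isomorphism, so [F] kills it. The
    copies [a'] and [b'] absorb equalities of degrees. *)
Lemma functional_boundary a a' b b' (h : 'Hom(Y b, Y a)) :
  is_rmorph h -> a' = a -> b' = b -> b = a + 1 ->
  F a' a (h \o cdiff Y a' b)%VF + F b b' (cdiff Y a b' \o h)%VF = 0.
Proof.
move=> hm -> -> eb; have ab : a != b by rewrite eb; lia.
pose hf i j : 'Hom(Y i, Y j) := (idfam Y a j \o (h \o idfam Y i b))%VF.
have hfm i j : is_rmorph (hf i j).
  apply: Defs.rmorph_comp; last exact: idfam_rmorph.
  by apply: Defs.rmorph_comp => //; exact: idfam_rmorph.
have hfE x : hf b a x = h x by rewrite !comp_lfunE !idfam_id.
have hf0 i j x : i != b \/ a != j -> hf i j x = 0.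
  by rewrite !comp_lfunE => -[] /idfam_neq ->; rewrite zero_lfunE ?linear0 ?zero_lfunE.
have [s [su sa sb sub]] : exists s : seq int,
    [/\ uniq s, a \in s, b \in s & {subset win Y <= s}].
  exists (undup (a :: b :: win Y)); split; first exact: undup_uniq.
  - by rewrite mem_undup mem_head.
  - by rewrite mem_undup 2!in_cons eqxx orbT.
  - by move=> i iY; rewrite mem_undup 2!in_cons iY !orbT.
have := proj1 (FP su sub) _ (nullh_not_ciso (bnd_nullh hfm)).
rewrite (bigD1_seq a) //= (big_rem b) //= [b == a]eq_sym (negPf ab) /=.
rewrite big_seq_cond big1 ?addr0 => [|i /andP[]].
  have -> : (bnd_fun hf a) = (h \o cdiff Y a b)%VF.
    apply/lfunP => x; rewrite [LHS](bndE hfm (p := a - 1) (n := b)) // hf0; last by left.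
    by rewrite linear0 add0r hfE comp_lfunE.
  have -> : (bnd_fun hf b) = (cdiff Y a b \o h)%VF.
    apply/lfunP => x; rewrite [LHS](bndE hfm (p := a) (n := b + 1)) //; last by rewrite eb addrK.
    by rewrite hfE hf0 ?addr0 ?comp_lfunE //; right.
  by [].
rewrite mem_rem_uniq // !inE => /andP[ib _] ia.
have -> : bnd_fun hf i = 0; last by rewrite linear0.
apply/lfunP => x; rewrite [LHS](bndE hfm (p := i - 1) (n := i + 1)) // !hf0.
- by rewrite linear0 addr0 zero_lfunE.
- by right; rewrite eq_sym.
- by left.
Qed.

(** For [j = i + 1] this is the Serre dual of the functional in degree [i], landing in the Nakayama
    dual of the same term of [Y], which the shift has placed in degree [j]. *)
Definition ar_att i j : 'Hom(Y i, nakayama_shift Y j) := serre (F (j - 1) i).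

Lemma ar_att_rmorph i j : is_rmorph (ar_att i j).
Proof. exact: serre_rmorph. Qed.

Lemma ar_att_shape i j : j != i + 1 -> ar_att i j = 0.
Proof.
by move=> ij; rewrite /ar_att F0 ?serre0 //; apply: contraNneq ij => <-; rewrite subrK.
Qed.

Lemma ar_att_diff i j l z : j = i + 1 -> l = j + 1 ->
  cdiff (nakayama_shift Y) j l (ar_att i j z) + ar_att j l (cdiff Y i j z) = 0.
Proof.
move=> ej el; apply: nakayama_eq => f; rewrite [LHS]add_lfunE nakayama_shiftE !serreE.
rewrite tens_compr ?tens_compl; try exact: cdiff_rmorph.
rewrite functional_boundary; [|exact: tens_rmorph|lia|lia|lia].
exact/esym/zero_lfunE.
Qed.

Definition ar_middle : complex A := tw ar_att_rmorph ar_att_shape ar_att_diff.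
Definition ar_proj : cmap ar_middle Y := tw_snd ar_att_rmorph ar_att_shape ar_att_diff.

(* A section would write every [F i i \1] as a difference [S (i + 1) - S i], but these
   values sum to [1]. *)
Lemma ar_no_section (s : cmap Y ar_middle) : (forall i x, ar_proj i (s i x) = x) -> False.
Proof.
move=> sP; have [B BP] := dchoice (fun i => dual_basis (Yp i)).
pose n i := projT1 (B i); pose x i : 'I_(n i) -> Y i := (projT2 (B i)).1.
pose e i : 'I_(n i) -> mdual (Y i) := (projT2 (B i)).2.
have xE i v : v = \sum_l ract (Y i) ((vsval (e i l) : 'Hom(Y i, A)) v) (x i l) by exact: BP.
pose b i : 'Hom(Y i, nakayama (Y (i - 1))) := (lfst _ _ \o s i)%VF.
have bm i : is_rmorph (b i).
  apply: (@Defs.rmorph_comp k A (Y i) (ar_middle i)); first exact: cfun_rmorph.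
  exact: (@lfst_rmorph k A (nakayama (Y (i - 1))) (Y i)).
have bE i y : b i y = (s i y).1 by rewrite comp_lfunE lfstE.
have sE i y : (s i y).2 = y by rewrite -[RHS](sP i) tw_sndE.
have bd i j y : b j (cdiff Y i j y) =
    nakayama_map (cdiff Y (i - 1) (j - 1)) (b i y) + serre (F (j - 1) i) y.
  by rewrite bE cmapE twE sE -bE.
pose S i := \sum_l (b i (x i l) : 'Hom(mdual (Y (i - 1)), k^o)) (mdual_map (cdiff Y (i - 1) i) (e i l)).
(* Computing the trace [S] of the next degree with [trace_swap] and the chain map equation of the
   section gives [S i] plus the pairing of [serre (F i i)] with a dual basis. The latter is [F] at
   the identity, since the tensors of dual basis elements sum to the identity. *)
have key i i' j (b' : 'Hom(Y j, nakayama (Y i'))) : is_rmorph b' -> i' = i ->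
    (forall y, b' (cdiff Y i j y) = nakayama_map (cdiff Y (i - 1) i') (b i y) + serre (F i' i) y) ->
    F i i \1%VF = \sum_l (b' (x j l) : 'Hom(mdual (Y i'), k^o)) (mdual_map (cdiff Y i' j) (e j l)) - S i.
  move=> bm' ei; move: b' bm'; rewrite ei => b' bm' bd'.
  rewrite -(trace_swap (cdiff_rmorph Y i j) bm' (xE i) (xE j)).
  under eq_bigr => l _ do rewrite bd' add_lfunE nakayama_mapE serreE.
  rewrite big_split /= addrAC subrr add0r -linear_sum /=; congr (F i i _).
  apply/lfunP => v; rewrite id_lfunE sum_lfunE [LHS](xE i).
  by apply: eq_bigr => l _; rewrite tensE.
have SE i : F i i \1%VF = S (i + 1) - S i.
  by apply: key => [||y]; [exact: bm | rewrite addrK | exact: bd].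
have S0 i : i \notin win Y -> S i = 0.
  move=> Hi; rewrite /S big1 // => l _; rewrite (win_out (x i l) Hi) linear0.
  exact: zero_lfunE.
(* Both this list and its translate by 1 contain the support, so the two sums in the telescoping
   difference agree. *)
set s' := undup (win Y ++ [seq i - 1 | i <- win Y]).
have su : uniq s' := undup_uniq _.
have sub : {subset win Y <= s'} by move=> i iY; rewrite mem_undup mem_cat iY.
have [_] := FP su sub; under eq_bigr => i _ do rewrite SE.
rewrite big_split /= sumrN (big_win _ su sub S0).
have -> : \sum_(i <- s') S (i + 1) = \sum_(i <- [seq i + 1 | i <- s']) S i by rewrite big_map.
rewrite (big_win (X := Y) +%R) //; last 1 first.
- move=> i iY; apply/mapP; exists (i - 1); last by rewrite subrK.
  by rewrite mem_undup mem_cat; apply/orP; right; apply/mapP; exists i.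
- by rewrite subrr => /eqP; rewrite eq_sym oner_eq0.
- by rewrite map_inj_uniq // => i j /addIr.
Qed.

(** By hypothesis every [u \o v] is a non-isomorphism, so composing [F] with [u] kills all chain
    maps from [Y] to [X]. By [functional_homotopy] it is a coboundary of some [G], and the Serre
    dual of [G] is the homotopy needed to lift [u] to the twisted sum. *)
Lemma ar_lift X (u : cmap X Y) : (forall v : cmap Y X, ~ ciso (cmap_comp u v)) ->
  exists w : cmap X ar_middle, forall i x, ar_proj i (w i x) = u i x.
Proof.
move=> nu; pose F' i : 'Hom('Hom(Y i, X i), k^o) := (F i i \o sandwich \1%VF (u i))%VF.
have F'E i v : F' i v = F i i (u i \o v)%VF by rewrite comp_lfunE sandwichE comp_lfun1r.
have [|G GE] := @functional_homotopy _ _ Y X F'.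
  move=> s su sub v; rewrite -[RHS](proj1 (FP su sub) _ (nu v)).
  by apply: eq_bigr => i _; rewrite F'E.
have K i i' p n (v : 'Hom(Y i', X i)) : is_rmorph v -> i' = i -> p = i - 1 -> n = i + 1 ->
    G i' n (cdiff X i n \o v)%VF = G p i (v \o cdiff Y p i')%VF + F i' i (u i \o v)%VF.
  move=> vm ei; move: v vm; rewrite ei => v vm ep en.
  by rewrite -F'E (GE i p n v vm ep en) addrC subrK.
pose b i : 'Hom(X i, nakayama_shift Y i) := serre (G (i - 1) i).
have bm i : is_rmorph (b i) by exact: serre_rmorph.
have bd i j w : j = i + 1 ->
    b j (cdiff X i j w) = cdiff (nakayama_shift Y) i j (b i w) + ar_att i j (u i w).
  move=> ej; apply: nakayama_eq => f; rewrite [RHS]add_lfunE nakayama_shiftE !serreE.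
  rewrite tens_compr ?tens_compl; try (exact: cdiff_rmorph || exact: cfun_rmorph).
  by apply: K => //; [exact: tens_rmorph | lia].
exists (tw_in ar_att_rmorph ar_att_shape ar_att_diff bm bd) => i x.
by rewrite tw_sndE tw_inE.
Qed.

End ARTriangle.
End AlmostSplit.

(** * The theorem *)

Section Finiteness.
Variables (k : fieldType) (A : falgType k).
Implicit Types (X Y Z W T Q : complex A).

Definition indp X := projc X /\ cind X.

Definition nonnull X Y (f : cmap X Y) := ~ nullh f.

Lemma nonnull_ext X Y (f g : cmap X Y) :
  (forall i x, f i x = g i x) -> nonnull f -> nonnull g.
Proof. by move=> fg nf /nullh_eq H; apply: nf; apply: H => i x; rewrite fg. Qed.

Lemma nonnull_compr X Y Z (f : cmap X Y) (g : cmap Y Z) :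
  nonnull (cmap_comp g f) -> nonnull g.
Proof. by move=> nf gn; apply: nf; exact: (nullh_compr f gn). Qed.

Lemma nonnull_src X Y (f : cmap X Y) : projc X -> nonnull f -> ~ acyclic X.
Proof.
move=> Xp nf XA; apply: nf; have H := proj_acyclic_nullh (cmap_id X) Xp XA.
by apply: nullh_eq (nullh_compl f H) => i x; rewrite comp_lfunE id_lfunE.
Qed.

(** The identity of [Q] is the sum of the projections on the summands, so if [a \o u] is not
    null-homotopic, neither is its part through some summand. *)
Lemma indecomposable_parts Q : projc Q -> exists l : seq (complex A),
  (forall Z, List.In Z l -> indp Z) /\
  forall X T (a : cmap Q T) (u : cmap X Q), nonnull (cmap_comp a u) ->
    exists Z (i : cmap Z Q) (v : cmap X Z),
      List.In Z l /\ nonnull (cmap_comp (cmap_comp a i) v).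
Proof.
move: Q; apply: cdec_ind => [Q Qp Qi|Q Y Z i1 r1 i2 r2 S Qp Yp Zp [l1 [g1 H1]] [l2 [g2 H2]]].
  exists [:: Q]; split=> [Z [<-|[]]|X T a u nau]; first by split.
  exists Q, (cmap_id Q), u; split; first by left.
  by apply: nonnull_ext nau => i x; rewrite /= !lfE.
exists (l1 ++ l2); split=> [W /(List.in_app_or l1 l2)[/g1|/g2] //|X T a u nau].
have [_ _ ir] := S.
have [n1|n2] : nonnull (cmap_comp (cmap_comp a i1) (cmap_comp r1 u)) \/
    nonnull (cmap_comp (cmap_comp a i2) (cmap_comp r2 u)).
  apply: contrapT => /not_orP[/contrapT n1 /contrapT n2]; apply: nau.
  apply: nullh_eq (nullhD n1 n2) => i x; rewrite /= !lfE -linearD.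
  by rewrite ir.
- have [W [i [v [Wl nv]]]] := H1 _ _ _ _ n1; exists W, (cmap_comp i1 i), v.
  split; first by apply/List.in_app_iff; left.
  by apply: nonnull_ext nv => j x; rewrite /= !lfE.
- have [W [i [v [Wl nv]]]] := H2 _ _ _ _ n2; exists W, (cmap_comp i2 i), v.
  split; first by apply/List.in_app_iff; right.
  by apply: nonnull_ext nv => j x; rewrite /= !lfE.
Qed.

Definition noniso X Y := forall f : cmap X Y, ~ ciso f.

(* [l] plays the role of the summands of the middle term of the almost split triangle
   ending at [Y]. *)
Definition radical_source Y (l : seq (complex A)) :=
  forall X T (g : cmap Y T) (u : cmap X Y), indp X -> noniso X Y ->
    nonnull (cmap_comp g u) -> exists Z (p : cmap Z Y) (v : cmap X Z),
      [/\ List.In Z l, ~ ciso p & nonnull (cmap_comp (cmap_comp g p) v)].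

Section Bounded.
Variable N : nat.
Hypothesis HN : forall X : complex A, db_indecomposable X -> (hr X <= N)%N.

Lemma radical_source_ex Y : indp Y -> exists l : seq (complex A),
  (forall Z, List.In Z l -> indp Z) /\ radical_source Y l.
Proof.
move=> [Yp Yi]; have [YA|nA] := pselect (acyclic Y).
  exists [::]; split=> // X T g u [Xp _] _ ngu; case: ngu.
  exact: (nullh_compl g (proj_acyclic_nullh u Xp YA)).
have [F [F0 FP]] := radical_functional Yi nA.
(* The middle term contains Nakayama duals, so it is replaced by a projective model before being
   decomposed. *)
have [E [q [Ep qq]]] := projective_model_ex HN (ar_middle nA F0 FP).
have [l [lg lP]] := indecomposable_parts Ep.
exists l; split=> // X T g u [Xp Xi] nXY ngu.
(* Were [u \o v] an isomorphism, [X] would be the sum of [im v] and [ker u]. As [Y] is not acyclic,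
   [im v] is nonzero, so [ker u] vanishes and [u] is an isomorphism, against [nXY]. *)
have [v|w wE] := @ar_lift _ _ Y nA F F0 FP X u.
  move=> uvi; apply: (nXY u).
  have vinj i : lker (v i) = 0%VS.
    apply/eqP; rewrite -subv0 -(proj1 (uvi i)); apply/subvP => y.
    by rewrite !memv_ker /= comp_lfunE => /eqP ->; rewrite linear0.
  have usurj i : limg (u i) = fullv.
    apply/eqP; rewrite eqEsubv subvf /= -(proj2 (uvi i)) limg_comp.
    exact/limgS/subvf.
  have C i : (limg (v i) :&: lker (u i) = 0)%VS /\ (limg (v i) + lker (u i) = fullv)%VS.
    have e : \dim (limg (u i \o v i)%VF) = \dim (limg (v i)).
      rewrite limg_comp limg_dim_eq //; apply/eqP; rewrite -subv0; apply/subvP => y.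
      rewrite memv_cap => /andP[/memv_imgP[z _ ->]]; rewrite memv_ker => /eqP uz.
      have : z \in lker (cmap_comp u v i) by rewrite memv_ker /= comp_lfunE uz.
      by rewrite (proj1 (uvi i)) memv0 => /eqP ->; rewrite linear0 mem0v.
    apply: img_ker_compl => //; rewrite usurj; congr (\dim _); exact: (proj2 (uvi i)).
  have := @cind_compl _ _ X (fun i => limg (v i)) (fun i => lker (u i)) Xi.
  case.
  - by move=> j a _ /memv_imgP[x _ ->]; rewrite -cfun_ract memv_img ?memvf.
  - by move=> j a x; rewrite !memv_ker !cfun_ract => /eqP ->; rewrite linear0.
  - by move=> j m _ /memv_imgP[x _ ->]; rewrite -cmapE memv_img ?memvf.
  - by move=> j m x; rewrite !memv_ker !cmapE => /eqP ->; rewrite linear0.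
  - by move=> j; case: (C j).
  - by move=> j; case: (C j).
  - move=> H; exfalso; apply: (nA) => i y _; suff -> : y = 0 by exact: mem0v.
    apply/eqP; rewrite -memv0 -(vinj i) memv_ker -memv0 -(H i).
    by rewrite memv_img ?memvf.
  - by move=> H i; split.
have [s Hs] := qis_lift w Xp qq.
pose p0 := cmap_comp (ar_proj nA F0 FP) q.
have n1 : nonnull (cmap_comp (cmap_comp g p0) s).
  move=> H; apply: ngu.
  have H1 := nullh_compl (cmap_comp g (ar_proj nA F0 FP)) (nullhN Hs).
  apply: nullh_eq (nullhD H H1) => i x.
  rewrite add_lfunE /= !lfE /= opprB linearB /= linearB /= wE.
  by rewrite addrC subrK.
have [Z [i [v [Zl nv]]]] := lP _ _ _ _ n1.
exists Z, (cmap_comp p0 i), v; split=> //.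
  (* If [p] were invertible, its inverse followed by [i] and [q] would be a section of [ar_proj]. *)
  move=> pi; apply: (@ar_no_section _ _ Y Yp nA F F0 FP
    (cmap_comp q (cmap_comp i (cinv pi)))) => j x.
  by rewrite -[RHS](cinvVK pi) /= !lfE.
by apply: nonnull_ext nv => j x; rewrite /= !lfE.
Qed.

Lemma radical_sources l : (forall Y, List.In Y l -> indp Y) ->
  exists l' : seq (complex A), (forall Z, List.In Z l' -> indp Z) /\
    forall Y, List.In Y l -> radical_source Y l'.
Proof.
elim: l => [_|Y l IHl lg]; first by exists [::].
have [l1 [g1 H1]] := IHl (fun Z Zl => lg Z (or_intror Zl)).
have [l2 [g2 H2]] := radical_source_ex (lg Y (or_introl erefl)).
exists (l1 ++ l2); split=> [Z /(List.in_app_or l1 l2)[/g1|/g2] //|Z [<-|/H1 HZ] X T g u Xg nXY ngu].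
  have [W [p [v [Wl np nv]]]] := H2 _ _ _ _ Xg nXY ngu.
  by exists W, p, v; split=> //; apply/List.in_app_iff; right.
have [W [p [v [Wl np nv]]]] := HZ _ _ _ _ Xg nXY ngu.
by exists W, p, v; split=> //; apply/List.in_app_iff; left.
Qed.

(** As [X] is not isomorphic to the current source [Z], the map [v] factors through a radical source
    of [Z], which prolongs the path at its beginning. Keeping the composite to [T] from being
    null-homotopic makes every object on the path non-acyclic, so that the bound [M] applies to
    it. *)
Lemma radical_chains T M n : projc T ->
  (forall Q, projc Q -> cind Q -> ~ acyclic Q -> (tdim Q <= M)%N) ->
  exists l : seq (complex A), (forall Z, List.In Z l -> indp Z) /\
    forall X (u : cmap X T), indp X -> (forall Y, List.In Y l -> noniso X Y) -> nonnull u ->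
      exists Z Z0 (p : cmap Z Z0) (g : cmap Z0 T) (v : cmap X Z),
        [/\ List.In Z l, radpath M n p & nonnull (cmap_comp (cmap_comp g p) v)].
Proof.
move=> Tp HM; elim: n => [|n [l [lg lP]]].
  have [l [lg lP]] := indecomposable_parts Tp; exists l; split=> // X u Xg _ nu.
  have [|Z [i [v [Zl nv]]]] := lP X T (cmap_id T) u.
    by apply: nonnull_ext nu => i x; rewrite /= !lfE.
  have [Zp Zi] := lg _ Zl.
  have Zs : small M Z.
    split=> //; apply: HM => //; apply: (nonnull_src Zp (nonnull_compr nv)).
  exists Z, Z, (cmap_id Z), i, v; split=> //.
  by apply: nonnull_ext nv => j x; rewrite /= !lfE.
have [l' [l'g l'P]] := radical_sources lg.
exists (l ++ l'); split=> [Z /(List.in_app_or l l')[/lg|/l'g] //|X u Xg nX nu].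
have [|Z [Z0 [p [g [v [Zl pp nv]]]]]] := lP _ _ Xg _ nu.
  by move=> Y Yl; apply: nX; apply/List.in_app_iff; left.
have [|W [q [w [Wl nq nw]]]] := l'P _ Zl _ _ _ _ Xg _ nv.
  by apply: nX; apply/List.in_app_iff; left.
have [Wp Wi] := l'g _ Wl.
exists W, Z0, (cmap_comp p q), g, w; split.
- by apply/List.in_app_iff; right.
- exists Z, q, p; split=> //; last by move=> i x; rewrite /= lfE.
  by split=> //; apply: HM => //; exact: (nonnull_src Wp (nonnull_compr nw)).
- by apply: nonnull_ext nw => i x; rewrite /= !lfE.
Qed.

Lemma finitely_many_over T : projc T -> exists l : seq (complex A),
  forall X (u : cmap X T), indp X -> nonnull u ->
    exists Y (f : cmap X Y), List.In Y l /\ ciso f.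
Proof.
move=> Tp; have [M HM] := cind_tdim_bound HN.
(* For [m = M] the bound [M - m] of [harada_sai] is 0, so paths of this length compose to zero. *)
have [l [lg lP]] := radical_chains (2 ^ M - 1) Tp HM.
exists l => X u Xg nu; apply: contrapT => H.
have [|Z [Z0 [p [g [v [Zl pp nv]]]]]] := lP X u Xg _ nu.
  by move=> Y Yl f fi; apply: H; exists Y, f.
have [s0 Hs] := harada_sai pp; apply: nv; apply: nullh0 => i x /=.
rewrite !comp_lfunE; suff -> : p i = 0 by rewrite zero_lfunE linear0.
have su : uniq (undup (i :: s0)) by exact: undup_uniq.
have := Hs _ su _; rewrite subnn leqn0 (bigD1_seq i) ?mem_undup ?mem_head //=.
rewrite addn_eq0 dimv_eq0 => H'; have /H'/andP[/eqP pi0 _] :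
    {subset s0 <= undup (i :: s0)} by move=> j sj; rewrite mem_undup in_cons sj orbT.
by apply/lfunP => z; rewrite zero_lfunE; apply/eqP; rewrite -memv0 -pi0 memv_img ?memvf.
Qed.

(** Indecomposability of [X] makes one half of any splitting of its model acyclic. The inclusion of
    the other half is then a quasi-isomorphism, and the induction continues with it. *)
Lemma indp_model X Q (q : cmap Q X) : db_indecomposable X -> projc Q -> quasi_iso q ->
  exists Q' (q' : cmap Q' X), indp Q' /\ quasi_iso q'.
Proof.
move=> /db_indecomposableP[nA HX] Qp.
suff H : forall Q : complex A, projc Q -> forall q : cmap Q X, quasi_iso q ->
    exists Q' (q' : cmap Q' X), indp Q' /\ quasi_iso q' by apply: H.
apply: cdec_ind => [Q1 Q1p Q1i q1 q1q|Q1 Y Z i1 r1 i2 r2 S Q1p Yp Zp IY IZ q1 q1q].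
  by exists Q1, q1.
have [ri1 ri2 ir] := S; have [r12 r21] := splits0 S.
have sq : quasi_iso (csum_in r1 r2).
  apply: ciso_qis; apply: cisoP => i; exists (csum_out i1 i2 i) => x.
    by rewrite csum_inE csum_outE /= ir.
  rewrite csum_outE csum_inE !linearD /= ri1 ri2 r12 r21 add0r addr0.
  by case: x.
have inq Y' Z' (j1 : cmap Y' Q1) (s1 : cmap Q1 Y') (j2 : cmap Z' Q1) (s2 : cmap Q1 Z') :
    splits j1 s1 j2 s2 -> acyclic Z' -> quasi_iso j1.
  move=> [sj1 _ js] Z'A i; split=> [y yZ jy|x xZ].
    by rewrite -(sj1 i y) cmap_cob.
  exists (s1 i x); first exact: cmap_coc.
  rewrite -[x in x - _](js i) addrAC subrr add0r; apply: cmap_cob; apply: Z'A.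
  exact: cmap_coc.
case: (HX _ _ _ _ _ q1q sq) => [YA|ZA].
  apply: (IZ (cmap_comp q1 i2)); apply: qis_comp q1q; apply: inq YA.
  by split=> // i x; rewrite addrC; exact: ir.
by apply: (IY (cmap_comp q1 i1)); apply: qis_comp q1q; apply: inq ZA.
Qed.

End Bounded.

Local Notation DA := (nakayama (regmod A)).

(** Module maps from [X 0] to the dual of [A] correspond to functionals on [X 0]. One that kills the
    coboundaries but not a given cocycle yields a chain map to the stalk; it is not null-homotopic,
    since a stalk has no nonzero coboundaries. *)
Lemma map_to_dual X : ~ Hzero X 0 -> exists u : cmap X (stalk 0 DA), nonnull u.
Proof.
move=> /existsNP[x /not_implyP[xZ /negP xB]].
have [f [fB fx]] := functional_sep xB.
pose ev : 'Hom('Hom(regmod A, X 0), X 0) := linfun (fun h : 'Hom(regmod A, X 0) => h (1 : A)).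
have evE h : ev h = h (1 : A) by rewrite linfun_linE // => c h1 h2; rewrite !lfE.
pose v0 : 'Hom(X 0, DA) := serre (f \o ev)%VF.
have v0E y (g : mdual (regmod A)) : (v0 y : 'Hom(mdual (regmod A), k^o)) g =
    f (ract (X 0) ((vsval g : 'Hom(regmod A, A)) (1 : A)) y).
  by rewrite serreE comp_lfunE evE tensE.
have v0d j y : v0 (cdiff X j 0 y) = 0.
  apply: nakayama_eq => g; rewrite v0E -cdiff_ract fB ?cdiff_cob //.
  exact/esym/zero_lfunE.
pose u i : 'Hom(X i, stalk 0 DA i) := (stalk_in 0 DA i \o (v0 \o idfam X i 0))%VF.
have um i : is_rmorph (u i).
  apply: Defs.rmorph_comp; last exact: stalk_in_rmorph.
  by apply: Defs.rmorph_comp; [exact: idfam_rmorph | exact: serre_rmorph].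
have ud i y : u (i + 1) (cdiff X i (i + 1) y) = cdiff (stalk 0 DA) i (i + 1) (u i y).
  rewrite stalk_dE !comp_lfunE; have [e|ne] := eqVneq (i + 1) 0.
    by rewrite idfam_cdiff // v0d linear0.
  by rewrite (idfam_neq _ ne) zero_lfunE !linear0.
exists (mkcmap um ud) => H; have /stalk_cob := nullh_coc H xZ.
rewrite /= !comp_lfunE idfam_id => /(congr1 (stalk_pr 0 DA 0)).
rewrite stalk_inK // linear0 => v0x.
have idm : (\1%VF : 'Hom(regmod A, A)) \in rhom_space (regmod A).
  by apply/rhom_spaceP; exact: rmorph_id.
have := v0E x (Subvs idm); rewrite v0x /= id_lfunE ract1E fx.
have -> : ((0 : DA) : 'Hom(mdual (regmod A), k^o)) (Subvs idm) = 0 by exact: zero_lfunE.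
by move/eqP; rewrite eq_sym oner_eq0.
Qed.

Lemma derived_bounded_finite : derived_bounded A -> derived_finite A.
Proof.
move=> [N HN]; have [T [t [Tp tq]]] := projective_model_ex HN (stalk 0 DA).
have [l lP] := finitely_many_over HN Tp.
exists (size l), (fun i => nth (complex0 A) l i) => X Xi.
have [nA _] := proj1 (db_indecomposableP X) Xi.
have [m [hm _]] := top_degree nA.
(* The shift moves cohomology of [X] from degree [m] to degree 0, where maps to the dual of [A]
   detect it. *)
have Xmi := shift_indec m Xi.
have [Q0 [q0 [Q0p q0q]]] := projective_model_ex HN (shift m X).
have [Q [q [[Qp Qi] qq]]] := indp_model Xmi Q0p q0q.
have nQ : ~ Hzero Q 0.
  by move/hdim_eq0; rewrite (hdim_qis 0 qq) hdim_shift addr0 => H; rewrite H in hm.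
have [u nu] := map_to_dual nQ.
(* The finiteness statement needs a projective target, so [u] is lifted to [T]; [t \o v] is
   homotopic to [u], so [v] is not null-homotopic either. *)
have [v Hv] := qis_lift u Qp tq.
have nv : nonnull v.
  move=> H; apply: nu; apply: nullh_eq (nullhD (nullh_compl t H) (nullhN Hv)) => i x.
  by rewrite !lfE opprB addrC subrK.
have [Y [f [Yl fi]]] := lP _ _ (conj Qp Qi) nv.
have [i [ltil nthE]] : exists i, (i < size l)%N /\ nth (complex0 A) l i = Y.
  elim: (l) Yl => [//|Z l' IHl /= [<-|/IHl[i [lti <-]]]]; first by exists 0%N.
  by exists i.+1.
exists (Ordinal ltil), (- m); rewrite /= nthE; apply/db_isoP.
exists (shift (- m) Q), (cmap_comp (unshift m X) (shift_map (- m) q)), (shift_map (- m) f).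
split; last exact/qis_shift/ciso_qis.
by apply: qis_comp; [exact: qis_shift | exact: unshift_qis].
Qed.

End Finiteness.

Theorem theoremI (k : closedFieldType) (A : falgType k)
  (hconn : connected_algebra A) (hbasic : basic_algebra A) :
  derived_bounded A <-> derived_finite A.
Proof. by split; [exact: derived_bounded_finite | exact: derived_finite_bounded]. Qed.
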